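(* Let $\phi\colon\mathbb{D}\to\mathbb{D}$ be an analytic self-map. The following assertions are equivalent. (1) There exists a weight $w$ such that $M_wC_\phi\colon H^p\to H^p$ is a nuclear operator for every $p\ge1$. (2) There exists a weight $w$ such that $M_wC_\phi\colon H^p\to H^p$ is $1$-summing for every $p\ge1$ (and hence $r$-summing for every $r\ge1$). (3) There exists a weight $w$ such that $M_wC_\phi\colon H^p\to H^p$ is $r$-summing for some $r\ge1$ and some $p\ge1$. (4) $\displaystyle\int_{\mathbb{T}}\log\frac{1}{1-|\phi^\ast|}\,dm<\infty$.
   Context: $\mathbb{D}$ is the open unit disk, $\mathbb{T}=\partial\mathbb{D}$, $m$ the normalized Lebesgue measure on $\mathbb{T}$, and for $1\le p<\infty$, $H^p$ is the Hardy space. $\phi^\ast$ is the radial limit function of $\phi$ (the integrand in (4) is $+\infty$ where $|\phi^\ast|=1$). A weight for $H^p$ is an analytic function $w\not\equiv0$ in $H^p$ such that $M_wC_\phi\colon f\mapsto w\,(f\circ\phi)$ is a bounded operator $H^p\to H^p$ (in (1) and (2), $w$ is required to be such a weight for every $p\ge1$). An operator $T\colon X\to Y$ between Banach spaces is nuclear if there are $y_n\in Y$, $x_n^\ast\in X^\ast$ with $\sum_n\|x_n^\ast\|\,\|y_n\|<\infty$ and $Tx=\sum_n x_n^\ast(x)y_n$ for all $x$; it is $r$-summing ($1\le r<\infty$) if there is $C>0$ with $\big(\sum_{k=1}^n\|Tx_k\|^r\big)^{1/r}\le C\sup_{x^\ast\in B_{X^\ast}}\big(\sum_{k=1}^n|\langle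 x^\ast,x_k\rangle|^r\big)^{1/r}$ for all finite sequences $x_1,\dots,x_n$ in $X$. *)

(* Defs.v *)
From HB Require Import structures.
From mathcomp Require Import all_boot all_order all_algebra.
From mathcomp Require Import all_classical all_reals all_analysis.
From mathcomp Require Import complex.
Set Implicit Arguments. Unset Strict Implicit. Unset Printing Implicit Defensive.
Import Order.TTheory GRing.Theory Num.Theory.
Local Open Scope classical_set_scope.
Local Open Scope ring_scope.

Section Hardy.
Context {R : realType}.

(* complex-valued functions (only their values on the open unit disk matter) *)
Definition cfun := R[i] -> R[i].

Definition cabs (z : R[i]) : R := Normc.normc z.

Definition inD (z : R[i]) : Prop := cabs z < 1.

(* parametrization of the unit circle T by t in [0,1]; with Lebesgue measure
   on [0,1] this gives the normalized Lebesgue measure m on T *)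
Definition ee (t : R) : R[i] := (cos (2 * pi * t) +i* sin (2 * pi * t))%C.

(* f is analytic on D : f is given on D by a power series centered at 0
   (equivalent to holomorphy on D) *)
Definition analytic_on_D (f : cfun) : Prop :=
  exists a : nat -> R[i], forall z, inD z ->
    (fun n : nat => cabs (\sum_(k < n) a k * z ^+ k - f z)) @ \oo --> 0%R.

Definition circ_mean (p : R) (f : cfun) (r : R) : \bar R :=
  (\int[lebesgue_measure]_(t in `[0%R, 1%R]) ((cabs (f (r%:C * ee t)%C)) `^ p)%:E)%E.

Definition hp_sup (p : R) (f : cfun) : \bar R :=
  ereal_sup [set circ_mean p f r | r in [set r : R | 0 <= r < 1]].

Definition in_Hp (p : R) (f : cfun) : Prop :=
  analytic_on_D f /\ (hp_sup p f < +oo)%E.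

(* the H^p norm (meaningful for f in H^p) *)
Definition hp_norm (p : R) (f : cfun) : R := (fine (hp_sup p f)) `^ p^-1.

Definition dual_Hp (p : R) (x : cfun -> R[i]) : Prop :=
  (forall (a : R[i]) (f g : cfun), in_Hp p f -> in_Hp p g ->
      x (fun z => a * f z + g z) = a * x f + x g) /\
  (exists C : R, forall f, in_Hp p f -> cabs (x f) <= C * hp_norm p f).

Definition dual_norm (p : R) (x : cfun -> R[i]) : \bar R :=
  ereal_sup [set (cabs (x f))%:E | f in [set f | in_Hp p f /\ hp_norm p f <= 1]].

Definition dual_ball (p : R) : set (cfun -> R[i]) :=
  [set x | dual_Hp p x /\ forall f, in_Hp p f -> cabs (x f) <= hp_norm p f].

Definition bounded_op_Hp (p : R) (T : cfun -> cfun) : Prop :=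
  (forall f, in_Hp p f -> in_Hp p (T f)) /\
  (exists C : R, forall f, in_Hp p f -> hp_norm p (T f) <= C * hp_norm p f).

Definition weighted_comp (w phi : cfun) : cfun -> cfun :=
  fun f z => w z * f (phi z).

Definition weight_Hp (p : R) (phi w : cfun) : Prop :=
  in_Hp p w /\ (exists z, inD z /\ w z != 0) /\
  bounded_op_Hp p (weighted_comp w phi).

Definition nuclear_Hp (p : R) (T : cfun -> cfun) : Prop :=
  exists (xs : nat -> (cfun -> R[i])) (ys : nat -> cfun),
    (forall n, dual_Hp p (xs n)) /\ (forall n, in_Hp p (ys n)) /\
    (\sum_(n <oo) (dual_norm p (xs n) * (hp_norm p (ys n))%:E) < +oo)%E /\
    (forall f, in_Hp p f ->
      (fun N : nat => hp_norm p (fun z => T f z - \sum_(n < N) xs n f * ys n z))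
        @ \oo --> 0%R).

Definition summing_Hp (p r : R) (T : cfun -> cfun) : Prop :=
  exists C : R, 0 < C /\
    forall (n : nat) (xs : 'I_n -> cfun), (forall k, in_Hp p (xs k)) ->
      (((\sum_(k < n) (hp_norm p (T (xs k))) `^ r) `^ r^-1)%:E <=
       C%:E * ereal_sup [set ((\sum_(k < n) (cabs (x (xs k))) `^ r) `^ r^-1)%:E
                        | x in dual_ball p])%E.

Definition radial_limit (phi : cfun) (t : R) (L : R[i]) : Prop :=
  (fun r : R => cabs (phi (r%:C * ee t)%C - L)) @ at_left 1 --> 0%R.

(* the radial limit function phi^* (set to 0 where the limit does not exist,
   a null set for bounded analytic phi) *)
Definition phi_star (phi : cfun) (t : R) : R[i] :=
  match pselect (exists L, radial_limit phi t L) with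
  | left h => projT1 (cid h)
  | right _ => 0
  end.

Definition log_integrand (phi : cfun) (t : R) : \bar R :=
  if cabs (phi_star phi t) < 1 then (ln (1 - cabs (phi_star phi t))^-1)%:E
  else +oo%E.

End Hardy.

(* Main.v *)
Require Import Defs.
From HB Require Import structures.
From mathcomp Require Import all_boot all_order all_algebra.
From mathcomp Require Import all_classical all_reals all_analysis.
From mathcomp Require Import measurable_realfun.
From mathcomp Require Import complex ring lra.
Set Implicit Arguments. Unset Strict Implicit. Unset Printing Implicit Defensive.
Import Order.TTheory GRing.Theory Num.Theory.
Import numFieldNormedType.Exports.
Local Open Scope classical_set_scope.
Local Open Scope ring_scope.

(**
(3) => (4): testing the summing inequality on 1, z, ..., z^(N-1) gives
||w phi^N||_p <= C N^(-d) for some d > 0. Summed over N = 2^j with weights b^j,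
1 < b < 2^d, this bounds the circle means of |w| F(|phi|), where F(x) behaves
like a negative power of 1 - x. Multiplying w by the outer function with
modulus F(|phi|) on a circle, the mean value inequality at 0 (after dividing
out the zero of w at 0) bounds the circle means of ln F(|phi|), and Fatou's
lemma transfers the bound to the radial limits.

(4) => (1): by Fatou's theorem phi is the Poisson integral of its radial
limits, so by Jensen's inequality ln 1/(1 - |phi|) is dominated by the Poisson
integral of u = ln 1/(1 - |phi^*|). The outer function w with modulus
exp(-2u) on the circle satisfies |w| <= (1 - |phi|)^2, hence
|w phi^n| <= 2 / ((n + 1)(n + 2)), and f |-> w (f o phi) is the sum of the
rank one operators f |-> a_n(f) w phi^n, a_n the Taylor coefficients.
*)

(** * Complex modulus *)

Section ComplexModulus.
Context {R : realType}.
Implicit Types z w : R[i].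

(** The decay N^(-d) compares two rates. The norms of w phi^k decrease in k, so the left side of the
    summing inequality, before its r-th root, is at least N ||w phi^N||_p^r. On the right, sum_(k <
    N) |x(z^k)| is O(N^(1 - 1/(4p))) over the dual ball, because a polynomial with N unimodular
    coefficients has norm of smaller order than N. No lower bound for ln |w| on circles is at hand.
    The outer factor avoids one: the logarithm is taken of F(|phi|) only, and w enters through a
    single nonzero value at 0. F is used through finite sections, so that ln F(|phi|) is bounded
    boundary data. The exponent 2 in exp(-2u) is there because (1 - x)^2 x^n has a maximum of order
    1/n^2, which is summable, while (1 - x) x^n only gives 1/n. The bounds on w phi^n are sup norm
    bounds and |a_n(f)| <= 2 ||f||_p, so one w serves every p. Since phi^* is chosen pointwise,
    measurability of the log integrand is not at hand; its integral is compared with others by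
    monotonicity alone, or through a measurable boundary function that agrees with phi^* almost
    everywhere. *)

Lemma cabsE z : cabs z = Num.sqrt (complex.Re z ^+ 2 + complex.Im z ^+ 2).
Proof. by case: z. Qed.

Lemma cabs_ge0 z : 0 <= cabs z.
Proof. by rewrite cabsE sqrtr_ge0. Qed.

Lemma cabs_sqr z : cabs z ^+ 2 = complex.Re z ^+ 2 + complex.Im z ^+ 2.
Proof. by rewrite cabsE sqr_sqrtr// addr_ge0// sqr_ge0. Qed.

Lemma cabs0 : cabs (0 : R[i]) = 0.
Proof. exact: Normc.normc0. Qed.

Lemma cabs1 : cabs (1 : R[i]) = 1.
Proof. exact: Normc.normc1. Qed.

Lemma cabsM z w : cabs (z * w) = cabs z * cabs w.
Proof. exact: Normc.normcM. Qed.

Lemma cabsD z w : cabs (z + w) <= cabs z + cabs w.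
Proof. exact: (@le_normcD R z w). Qed.

Lemma cabsN z : cabs (- z) = cabs z.
Proof. exact: (@normcN R z). Qed.

Lemma cabsC z w : cabs (z - w) = cabs (w - z).
Proof. by rewrite -cabsN opprB. Qed.

Lemma cabsB z w : cabs (z - w) <= cabs z + cabs w.
Proof. by rewrite -[leRHS](congr1 (+%R (cabs z)) (cabsN w)) cabsD. Qed.

Lemma cabs_distl z w v : cabs (z - w) <= cabs (z - v) + cabs (v - w).
Proof. by rewrite (_ : z - w = (z - v) + (v - w)) ?cabsD//; ring. Qed.

Lemma cabsV z : cabs z^-1 = (cabs z)^-1.
Proof. exact: Normc.normcV. Qed.

Lemma cabsX z n : cabs (z ^+ n) = cabs z ^+ n.
Proof. by elim: n => [|n IH]; rewrite ?expr0 ?cabs1// !exprS cabsM IH. Qed.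

Lemma cabs_eq0 z : (cabs z == 0) = (z == 0).
Proof. by apply/eqP/eqP => [/Normc.eq0_normc//|->]; rewrite cabs0. Qed.

Lemma cabs_gt0 z : (0 < cabs z) = (z != 0).
Proof. by rewrite lt_neqAle cabs_ge0 andbT eq_sym cabs_eq0. Qed.

Lemma cabs_real (x : R) : cabs x%:C%C = `|x|.
Proof. by rewrite cabsE/= expr0n addr0 sqrtr_sqr. Qed.

Lemma cabs_sum (I : Type) (r : seq I) (P : pred I) (F : I -> R[i]) :
  cabs (\sum_(i <- r | P i) F i) <= \sum_(i <- r | P i) cabs (F i).
Proof.
elim: r => [|i r IH]; first by rewrite !big_nil cabs0.
rewrite !big_cons; case: ifP => // _.
by apply: (le_trans (cabsD _ _)); rewrite lerD2l.
Qed.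

Lemma Re_le_cabs z : `|complex.Re z| <= cabs z.
Proof.
rewrite -(@ler_pXn2r _ 2%N) ?nnegrE ?cabs_ge0// cabs_sqr real_normK ?num_real//.
by rewrite lerDl sqr_ge0.
Qed.

Lemma Im_le_cabs z : `|complex.Im z| <= cabs z.
Proof.
rewrite -(@ler_pXn2r _ 2%N) ?nnegrE ?cabs_ge0// cabs_sqr real_normK ?num_real//.
by rewrite lerDr sqr_ge0.
Qed.

Lemma cabs_le_ReIm z : cabs z <= `|complex.Re z| + `|complex.Im z|.
Proof.
rewrite -(@ler_pXn2r _ 2%N) ?nnegrE ?cabs_ge0 ?addr_ge0// cabs_sqr sqrrD.
rewrite !real_normK ?num_real// lerD2r lerDl mulrn_wge0//.
Qed.

Lemma ReD z w : complex.Re (z + w) = complex.Re z + complex.Re w.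
Proof. by case: z w => [? ?] []. Qed.

Lemma ImD z w : complex.Im (z + w) = complex.Im z + complex.Im w.
Proof. by case: z w => [? ?] []. Qed.

Lemma ReN z : complex.Re (- z) = - complex.Re z.
Proof. by case: z. Qed.

Lemma ImN z : complex.Im (- z) = - complex.Im z.
Proof. by case: z. Qed.

Lemma ReM z w : complex.Re (z * w) =
  complex.Re z * complex.Re w - complex.Im z * complex.Im w.
Proof. by case: z w => [? ?] []. Qed.

Lemma ImM z w : complex.Im (z * w) =
  complex.Re z * complex.Im w + complex.Im z * complex.Re w.
Proof. by case: z w => [a b] [c d] /=; rewrite mulrC addrC [b * c]mulrC addrC mulrC [c * b]mulrC. Qed.

Lemma complex_eq z w : complex.Re z = complex.Re w ->
  complex.Im z = complex.Im w -> z = w.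
Proof. by case: z w => [? ?] [? ?] /= -> ->. Qed.

Lemma mul_conj z : z * (z^*)%C = (cabs z ^+ 2)%:C%C.
Proof. by apply: complex_eq; rewrite ?ReM ?ImM cabs_sqr; case: z => a b /=; ring. Qed.

Lemma cabs_conj z : cabs (z^*)%C = cabs z.
Proof. by rewrite !cabsE; case: z => a b /=; rewrite sqrrN. Qed.

Lemma Re_rotation z : exists2 c : R[i], cabs c = 1 & c * z = (cabs z)%:C%C.
Proof.
have [->|z0] := eqVneq z 0.
  by exists 1; rewrite ?cabs1// mulr0 cabs0.
have cz0 : cabs z != 0 by rewrite cabs_eq0.
exists ((z^*)%C * ((cabs z)^-1)%:C%C).
  by rewrite cabsM cabs_conj cabs_real ger0_norm ?invr_ge0 ?cabs_ge0// divff.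
rewrite mulrAC [_^*%C * _]mulrC mul_conj -rmorphM/= expr2 -mulrA divff// mulr1//.
Qed.

Lemma cabs_ee (t : R) : cabs (ee t) = 1.
Proof. by rewrite cabsE /= cos2Dsin2 sqrtr1. Qed.

Lemma ee_neq0 (t : R) : ee t != 0.
Proof. by rewrite -cabs_eq0 cabs_ee oner_eq0. Qed.

Lemma cabs_rad (r t : R) : cabs (r%:C * ee t)%C = `|r|.
Proof. by rewrite cabsM cabs_ee mulr1 cabs_real. Qed.

Lemma eeX (t : R) n : ee t ^+ n = ee (n%:R * t).
Proof.
elim: n => [|n IH].
  by rewrite expr0 /ee mul0r mulr0 cos0 sin0.
have E : 2 * pi * (n.+1%:R * t) = 2 * pi * t + 2 * pi * (n%:R * t).
  by rewrite -natr1; ring.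
rewrite exprS IH; apply: complex_eq; rewrite ?ReM ?ImM /= E.
  by rewrite [RHS]cosD; ring.
by rewrite [RHS]sinD; ring.
Qed.

Lemma ee_conj (t : R) : ((ee t)^*)%C = ee (- t).
Proof. by rewrite /ee mulrN cosN sinN. Qed.

Lemma eeV (t : R) : (ee t)^-1 = ee (- t).
Proof.
apply: (mulfI (ee_neq0 t)); rewrite divff ?ee_neq0// -ee_conj mul_conj cabs_ee.
by rewrite expr1n.
Qed.

End ComplexModulus.

(** * Integration over the circle *)

Section CircleIntegral.
Context {R : realType}.
Local Notation mu := (@lebesgue_measure R).
Implicit Types (f g u h : R -> R).

Definition Int f : R := \int[mu]_(t in `[0%R, 1%R]) f t.

Definition itg f : Prop := mu.-integrable `[0%R, 1%R] (EFin \o f).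

(* Bounded and measurable on the whole line, not only on the unit interval. *)
Definition bddm f : Prop := measurable_fun setT f /\
  exists M, forall t, `|f t| <= M.

Lemma ae_imply (P Q : R -> Prop) : (forall t, P t -> Q t) ->
  {ae mu, forall t, P t} -> {ae mu, forall t, Q t}.
Proof. by move=> PQ; exact: (@filterS _ (almost_everywhere mu) _ _ _ PQ). Qed.

Lemma ae_imply2 (P Q S : R -> Prop) : (forall t, P t -> Q t -> S t) ->
  {ae mu, forall t, P t} -> {ae mu, forall t, Q t} -> {ae mu, forall t, S t}.
Proof. by move=> PQ; exact: (@filterS2 _ (almost_everywhere mu) _ _ _ _ PQ). Qed.

Lemma mu01 : mu `[0%R, 1%R] = 1%E.
Proof. by rewrite lebesgue_measure_itv/= lte_fin ltr01 oppr0 adde0. Qed.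

Lemma meas01 : measurable (`[0%R, 1%R]%classic : set R).
Proof. exact: measurable_itv. Qed.
Local Hint Resolve meas01 : core.

Lemma itg_EFin f : itg f -> (\int[mu]_(t in `[0%R, 1%R]) (f t)%:E)%E = (Int f)%:E.
Proof. by move=> fi; rewrite /Int /Rintegral fineK//; exact: integrable_fin_num. Qed.

Lemma itgD f g : itg f -> itg g -> itg (fun t => f t + g t).
Proof. by move=> fi gi; exact: (@integrableD _ _ _ mu _ meas01 _ _ fi gi). Qed.

Lemma itgZ k f : itg f -> itg (fun t => k * f t).
Proof. by move=> fi; exact: (@integrableZl _ _ _ mu _ meas01 k _ fi). Qed.

Lemma itgN f : itg f -> itg (fun t => - f t).
Proof.
by move=> /(@itgZ (-1)); congr itg; apply/funext => t; rewrite mulN1r.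
Qed.

Lemma itgB f g : itg f -> itg g -> itg (fun t => f t - g t).
Proof. by move=> fi gi; apply: itgD => //; exact: itgN. Qed.

Lemma bddm_itg f : bddm f -> itg f.
Proof.
move=> [mf [M fM]]; apply: measurable_bounded_integrable => //.
- by rewrite [X in (X < _)%E]mu01 ltry.
- exact: measurable_funTS.
- by exists M; split; [exact: num_real|move=> x Mx t _ /=; rewrite (le_trans (fM t))// ltW].
Qed.

Lemma bddm_cst k : bddm (fun=> k).
Proof. by split; [exact: measurable_cst|exists `|k|]. Qed.

Lemma bddmD f g : bddm f -> bddm g -> bddm (fun t => f t + g t).
Proof.
move=> [mf [M fM]] [mg [N gN]]; split; first exact: measurable_funD.
by exists (M + N) => t; rewrite (le_trans (ler_normD _ _))// lerD.
Qed.

Lemma bddmM f g : bddm f -> bddm g -> bddm (fun t => f t * g t).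
Proof.
move=> [mf [M fM]] [mg [N gN]]; split; first exact: measurable_funM.
by exists (M * N) => t; rewrite normrM ler_pM.
Qed.

Lemma bddmZ k f : bddm f -> bddm (fun t => k * f t).
Proof. by move=> bf; apply: bddmM => //; exact: bddm_cst. Qed.

Lemma bddmN f : bddm f -> bddm (fun t => - f t).
Proof. by move=> /(@bddmZ (-1)); congr bddm; apply/funext => t; rewrite mulN1r. Qed.

Lemma bddmB f g : bddm f -> bddm g -> bddm (fun t => f t - g t).
Proof. by move=> bf bg; apply: bddmD => //; exact: bddmN. Qed.

Lemma bddmX f n : bddm f -> bddm (fun t => f t ^+ n).
Proof.
move=> bf; elim: n => [|n IH]; first exact: bddm_cst.
rewrite (_ : (fun _ => _) = (fun t => f t * f t ^+ n)); first exact: bddmM.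
by apply/funext => t; rewrite exprS.
Qed.

Lemma bddm_sum n (F : nat -> R -> R) : (forall k, bddm (F k)) ->
  bddm (fun t => \sum_(k < n) F k t).
Proof.
move=> bF; elim: n => [|n IH].
  under eq_fun do rewrite big_ord0; exact: bddm_cst.
by under eq_fun do rewrite big_ord_recr/=; exact: bddmD.
Qed.

Lemma bddm_indic (A : set R) : measurable A -> bddm (\1_A).
Proof.
move=> mA; split; first exact: measurable_indic.
by exists 1 => t; rewrite indicE; case: (_ \in _); rewrite ?normr1 ?normr0.
Qed.

Lemma bddm_continuous f M : continuous f -> (forall t, `|f t| <= M) -> bddm f.
Proof. by move=> cf fM; split; [exact: continuous_measurable_fun|exists M]. Qed.

Lemma bddm_cvg (f_ : nat -> R -> R) f M :
  (forall n, measurable_fun setT (f_ n)) -> (forall n t, `|f_ n t| <= M) ->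
  (forall t, f_ n t @[n --> \oo] --> f t) -> bddm f.
Proof.
move=> mf_ f_M cf; split.
  by apply: (@measurable_fun_cvg _ _ _ setT f_ f) => // t _; exact: cf.
exists M => t.
have /(@cvg_norm _ R^o _ _ _ _ _ ) c := cf t.
rewrite -(cvg_lim _ c)//; apply: limr_le; first by apply/cvg_ex; exists `|f t|.
by near=> n; exact: f_M.
Unshelve. all: by end_near. Qed.

Lemma itgM h u : bddm h -> itg u -> itg (fun t => h t * u t).
Proof.
move=> [mh [M hM]] ui.
apply: (@integrableMr _ _ _ mu _ meas01 h (EFin \o u)) => //.
- exact: measurable_funTS.
- by exists M; split; [exact: num_real|move=> x Mx t _ /=; rewrite (le_trans (hM t))// ltW].
Qed.

Lemma itg_norm f : itg f -> itg (fun t => `|f t|).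
Proof. by move=> /integrable_norm. Qed.

Lemma IntD f g : itg f -> itg g -> Int (fun t => f t + g t) = Int f + Int g.
Proof. by move=> *; rewrite /Int RintegralD. Qed.

Lemma IntZ k f : itg f -> Int (fun t => k * f t) = k * Int f.
Proof. by move=> *; rewrite /Int RintegralZl. Qed.

Lemma IntN f : itg f -> Int (fun t => - f t) = - Int f.
Proof. by move=> fi; rewrite -[RHS]mulN1r -IntZ//; congr Int; apply/funext => t; rewrite mulN1r. Qed.

Lemma IntB f g : itg f -> itg g -> Int (fun t => f t - g t) = Int f - Int g.
Proof. by move=> fi gi; rewrite IntD ?IntN//; exact: itgN. Qed.

Lemma Int_cst k : Int (fun=> k) = k.
Proof. by rewrite /Int Rintegral_cst// [X in fine X]mu01 mulr1. Qed.

Lemma Int_sum n (F : nat -> R -> R) : (forall k, itg (F k)) ->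
  Int (fun t => \sum_(k < n) F k t) = \sum_(k < n) Int (F k).
Proof.
move=> iF.
suff [] : itg (fun t => \sum_(k < n) F k t) /\
  Int (fun t => \sum_(k < n) F k t) = \sum_(k < n) Int (F k) by [].
elim: n => [|n [iS IH]].
  under eq_fun do rewrite big_ord0; rewrite Int_cst big_ord0; split => //.
  exact/bddm_itg/bddm_cst.
under eq_fun do rewrite big_ord_recr/=; split; first exact: itgD.
by rewrite IntD// IH big_ord_recr.
Qed.

Lemma Int_le f g : itg f -> itg g -> (forall t, 0 <= t <= 1 -> f t <= g t) ->
  Int f <= Int g.
Proof. by move=> fi gi fg; apply: le_Rintegral => // t /=; rewrite in_itv/=; exact: fg. Qed.

Lemma Int_ge0 f : (forall t, 0 <= f t) -> 0 <= Int f.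
Proof. by move=> f0; apply: Rintegral_ge0. Qed.

Lemma Int_norm f : itg f -> `|Int f| <= Int (fun t => `|f t|).
Proof. by move=> fi; apply: le_normr_Rintegral. Qed.

Lemma Int_dct (f_ : nat -> R -> R) f g : (forall n, measurable_fun setT (f_ n)) ->
  measurable_fun setT f -> {ae mu, forall t, 0 <= t <= 1 -> f_ n t @[n --> \oo] --> f t} ->
  itg g -> (forall n t, `|f_ n t| <= g t) ->
  Int (f_ n) @[n --> \oo] --> Int f.
Proof.
move=> mf_ mf cf gi fg.
have m_ n : measurable_fun (`[0%R, 1%R]%classic : set R) (EFin \o f_ n).
  by apply/measurable_EFinP; exact: measurable_funTS.
have m : measurable_fun (`[0%R, 1%R]%classic : set R) (EFin \o f).
  by apply/measurable_EFinP; exact: measurable_funTS.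
have c : {ae mu, forall t, `[0%R, 1%R]%classic t ->
    (EFin \o f_ n) t @[n --> \oo] --> (EFin \o f) t}.
  apply: ae_imply cf => t ct; rewrite /= in_itv/= => t01.
  by apply/fine_cvgP; split; [exact: nearW|exact: ct].
have b : {ae mu, forall t n, `[0%R, 1%R]%classic t ->
    (`|(EFin \o f_ n) t| <= (EFin \o g) t)%E}.
  by apply: aeW => t n _ /=; rewrite lee_fin.
have [fi _ /=] := @dominated_convergence _ _ _ mu _ meas01
  (fun n => EFin \o f_ n) (EFin \o f) (EFin \o g) m_ m c gi b.
by rewrite itg_EFin// => /fine_cvg.
Qed.

(* No measurability is needed: the integral of a
   nonnegative function is the supremum of the integrals of the simple
   functions below it. *)
Lemma ge0_le_integral_nonmeas (f g : R -> \bar R) (D : set R) :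
  (forall t, D t -> (0 <= f t)%E) -> (forall t, D t -> (f t <= g t)%E) ->
  (\int[mu]_(t in D) f t <= \int[mu]_(t in D) g t)%E.
Proof.
move=> f0 fg.
rewrite !ge0_integralE//; last first.
  by move=> t Dt; exact: le_trans (f0 t Dt) (fg t Dt).
apply: ereal_sup_le => _ [h hf <-]; exists h => // t.
by apply: (le_trans (hf t)); rewrite !patchE; case: ifPn => //; rewrite inE; exact: fg.
Qed.

End CircleIntegral.

(** * Complex-valued integrals and orthogonality of the characters *)

Section ComplexIntegral.
Context {R : realType}.
Implicit Types (f g : R -> R[i]).

Definition cint f : R[i] :=
  (Int (fun t => complex.Re (f t)) +i* Int (fun t => complex.Im (f t)))%C.

Definition citg f := itg (fun t => complex.Re (f t)) /\ itg (fun t => complex.Im (f t)).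

Definition cbddm f := bddm (fun t => complex.Re (f t)) /\ bddm (fun t => complex.Im (f t)).

Lemma cbddm_citg f : cbddm f -> citg f.
Proof. by move=> [? ?]; split; exact: bddm_itg. Qed.

Lemma citgD f g : citg f -> citg g -> citg (fun t => f t + g t).
Proof.
by move=> [a b] [c d]; split; [under eq_fun do rewrite ReD|under eq_fun do rewrite ImD]; exact: itgD.
Qed.

Lemma citgZ c f : citg f -> citg (fun t => c * f t).
Proof.
move=> [a b]; split; [under eq_fun do rewrite ReM|under eq_fun do rewrite ImM].
  by apply: itgB; exact: itgZ.
by apply: itgD; exact: itgZ.
Qed.

Lemma cbddmD f g : cbddm f -> cbddm g -> cbddm (fun t => f t + g t).
Proof.
by move=> [a b] [c d]; split; [under eq_fun do rewrite ReD|under eq_fun do rewrite ImD]; exact: bddmD.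
Qed.

Lemma cbddmM f g : cbddm f -> cbddm g -> cbddm (fun t => f t * g t).
Proof.
move=> [a b] [c d]; split; [under eq_fun do rewrite ReM|under eq_fun do rewrite ImM].
  by apply: bddmB; exact: bddmM.
by apply: bddmD; exact: bddmM.
Qed.

Lemma cbddm_cst c : cbddm (fun=> c).
Proof. by split; exact: bddm_cst. Qed.

Lemma cbddmZ c f : cbddm f -> cbddm (fun t => c * f t).
Proof. by move=> bf; apply: cbddmM => //; exact: cbddm_cst. Qed.

Lemma cbddmN f : cbddm f -> cbddm (fun t => - f t).
Proof. by move=> /(@cbddmZ (-1)); congr cbddm; apply/funext => t; rewrite mulN1r. Qed.

Lemma cbddmB f g : cbddm f -> cbddm g -> cbddm (fun t => f t - g t).
Proof. by move=> bf bg; apply: cbddmD => //; exact: cbddmN. Qed.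

Lemma cbddmX f n : cbddm f -> cbddm (fun t => f t ^+ n).
Proof.
move=> bf; elim: n => [|n IH]; first exact: cbddm_cst.
rewrite (_ : (fun _ => _) = (fun t => f t * f t ^+ n)); first exact: cbddmM.
by apply/funext => t; rewrite exprS.
Qed.

Lemma cbddm_sum n (F : nat -> R -> R[i]) : (forall k, cbddm (F k)) ->
  cbddm (fun t => \sum_(k < n) F k t).
Proof.
move=> bF; elim: n => [|n IH].
  under eq_fun do rewrite big_ord0; exact: cbddm_cst.
by under eq_fun do rewrite big_ord_recr/=; exact: cbddmD.
Qed.

Lemma cbddm_real (u : R -> R) : bddm u -> cbddm (fun t => (u t)%:C%C).
Proof. by move=> bu; split => //=; exact: bddm_cst. Qed.

Lemma measurable_cabs f : measurable_fun setT (fun t => complex.Re (f t)) ->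
  measurable_fun setT (fun t => complex.Im (f t)) ->
  measurable_fun setT (fun t => cabs (f t)).
Proof.
move=> mr mi; under eq_fun do rewrite cabsE.
apply: (measurableT_comp (continuous_measurable_fun (@sqrt_continuous R))).
by apply: measurable_funD; exact: measurable_funX.
Qed.

Lemma bddm_cabs f : cbddm f -> bddm (fun t => cabs (f t)).
Proof.
move=> [[mr [M hM]] [mi [N hN]]]; split; first exact: measurable_cabs.
exists (M + N) => t; rewrite ger0_norm ?cabs_ge0//.
by rewrite (le_trans (cabs_le_ReIm _))// lerD.
Qed.

Lemma cintD f g : citg f -> citg g -> cint (fun t => f t + g t) = cint f + cint g.
Proof.
move=> [a b] [c d]; apply: complex_eq => /=.
  by under eq_fun do rewrite ReD; rewrite IntD.
by under eq_fun do rewrite ImD; rewrite IntD.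
Qed.

Lemma cintZ c f : citg f -> cint (fun t => c * f t) = c * cint f.
Proof.
move=> [a b]; apply: complex_eq; rewrite ?ReM ?ImM /=.
  by under eq_fun do rewrite ReM; rewrite IntB ?IntZ//; exact: itgZ.
by under eq_fun do rewrite ImM; rewrite IntD ?IntZ//; exact: itgZ.
Qed.

Lemma cint_cst c : cint (fun=> c) = c.
Proof. by apply: complex_eq => /=; rewrite Int_cst. Qed.

Lemma cint_sum n (F : nat -> R -> R[i]) : (forall k, citg (F k)) ->
  cint (fun t => \sum_(k < n) F k t) = \sum_(k < n) cint (F k).
Proof.
move=> iF.
suff [] : citg (fun t => \sum_(k < n) F k t) /\
  cint (fun t => \sum_(k < n) F k t) = \sum_(k < n) cint (F k) by [].
elim: n => [|n [iS IH]].
  under eq_fun do rewrite big_ord0; rewrite cint_cst big_ord0; split => //.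
  exact/cbddm_citg/cbddm_cst.
under eq_fun do rewrite big_ord_recr/=; split; first exact: citgD.
by rewrite cintD// IH big_ord_recr.
Qed.

(* Rotate so that the integral becomes real and nonnegative. *)
Lemma cabs_cint f (h : R -> R) : citg f -> itg h ->
  (forall t, 0 <= t <= 1 -> cabs (f t) <= h t) -> cabs (cint f) <= Int h.
Proof.
move=> fi hi fh; have [c c1 cE] := Re_rotation (cint f).
have : complex.Re (c * cint f) = cabs (cint f) by rewrite cE.
rewrite -cintZ// => <- /=; apply: Int_le => //; first by case: (citgZ c fi).
move=> t /fh; apply: le_trans; apply: (le_trans (ler_norm _)).
by rewrite (le_trans (Re_le_cabs _))// cabsM c1 mul1r.
Qed.

Lemma cint_real (u : R -> R) : cint (fun t => (u t)%:C%C) = (Int u)%:C%C.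
Proof. by rewrite /cint /= Int_cst. Qed.

Lemma continuous_cosM (a : R) : continuous (fun t : R => cos (a * t)).
Proof.
move=> t; apply: (@continuous_comp _ _ _ ( *%R a) cos); first exact: mulrl_continuous.
exact: continuous_cos.
Qed.

Lemma continuous_sinM (a : R) : continuous (fun t : R => sin (a * t)).
Proof.
move=> t; apply: (@continuous_comp _ _ _ ( *%R a) sin); first exact: mulrl_continuous.
exact: continuous_sin.
Qed.

Lemma cbddm_eeM (c : R) : cbddm (fun t => ee (c * t)).
Proof.
split => /=; apply: (@bddm_continuous _ _ 1).
- by move=> t; under eq_fun do rewrite mulrA; exact: continuous_cosM.
- by move=> t; rewrite ler_norml cos_geN1 cos_le1.
- by move=> t; under eq_fun do rewrite mulrA; exact: continuous_sinM.
- by move=> t; rewrite ler_norml sin_geN1 sin_le1.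
Qed.

Lemma cbddm_ee : cbddm (@ee R).
Proof. by have := cbddm_eeM 1; congr cbddm; apply/funext => t; rewrite mul1r. Qed.

Lemma cbddm_eeN : cbddm (fun t : R => ee (- t)).
Proof. by have := cbddm_eeM (-1); congr cbddm; apply/funext => t; rewrite mulN1r. Qed.

Lemma Int_cosM (a : R) : a != 0 -> Int (fun t => cos (a * t)) = a^-1 * sin a.
Proof.
move=> a0; rewrite /Int /Rintegral (@continuous_FTC2 R _ (fun t => a^-1 * sin (a * t)) 0 1)//.
- by rewrite /= mulr0 sin0 mulr0 subr0 mulr1.
- exact/continuous_subspaceT/continuous_cosM.
- split.
  + by move=> t _; apply: ex_derive.
  + apply: cvg_at_right_filter; apply: cvgM; [exact: cvg_cst|exact: continuous_sinM].
  + apply: cvg_at_left_filter; apply: cvgM; [exact: cvg_cst|exact: continuous_sinM].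
- by move=> t _; rewrite derive1E derive_val /GRing.scale/=; field.
Qed.

Lemma Int_sinM (a : R) : a != 0 -> Int (fun t => sin (a * t)) = a^-1 * (1 - cos a).
Proof.
move=> a0; rewrite /Int /Rintegral (@continuous_FTC2 R _ (fun t => - a^-1 * cos (a * t)) 0 1)//.
- by rewrite /= mulr0 cos0 mulr1; ring.
- exact/continuous_subspaceT/continuous_sinM.
- split.
  + by move=> t _; apply: ex_derive.
  + apply: cvg_at_right_filter; apply: cvgM; [exact: cvg_cst|exact: continuous_cosM].
  + apply: cvg_at_left_filter; apply: cvgM; [exact: cvg_cst|exact: continuous_cosM].
- by move=> t _; rewrite derive1E derive_val /GRing.scale/=; field.
Qed.

(** The hypothesis [ee c = 1] says that c is an integer, so that sine and cosine take equal values
    at both ends of the interval. In this form [cint_eeXV] can read off that m - n is an integer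
    from its identity for [ee], evaluated at t = 1. *)
Lemma cint_eeM (c : R) : c != 0 -> ee c = 1 -> cint (fun t => ee (c * t)) = 0.
Proof.
move=> c0 [cc sc]; have a0 : 2 * pi * c != 0 by rewrite !mulf_neq0// gt_eqF// pi_gt0.
apply: complex_eq => /=.
  by under eq_fun do rewrite mulrA; rewrite Int_cosM// sc mulr0.
by under eq_fun do rewrite mulrA; rewrite Int_sinM// cc subrr mulr0.
Qed.

Lemma ee1 : ee (1 : R) = 1.
Proof. by apply: complex_eq; rewrite /= mulr1 mulr_natl ?cos2pi ?sin2pi. Qed.

Lemma eeD (s t : R) : ee (s + t) = ee s * ee t.
Proof.
by apply: complex_eq; rewrite ?ReM ?ImM /= mulrDr ?cosD ?sinD//; ring.
Qed.

Lemma cint_eeXV (m n : nat) :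
  cint (fun t : R => ee t ^+ m * ee (- t) ^+ n) = (m == n)%:R.
Proof.
have E t : ee t ^+ m * ee (- t) ^+ n = ee ((m%:R - n%:R) * t) :> R[i].
  by rewrite !eeX -eeD; congr ee; ring.
under eq_fun do rewrite E.
have [->|mn] := eqVneq m n.
  rewrite -[RHS]cint_cst; congr cint; apply/funext => t.
  by rewrite subrr mul0r /ee mulr0 cos0 sin0.
apply: cint_eeM; first by rewrite subr_eq0 eqr_nat.
have := E 1; rewrite mulr1 => <-; rewrite -eeV ee1 invr1 !expr1n mul1r//.
Qed.

End ComplexIntegral.

(** * Analytic functions on the disk *)

Section Analytic.
Context {R : realType}.
Implicit Types (f g : R[i] -> R[i]) (p q : {poly R[i]}).

Lemma cvg0_ex (u : nat -> R) : u @ \oo --> 0 ->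
  forall e : R, 0 < e -> exists N, forall n, (N <= n)%N -> `|u n| < e.
Proof.
move=> /cvgrPdist_lt h e e0; have [N _ Nh] := h e e0.
by exists N => n Nn; have := Nh n Nn; rewrite sub0r normrN.
Qed.

Lemma ex_cvg0 (u : nat -> R) :
  (forall e : R, 0 < e -> exists N, forall n, (N <= n)%N -> `|u n| <= e) -> u @ \oo --> 0.
Proof.
move=> h; apply/cvgrPdist_le => e e0; have [N Nh] := h e e0.
by exists N => // n Nn; rewrite sub0r normrN; exact: Nh.
Qed.

(* On every disk of radius [rho < 1], a uniform limit of polynomials; this is
   equivalent to [analytic_on_D] and stable under the usual operations. *)
Definition poly_approx f := forall rho eps : R, 0 <= rho < 1 -> 0 < eps ->
  exists p, forall z, cabs z <= rho -> cabs (f z - p.[z]) <= eps.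

Definition unif_coef f (a : nat -> R[i]) := forall rho eps : R, 0 <= rho < 1 -> 0 < eps ->
  exists N, forall n, (N <= n)%N -> forall z, cabs z <= rho ->
    cabs (\sum_(k < n) a k * z ^+ k - f z) <= eps.

Lemma geo_sum_le (x : R) n : 0 <= x < 1 -> \sum_(i < n) x ^+ i <= (1 - x)^-1.
Proof.
move=> /andP[x0 x1]; have y0 : 0 < 1 - x by rewrite subr_gt0.
rewrite -[leLHS](mulKf (lt0r_neq0 y0)) ler_piMr ?invr_ge0 ?(ltW y0)//.
have -> : (1 - x) * \sum_(i < n) x ^+ i = 1 - x ^+ n.
  by rewrite -[1 - x]opprB mulNr -subrX1 opprB.
by rewrite lerBlDr lerDl exprn_ge0.
Qed.

Lemma geo_tail_le (x : R) m n : 0 <= x < 1 -> (m <= n)%N ->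
  \sum_(m <= i < n) x ^+ i <= x ^+ m / (1 - x).
Proof.
move=> x01 mn; rewrite -{1}[m]add0n big_addn big_mkord.
under eq_bigr do rewrite exprD mulrC.
rewrite -mulr_sumr ler_wpM2l ?geo_sum_le// exprn_ge0//; by case/andP: x01.
Qed.

(** Abel's argument: convergence at one point s between rho and 1 bounds the terms a_k s^k, so on
    |z| <= rho the series is dominated by a geometric one of ratio rho / s. *)
Lemma analytic_unif_coef f (a : nat -> R[i]) :
  (forall z, inD z -> (fun n => cabs (\sum_(k < n) a k * z ^+ k - f z)) @ \oo --> 0) ->
  unif_coef f a.
Proof.
move=> fa rho eps /andP[rho0 rho1] eps0.
pose s := (1 + rho) / 2; have s0 : 0 < s by rewrite /s; lra.
have s1 : s < 1 by rewrite /s; lra.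
have rs : rho < s by rewrite /s; lra.
have sD : inD s%:C%C by rewrite /inD cabs_real ger0_norm// ltW.
have [N0 hN0] := cvg0_ex (fa _ sD) ltr01.
have aN k : (N0 <= k)%N -> cabs (a k) * s ^+ k <= 2.
  move=> Nk; have h1 := hN0 _ Nk; have h2 := hN0 _ (leqW Nk).
  have -> : cabs (a k) * s ^+ k = cabs (a k * (s%:C%C) ^+ k).
    by rewrite cabsM cabsX cabs_real ger0_norm// ltW.
  move: h2; rewrite big_ord_recr/= => h2.
  set S := \sum_(i < k) _ in h1 h2; set x := a k * _ in h2 *.
  (* A term is the difference of two consecutive partial sums, each within 1 of f(s). *)
  rewrite (_ : x = (S + x - f s%:C%C) - (S - f s%:C%C)); last by ring.
  apply: (le_trans (cabsB _ _)); move: h1 h2; rewrite !ger0_norm ?cabs_ge0//; lra.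
pose x := rho / s; have x0 : 0 <= x by rewrite divr_ge0// ltW.
have x1 : x < 1 by rewrite ltr_pdivrMr// mul1r.
have e2 : 0 < eps * (1 - x) / 2 by rewrite !mulr_gt0// ?subr_gt0// invr_gt0.
have cx : (fun n => x ^+ n) @ \oo --> 0 by apply: cvg_expr; rewrite ger0_norm.
have [N1 hN1] := cvg0_ex cx e2.
exists (maxn N0 N1) => n; rewrite geq_max => /andP[n0 n1] z zr.
have zD : inD z by rewrite /inD (le_lt_trans zr).
(* Both N2 and m depend on z, but the bound for the block of terms from n to m does not, so d may
   tend to 0. *)
apply/ler_addgt0Pr => d d0; have [N2 hN2] := cvg0_ex (fa z zD) d0.
pose m := maxn n N2; have nm : (n <= m)%N := leq_maxl _ _.
apply: (le_trans (cabs_distl _ _ (\sum_(k < m) a k * z ^+ k))); apply: lerD; last first.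
  by apply/ltW/(le_lt_trans (ler_norm _))/hN2; exact: leq_maxr.
rewrite cabsC -!(big_mkord xpredT (fun k => a k * z ^+ k)) (big_cat_nat (leq0n n) nm)/=.
rewrite addrAC subrr add0r; apply: (le_trans (cabs_sum _ _ _)).
apply: (@le_trans _ _ (\sum_(n <= i < m) 2 * x ^+ i)).
  rewrite big_nat [leRHS]big_nat; apply: ler_sum => k /andP[nk km].
  have Nk := leq_trans n0 nk; rewrite cabsM cabsX.
  apply: (@le_trans _ _ (cabs (a k) * rho ^+ k)).
    by rewrite ler_wpM2l ?cabs_ge0// lerXn2r ?nnegrE ?cabs_ge0.
  rewrite (_ : rho = s * x); last by rewrite /x mulrC divfK// gt_eqF.
  by rewrite exprMn mulrA ler_wpM2r ?exprn_ge0// aN.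
rewrite -mulr_sumr; apply: (@le_trans _ _ (2 * (x ^+ n / (1 - x)))).
  by rewrite ler_wpM2l// geo_tail_le// x0.
rewrite mulrA ler_pdivrMr ?subr_gt0// -ler_pdivlMl// mulrC ltW//.
by have := hN1 _ n1; rewrite ger0_norm// exprn_ge0.
Qed.

Lemma unif_coef_poly_approx f a : unif_coef f a -> poly_approx f.
Proof.
move=> fa rho eps r e; have [N hN] := fa rho eps r e.
exists (\poly_(k < N) a k) => z zr; rewrite horner_poly cabsC; exact: hN.
Qed.

Lemma analytic_poly_approx f : analytic_on_D f -> poly_approx f.
Proof. by move=> [a fa]; exact/unif_coef_poly_approx/analytic_unif_coef/fa. Qed.

Lemma cbddm_rad (r : R) : cbddm (fun t : R => (r%:C * ee t)%C).
Proof. exact/cbddmZ/cbddm_ee. Qed.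

Lemma cbddm_horner p (r : R) : cbddm (fun t => p.[(r%:C * ee t)%C]).
Proof.
under eq_fun do rewrite horner_coef.
apply: (@cbddm_sum _ _ (fun k t => p`_k * (r%:C * ee t)%C ^+ k)) => k.
exact/cbddmZ/cbddmX/cbddm_rad.
Qed.

Lemma cint_horner p (r : R) k :
  cint (fun t => p.[(r%:C * ee t)%C] * ee (- t) ^+ k) = p`_k * r%:C%C ^+ k.
Proof.
have -> : (fun t => p.[(r%:C * ee t)%C] * ee (- t) ^+ k) =
   (fun t => \sum_(j < size p) (p`_j * r%:C%C ^+ j) * (ee t ^+ j * ee (- t) ^+ k)).
  apply/funext => t; rewrite horner_coef mulr_suml; apply: eq_bigr => j _.
  by rewrite exprMn !mulrA.
have b j : cbddm (fun t : R => ee t ^+ j * ee (- t) ^+ k).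
  by apply: cbddmM; apply: cbddmX; [exact: cbddm_ee|exact: cbddm_eeN].
rewrite (@cint_sum _ _ (fun j t => p`_j * r%:C%C ^+ j * (ee t ^+ j * ee (- t) ^+ k))); last first.
  by move=> j; exact/citgZ/cbddm_citg/b.
rewrite (eq_bigr (fun j : 'I_(size p) => p`_j * r%:C%C ^+ j * (nat_of_ord j == k)%:R)); last first.
  by move=> j _; rewrite cintZ ?cint_eeXV//; exact/cbddm_citg/b.
have [ks|ks] := ltnP k (size p).
  rewrite (bigD1 (Ordinal ks))//= eqxx mulr1 big1 ?addr0// => j jk.
  by rewrite (negbTE (_ : nat_of_ord j != k)) ?mulr0.
rewrite nth_default// mul0r big1// => j _.
by rewrite (_ : (nat_of_ord j == k) = false) ?mulr0// ltn_eqF// (leq_trans (ltn_ord j)).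
Qed.

Lemma cbddm_unif (f : R -> R[i]) :
  (forall e : R, 0 < e -> exists2 g, cbddm g & forall t, cabs (f t - g t) <= e) -> cbddm f.
Proof.
move=> fa; have e0 (n : nat) : (0 : R) < n.+1%:R^-1 by rewrite invr_gt0.
have fa' (n : nat) : exists g : R -> R[i], cbddm g /\ forall t, cabs (f t - g t) <= n.+1%:R^-1.
  by have [g ? ?] := fa _ (e0 n); exists g.
have /choice[g hg] := fa'.
have bg n : cbddm (g n) by case: (hg n).
have {}hg n t : cabs (f t - g n t) <= n.+1%:R^-1 by case: (hg n).
have [M hM] : exists M, forall t, cabs (f t) <= M.
  have [_ [M hM]] := bddm_cabs (bg 0%N); exists (1 + M) => t.
  rewrite -[f _](subrK (g 0%N t)) (le_trans (cabsD _ _))//.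
  by rewrite lerD//; [rewrite (le_trans (hg _ _))// invr1|rewrite (le_trans _ (hM t))// ler_norm].
have c (F : R[i] -> R) : (forall z w, `|F z - F w| <= cabs (z - w)) ->
    forall t, F (g n t) @[n --> \oo] --> F (f t).
  move=> hF t; apply/cvgrPdist_le => e e1.
  have [N hN] := cvg0_ex (@cvg_harmonic R) e1.
  exists N => // n Nn /=; rewrite (le_trans (hF _ _))// (le_trans (hg _ _))//.
  by rewrite (le_trans (ler_norm _))// ltW// hN.
split; split.
- apply: (@measurable_fun_cvg _ _ _ setT (fun n t => complex.Re (g n t))).
    by move=> n; case: (bg n) => -[].
  by move=> t _; apply: (c (@complex.Re R)) => z w; rewrite -ReN -ReD Re_le_cabs.
- by exists M => t; rewrite (le_trans (Re_le_cabs _)).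
- apply: (@measurable_fun_cvg _ _ _ setT (fun n t => complex.Im (g n t))).
    by move=> n; case: (bg n) => _ [].
  by move=> t _; apply: (c (@complex.Im R)) => z w; rewrite -ImN -ImD Im_le_cabs.
- by exists M => t; rewrite (le_trans (Im_le_cabs _)).
Qed.

Lemma poly_approx_bddm f (r : R) : 0 <= r < 1 -> poly_approx f ->
  cbddm (fun t => f (r%:C * ee t)%C).
Proof.
move=> r01 fa; apply: cbddm_unif => e e0; have [p hp] := fa r e r01 e0.
exists (fun t => p.[(r%:C * ee t)%C]); first exact: cbddm_horner.
by move=> t; apply: hp; rewrite cabs_rad ger0_norm//; case/andP: r01.
Qed.

End Analytic.

(** * Taylor coefficients and closure properties of analytic functions *)

Section AnalyticClosure.
Context {R : realType}.
Implicit Types (f g : R[i] -> R[i]) (p q : {poly R[i]}).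

(* The k-th Taylor coefficient at 0, read off on the circle of radius 1/2. *)
Definition coef f (k : nat) : R[i] :=
  2 ^+ k * cint (fun t : R => f (2^-1%:C * ee t)%C * ee (- t) ^+ k).

Lemma half01 : 0 <= (2^-1 : R) < 1.
Proof. by apply/andP; split; lra. Qed.

Lemma cbddm_radX f (r : R) k : 0 <= r < 1 -> poly_approx f ->
  cbddm (fun t => f (r%:C * ee t)%C * ee (- t) ^+ k).
Proof.
move=> r01 fa; apply: cbddmM; first exact: poly_approx_bddm.
exact/cbddmX/cbddm_eeN.
Qed.

(** Fourier coefficients on a circle are contractive for the sup norm, and those of a polynomial are
    its coefficients times r^k. This comparison does the work of Cauchy's theorem below. *)
Lemma cint_approx f p (r e : R) k : 0 <= r < 1 -> poly_approx f ->
  (forall z, cabs z <= r -> cabs (f z - p.[z]) <= e) ->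
  cabs (cint (fun t => f (r%:C * ee t)%C * ee (- t) ^+ k) - p`_k * r%:C%C ^+ k) <= e.
Proof.
move=> r01 fa fp; rewrite -cint_horner.
have bf := cbddm_radX k r01 fa.
have bp : cbddm (fun t => p.[(r%:C * ee t)%C] * ee (- t) ^+ k).
  by apply: cbddmM; [exact: cbddm_horner|exact/cbddmX/cbddm_eeN].
rewrite -[X in _ - X]mul1r -mulNr -cintZ; last exact: cbddm_citg.
rewrite -cintD; [|exact: cbddm_citg|exact/cbddm_citg/cbddmZ].
rewrite -[leRHS]Int_cst; apply: cabs_cint.
- by apply/cbddm_citg/cbddmD => //; exact: cbddmZ.
- exact/bddm_itg/bddm_cst.
- move=> t _; rewrite mulNr mul1r -mulrBl cabsM cabsX cabs_ee expr1n mulr1.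
  by apply: fp; rewrite cabs_rad ger0_norm//; case/andP: r01.
Qed.

(** Independence of the radius: one polynomial approximates f on the disk of radius max(r, 1/2),
    which contains both circles, and its own Fourier coefficients scale exactly like r^k. *)
Lemma coefP f (r : R) k : 0 <= r < 1 -> poly_approx f ->
  cint (fun t => f (r%:C * ee t)%C * ee (- t) ^+ k) = coef f k * r%:C%C ^+ k.
Proof.
move=> r01 fa; apply/eqP; rewrite -subr_eq0 -cabs_eq0 eq_le cabs_ge0 andbT.
apply/ler_addgt0Pr => d d0; rewrite add0r.
(* The errors on the two circles add up to e + 2^k r^k e, which is d. *)
set A := cint _; pose e := d / (1 + 2 ^+ k * r ^+ k).
case/andP: (r01) => r0 r1.
have den : 0 < 1 + 2 ^+ k * r ^+ k by rewrite ltr_wpDr// mulr_ge0 ?exprn_ge0.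
have e0 : 0 < e by rewrite divr_gt0.
have [p hp] : exists p, forall z, cabs z <= Num.max r 2^-1 -> cabs (f z - p.[z]) <= e.
  by apply: fa => //; have := half01; rewrite le_max r0/= gt_max r1 => /andP[].
have h1 : cabs (A - p`_k * r%:C%C ^+ k) <= e.
  by apply: cint_approx => // z zr; apply: hp; rewrite le_max zr.
have hp2 z : cabs z <= 2^-1 -> cabs (f z - p.[z]) <= e.
  by move=> zr; apply: hp; rewrite le_max zr orbT.
have h2 := @cint_approx f p 2^-1 e k half01 fa hp2.
rewrite /coef; set B := cint _ in h2 *.
have -> : A - 2 ^+ k * B * r%:C%C ^+ k = (A - p`_k * r%:C%C ^+ k) -
   2 ^+ k * r%:C%C ^+ k * (B - p`_k * (2^-1)%:C%C ^+ k).
  have E : 2 ^+ k * (2^-1)%:C%C ^+ k = 1 :> R[i].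
    by rewrite fmorphV/= rmorph_nat -exprMn divff ?expr1n// pnatr_eq0.
  move: E; move: (2 ^+ k) ((2^-1)%:C%C ^+ k) (r%:C%C ^+ k) => X Y Z E.
  have -> : X * Z * (B - p`_k * Y) = X * B * Z - X * Y * (p`_k * Z) by ring.
  by rewrite E; ring.
apply: (le_trans (cabsB _ _)); rewrite !cabsM !cabsX cabs_real ger0_norm//.
have -> : cabs (2 : R[i]) = 2 by rewrite -[2](rmorph_nat (real_complex R)) cabs_real ger0_norm.
apply: (@le_trans _ _ (e + 2 ^+ k * r ^+ k * e)).
  apply: lerD; first exact: h1.
  by apply: ler_wpM2l; [apply: mulr_ge0; exact: exprn_ge0|exact: h2].
by rewrite -{1}[e]mul1r -mulrDl mulrC divfK// gt_eqF.
Qed.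

Lemma coef_le f (r : R) k : 0 <= r < 1 -> poly_approx f ->
  cabs (coef f k) * r ^+ k <= Int (fun t => cabs (f (r%:C * ee t)%C)).
Proof.
move=> r01 fa; case/andP: (r01) => r0 r1.
have -> : cabs (coef f k) * r ^+ k = cabs (coef f k * r%:C%C ^+ k).
  by rewrite cabsM cabsX cabs_real ger0_norm.
rewrite -coefP//; apply: cabs_cint.
- exact/cbddm_citg/cbddm_radX.
- exact/bddm_itg/bddm_cabs/poly_approx_bddm.
- by move=> t _; rewrite cabsM cabsX cabs_ee expr1n mulr1.
Qed.

(** Uniqueness of Taylor coefficients: long truncations of the series are polynomial approximations
    whose k-th coefficient is already a_k, and [cint_approx] compares them with the integral
    defining [coef]. *)
Lemma unif_coefE f a k : unif_coef f a -> a k = coef f k.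
Proof.
move=> fa; have pf := unif_coef_poly_approx fa.
apply/eqP; rewrite -subr_eq0 -cabs_eq0 eq_le cabs_ge0 andbT.
apply/ler_addgt0Pr => d d0; rewrite add0r.
have e0 : 0 < d / 2 ^+ k by rewrite divr_gt0// exprn_gt0.
have [N hN] := fa _ _ half01 e0; pose n := maxn N k.+1.
have h := @cint_approx f (\poly_(j < n) a j) 2^-1 _ k half01 pf _.
have {h} := h (d / 2 ^+ k) _; rewrite coefP//; last exact: half01.
rewrite coef_poly (_ : (k < n)%N); last exact: leq_maxr.
rewrite -mulrBl cabsM cabsX cabs_real ger0_norm ?invr_ge0// exprVn.
rewrite ler_pM2r ?invr_gt0 ?exprn_gt0// cabsC; apply => z zr.
by rewrite horner_poly cabsC; apply: hN => //; exact: leq_maxl.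
Qed.

(** Weierstrass's theorem. If p is within e of f up to a radius s > |z|, the k-th Taylor
    coefficients of f and p differ by at most e / s^k, so their Taylor sums at z differ by at most e
    times a geometric sum of ratio |z| / s. *)
Lemma poly_approx_analytic f : poly_approx f -> analytic_on_D f.
Proof.
move=> fa; exists (coef f) => z zD; apply: ex_cvg0 => d d0.
pose s := (1 + cabs z) / 2; have z1 : cabs z < 1 := zD.
have z0 := cabs_ge0 z.
have zs : cabs z < s by rewrite /s; lra.
have s0 : 0 < s by rewrite /s; lra.
have s1 : s < 1 by rewrite /s; lra.
have s01 : 0 <= s < 1 by rewrite s1 ltW.
pose x := cabs z / s; have x0 : 0 <= x by rewrite divr_ge0// ltW.
have x1 : x < 1 by rewrite ltr_pdivrMr// mul1r.
have y0 : 0 < (1 - x)^-1 by rewrite invr_gt0 subr_gt0.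
pose e := d / ((1 - x)^-1 + 1).
have den : 0 < (1 - x)^-1 + 1 by rewrite addr_gt0.
have e0 : 0 < e by rewrite divr_gt0.
(* From index [size p] on, the Taylor sum of p is p itself. *)
have [p hp] := fa _ _ s01 e0; exists (size p) => n pn.
rewrite ger0_norm ?cabs_ge0//.
apply: (le_trans (cabs_distl _ _ (\sum_(k < n) p`_k * z ^+ k))).
have -> : d = e * (1 - x)^-1 + e.
  by rewrite -{2}[e]mulr1 -mulrDr divfK// gt_eqF.
apply: lerD; last first.
  rewrite cabsC (_ : \sum_(k < n) _ = p.[z]); first by apply: hp; exact: ltW.
  by rewrite (horner_coef_wide z pn).
rewrite -sumrB; apply: (le_trans (cabs_sum _ _ _)).
apply: (@le_trans _ _ (\sum_(i < n) e * x ^+ i)); last first.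
  by rewrite -mulr_sumr ler_wpM2l ?geo_sum_le ?x0// ltW.
apply: ler_sum => k _; rewrite -mulrBl cabsM cabsX.
have -> : cabs z = s * x by rewrite /x mulrC divfK// gt_eqF.
rewrite exprMn mulrA ler_wpM2r ?exprn_ge0//.
have := @cint_approx f p s e k s01 fa hp; rewrite coefP//.
by rewrite -mulrBl cabsM cabsX cabs_real ger0_norm// ltW.
Qed.

Lemma analytic_coef f : poly_approx f -> unif_coef f (coef f).
Proof.
move=> /poly_approx_analytic[a /analytic_unif_coef fa].
by have -> : coef f = a by apply/funext => k; rewrite (unif_coefE k fa).
Qed.

Lemma coefD (c : R[i]) f g k : poly_approx f -> poly_approx g ->
  coef (fun z => c * f z + g z) k = c * coef f k + coef g k.
Proof.
move=> fa ga; rewrite /coef mulrCA -mulrDr; congr (_ * _).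
have bf := cbddm_radX k half01 fa; have bg := cbddm_radX k half01 ga.
rewrite -cintZ; last exact: cbddm_citg.
rewrite -cintD; [|exact/cbddm_citg/cbddmZ|exact: cbddm_citg].
by congr cint; apply/funext => t; ring.
Qed.

Lemma horner_bound p : exists2 M, 0 <= M & forall z, cabs z <= 1 -> cabs p.[z] <= M.
Proof.
exists (\sum_(i < size p) cabs p`_i); first by apply: sumr_ge0 => i _; exact: cabs_ge0.
move=> z z1; rewrite horner_coef (le_trans (cabs_sum _ _ _))//; apply: ler_sum => i _.
by rewrite cabsM ler_piMr ?cabs_ge0// cabsX exprn_ile1 ?cabs_ge0.
Qed.

Lemma poly_approx_bound f (r : R) : 0 <= r < 1 -> poly_approx f ->
  exists2 M, 0 <= M & forall z, cabs z <= r -> cabs (f z) <= M.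
Proof.
move=> r01 fa; have [p hp] := fa r 1 r01 ltr01; have [M M0 hM] := horner_bound p.
exists (1 + M); first by rewrite addr_ge0.
move=> z zr; rewrite -[f z](subrK p.[z]) (le_trans (cabsD _ _))// lerD ?hp//.
by apply: hM; rewrite (le_trans zr)//; case/andP: r01 => _ /ltW.
Qed.

Lemma poly_approx_lim f :
  (forall r e : R, 0 <= r < 1 -> 0 < e -> exists2 h, poly_approx h &
     forall z, cabs z <= r -> cabs (f z - h z) <= e) -> poly_approx f.
Proof.
move=> H r e r01 e0; have e2 : 0 < e / 2 by rewrite divr_gt0.
have [h hh fh] := H r _ r01 e2; have [p hp] := hh r _ r01 e2.
exists p => z zr; rewrite (le_trans (cabs_distl _ _ (h z)))// [e]splitr lerD//.
  exact: fh.
exact: hp.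
Qed.

Lemma poly_approx_horner p : poly_approx (fun z => p.[z]).
Proof. by move=> r e r01 e0; exists p => z _; rewrite subrr cabs0 ltW. Qed.

Lemma poly_approx_cst (c : R[i]) : poly_approx (fun=> c).
Proof. by have := poly_approx_horner c%:P; congr poly_approx; apply/funext => z; rewrite hornerC. Qed.

Lemma poly_approx_id : @poly_approx R id.
Proof. by have := poly_approx_horner 'X; congr (@poly_approx R _); apply/funext => z; rewrite hornerX. Qed.

Lemma poly_approxD f g : poly_approx f -> poly_approx g -> poly_approx (fun z => f z + g z).
Proof.
move=> fa ga r e r01 e0; have e2 : 0 < e / 2 by rewrite divr_gt0.
have [p hp] := fa r _ r01 e2; have [q hq] := ga r _ r01 e2.
exists (p + q) => z zr; rewrite hornerD opprD addrACA (le_trans (cabsD _ _))//.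
rewrite [e]splitr lerD//; [exact: hp|exact: hq].
Qed.

Lemma poly_approxM f g : poly_approx f -> poly_approx g -> poly_approx (fun z => f z * g z).
Proof.
move=> fa ga r e r01 e0.
have [M M0 hM] := poly_approx_bound r01 fa.
have e2 : 0 < e / 2 by rewrite divr_gt0.
(* The tolerance for p involves a bound of q, hence q is chosen before p. *)
have [q hq] := ga r _ r01 (divr_gt0 e2 (ltr_wpDl M0 ltr01)).
have [N N0 hN] := horner_bound q.
have [p hp] := fa r _ r01 (divr_gt0 e2 (ltr_wpDl N0 ltr01)).
exists (p * q) => z zr; rewrite hornerM.
have -> : f z * g z - p.[z] * q.[z] = f z * (g z - q.[z]) + (f z - p.[z]) * q.[z] by ring.
rewrite (le_trans (cabsD _ _))// !cabsM [e]splitr; apply: lerD.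
  apply: (@le_trans _ _ ((M + 1) * (e / 2 / (M + 1)))).
    apply: ler_pM; rewrite ?cabs_ge0// ?hq//.
    by rewrite (le_trans (hM _ zr))// lerDl.
  by rewrite mulrC divfK// gt_eqF// ltr_wpDl.
apply: (@le_trans _ _ ((e / 2 / (N + 1)) * (N + 1))).
  apply: ler_pM; rewrite ?cabs_ge0// ?hp//.
  rewrite (le_trans (hN _ _)) ?lerDl// (le_trans zr)//.
  by case/andP: r01 => _ /ltW.
by rewrite divfK// gt_eqF// ltr_wpDl.
Qed.

Lemma poly_approxX f n : poly_approx f -> poly_approx (fun z => f z ^+ n).
Proof.
move=> fa; elim: n => [|n IH]; first exact: poly_approx_cst.
rewrite (_ : (fun _ => _) = (fun z => f z * f z ^+ n)); first exact: poly_approxM.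
by apply/funext => z; rewrite exprS.
Qed.

Lemma poly_approx_sum n (F : nat -> R[i] -> R[i]) : (forall k, poly_approx (F k)) ->
  poly_approx (fun z => \sum_(k < n) F k z).
Proof.
move=> bF; elim: n => [|n IH].
  under eq_fun do rewrite big_ord0; exact: poly_approx_cst.
by under eq_fun do rewrite big_ord_recr/=; exact: poly_approxD.
Qed.

(** The hypothesis on g keeps its values in a disk where one polynomial approximates f uniformly, so
    that composition reduces to powers of g. For the map phi it is supplied by [log_outer], for a
    dilation it is immediate. *)
Lemma poly_approx_comp f g :
  (forall r : R, 0 <= r < 1 -> exists2 s : R, 0 <= s < 1 &
     forall z, cabs z <= r -> cabs (g z) <= s) ->
  poly_approx f -> poly_approx g -> poly_approx (fun z => f (g z)).
Proof.
move=> gb fa ga; apply: poly_approx_lim => r e r01 e0.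
have [s s01 gs] := gb r r01; have [p hp] := fa s e s01 e0.
exists (fun z => p.[g z]); last by move=> z zr; apply: hp; exact: gs.
under eq_fun do rewrite horner_coef.
apply: (@poly_approx_sum _ (fun k z => p`_k * g z ^+ k)) => k.
by apply: poly_approxM; [exact: poly_approx_cst|exact: poly_approxX].
Qed.

End AnalyticClosure.

(** * The complex exponential *)

Section ComplexExponential.
Context {R : realType}.
Implicit Types (z w : R[i]).

Definition cexp z : R[i] :=
  ((expR (complex.Re z) * cos (complex.Im z)) +i*
   (expR (complex.Re z) * sin (complex.Im z)))%C.

Lemma cabs_cexp z : cabs (cexp z) = expR (complex.Re z).
Proof.
rewrite cabsE /= !exprMn -mulrDr cos2Dsin2 mulr1 sqrtr_sqr ger0_norm//; exact: expR_ge0.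
Qed.

Lemma cexp_real (x : R) : cexp x%:C%C = (expR x)%:C%C.
Proof. by apply: complex_eq; rewrite /= ?cos0 ?sin0 ?mulr1 ?mulr0. Qed.

Lemma cexpD z w : cexp (z + w) = cexp z * cexp w.
Proof.
apply: complex_eq; rewrite ?ReM ?ImM /= ReD ImD expRD ?cosD ?sinD; ring.
Qed.

Lemma cexpXn z n : cexp z ^+ n = cexp (n%:R * z).
Proof.
elim: n => [|n IH]; first by rewrite expr0 mul0r (cexp_real 0) expR0.
by rewrite exprS IH -cexpD -natr1; congr cexp; ring.
Qed.

Lemma sin_cos_taylor (b : R) :
  [/\ `|sin b| <= `|b|, `|cos b - 1| <= b ^+ 2 & `|sin b - b| <= b ^+ 2].
Proof.
wlog b0 : b / 0 <= b.
  move=> H; have [|b0] := leP 0 b; first exact: H.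
  have [] := H (- b) _; first by rewrite oppr_ge0 ltW.
  by rewrite sinN cosN sqrrN -opprD !normrN.
have sle (c : R) : 0 <= c -> `|sin c| <= c.
  move=> c0; have [d _ E] := @MVT_segment R sin cos 0 c c0 (fun x _ => is_derive_sin x)
    (continuous_subspaceT (@continuous_sin R)).
  move: E; rewrite sin0 !subr0 => ->; rewrite normrM (ger0_norm c0) ler_piMl//.
  by rewrite ler_norml cos_geN1 cos_le1.
have cle (c : R) : 0 <= c -> exists2 d, 0 <= d <= c & cos c - 1 = - sin d * c.
  move=> c0; have [d dI E] := @MVT_segment R cos (fun x => - sin x) 0 c c0
    (fun x _ => is_derive_cos x) (continuous_subspaceT (@continuous_cos R)).
  by exists d; [move: dI; rewrite in_itv|move: E; rewrite cos0 !subr0].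
split.
- by rewrite (ger0_norm b0) sle.
- have [d /andP[d0 db] ->] := cle b b0.
  by rewrite normrM normrN expr2 (ger0_norm b0) ler_wpM2r// (le_trans (sle d d0)).
- have [d dI E] := @MVT_segment R sin cos 0 b b0 (fun x _ => is_derive_sin x)
    (continuous_subspaceT (@continuous_sin R)).
  move: E dI; rewrite sin0 !subr0 in_itv/= => -> /andP[d0 db].
  have -> : cos d * b - b = (cos d - 1) * b by ring.
  rewrite normrM expr2 (ger0_norm b0) ler_wpM2r//.
  have [d' /andP[d'0 d'd] ->] := cle d d0; rewrite normrM normrN (ger0_norm d0).
  by rewrite (le_trans _ db)// ler_piMl// ler_norml sin_geN1 sin_le1.
Qed.

(** The upper bound comes from 1 - a <= exp(-a): it gives exp(a) (1 - a) <= 1, hence (exp(a) - 1 -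
    a) (1 - a) <= a^2, where 1 - a >= 1/2. *)
Lemma expR_taylor (a : R) : `|a| <= 2^-1 -> 0 <= expR a - 1 - a <= 2 * a ^+ 2.
Proof.
rewrite ler_norml => /andP[a1 a2]; have h1 := expR_ge1Dx a.
have h2 := expR_ge1Dx (- a); have h3 := expRxMexpNx_1 a.
have e0 := expR_gt0 a; apply/andP; split; first lra.
have : expR a * (1 - a) <= 1 by rewrite -[leRHS]h3 ler_wpM2l// ltW.
move: (expR a) e0 => E e0 h4.
have {h4} : (E - 1 - a) * (1 - a) <= a ^+ 2 by nra.
have : 0 <= a ^+ 2 by exact: sqr_ge0.
move: (a ^+ 2) => s s0 h4; rewrite leNgt; apply/negP => h5.
have : 2 * s * (1 - a) < (E - 1 - a) * (1 - a) by rewrite ltr_pM2r//; lra.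
nra.
Qed.

Lemma cexp_taylor z : cabs z <= 2^-1 -> cabs (cexp z - 1 - z) <= 8 * cabs z ^+ 2.
Proof.
move=> z2; have := Re_le_cabs z; have := Im_le_cabs z; rewrite cabs_sqr.
set a := complex.Re z; set b := complex.Im z => bz az.
have a2 : `|a| <= 2^-1 := le_trans az z2; have b2 : `|b| <= 2^-1 := le_trans bz z2.
have /andP[e1 e2] := expR_taylor a2; have [s1 c1 s2] := sin_cos_taylor b.
rewrite (le_trans (cabs_le_ReIm _))// !ReD !ImD !ReN !ImN /= -/a -/b subr0.
have E2 : expR a <= 2.
  move: a2; rewrite ler_norml => /andP[h1 h2]; nra.
have e0 := expR_gt0 a.
have h1 : `|expR a * cos b - 1 - a| <= 2 * a ^+ 2 + 2 * b ^+ 2.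
  rewrite (_ : _ - a = (expR a - 1 - a) + expR a * (cos b - 1)); last by ring.
  rewrite (le_trans (ler_normD _ _))// lerD//; first by rewrite ger0_norm.
  by rewrite normrM (gtr0_norm e0) ler_pM// ltW.
have h2 : `|expR a * sin b - b| <= 2 * a ^+ 2 + 3 * b ^+ 2.
  rewrite (_ : _ - b = (expR a - 1 - a) * sin b + a * sin b + (sin b - b)); last by ring.
  rewrite (le_trans (ler_normD _ _))//.
  have h3 : `|(expR a - 1 - a) * sin b + a * sin b| <= 2 * a ^+ 2 + 2 * b ^+ 2.
    rewrite (le_trans (ler_normD _ _))// !normrM (ger0_norm e1).
    have h5 : (expR a - 1 - a) * `|sin b| <= 2 * a ^+ 2 * 2^-1.
      by rewrite ler_pM// (le_trans s1).
    have h6 : `|a| * `|sin b| <= `|a| * `|b| by rewrite ler_wpM2l.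
    have h7 : `|a| * `|b| <= (a ^+ 2 + b ^+ 2) / 2.
      have := sqr_ge0 (`|a| - `|b|); rewrite sqrrB !real_normK ?num_real//.
      by rewrite -mulr_natl; nra.
    have := sqr_ge0 a; have := sqr_ge0 b; nra.
  lra.
have := sqr_ge0 a; have := sqr_ge0 b; lra.
Qed.

Lemma cabs_subXX z w (M : R) n : cabs z <= M -> cabs w <= M ->
  cabs (z ^+ n - w ^+ n) <= n%:R * M ^+ n.-1 * cabs (z - w).
Proof.
move=> zM wM; rewrite subrXX cabsM mulrC ler_wpM2r ?cabs_ge0//.
rewrite (le_trans (cabs_sum _ _ _))//.
rewrite mulr_natl -[X in _ *+ X](card_ord n) -sumr_const.
apply: ler_sum => i _; rewrite cabsM !cabsX.
have -> : M ^+ n.-1 = M ^+ (n.-1 - i) * M ^+ i.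
  by rewrite -exprD subnK//; case: n i => [[]//|n i]; exact: (ltn_ord i).
by rewrite ler_pM ?exprn_ge0 ?cabs_ge0// lerXn2r ?nnegrE ?cabs_ge0// (le_trans (cabs_ge0 _) zM).
Qed.

(** Write exp(z) as the n-th power of exp(z/n). This and 1 + z/n have modulus at most exp(|z|/n) and
    differ by O(1/n^2), while the difference of n-th powers costs a factor n. So the exponential of
    an analytic function is a locally uniform limit of polynomials in it. *)
Lemma cexp_limit (B e : R) : 0 <= B -> 0 < e -> exists n : nat, forall z, cabs z <= B ->
  cabs (cexp z - (1 + n%:R^-1 * z) ^+ n) <= e.
Proof.
move=> B0 e0.
(* The first summand forces |z| / n <= 1/2, the range of [cexp_taylor]; the second makes the final
   error 8 exp(B) B^2 / n at most e. *)
pose X := 2 * B + 8 * expR B * B ^+ 2 / e.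
have E0 := expR_gt0 B.
have Y0 : 0 <= 8 * expR B * B ^+ 2 / e.
  by rewrite !mulr_ge0 ?invr_ge0 ?sqr_ge0// ltW.
have X0 : 0 <= X by rewrite addr_ge0// mulr_ge0.
pose n := Num.bound X; have nX : X < n%:R := archi_boundP X0.
have n0 : 0 < n%:R :> R := le_lt_trans X0 nX.
exists n => z zB; have z0 := cabs_ge0 z.
have cn : cabs (n%:R^-1 * z) = n%:R^-1 * cabs z.
  by rewrite cabsM cabsV -[n%:R](rmorph_nat (real_complex R)) cabs_real ger0_norm// ltW.
have h1 : cabs (n%:R^-1 * z) <= 2^-1.
  rewrite cn -ler_pdivlMl ?invr_gt0// invrK (le_trans zB)//.
  rewrite -ler_pdivrMr ?invr_gt0// invrK mulrC (le_trans _ (ltW nX))// lerDl//.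
have -> : cexp z = cexp (n%:R^-1 * z) ^+ n.
  by rewrite cexpXn mulrA divff ?mul1r// pnatr_eq0 -lt0n -(ltr_nat R).
have M1 : cabs (cexp (n%:R^-1 * z)) <= expR (cabs (n%:R^-1 * z)).
  by rewrite cabs_cexp ler_expR (le_trans (ler_norm _))// Re_le_cabs.
have M2 : cabs (1 + n%:R^-1 * z) <= expR (cabs (n%:R^-1 * z)).
  by rewrite (le_trans (cabsD _ _))// cabs1 expR_ge1Dx.
apply: (le_trans (cabs_subXX _ M1 M2)).
have h3 : cabs (cexp (n%:R^-1 * z) - (1 + n%:R^-1 * z)) <= 8 * cabs (n%:R^-1 * z) ^+ 2.
  by rewrite opprD addrA cexp_taylor.
have h4 : expR (cabs (n%:R^-1 * z)) ^+ n.-1 <= expR B.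
  rewrite -expRM_natl ler_expR cn mulrA; apply: (le_trans _ zB).
  rewrite ler_piMl// ler_pdivrMr// mul1r ler_nat leq_pred//.
apply: (@le_trans _ _ (n%:R * expR B * (8 * (n%:R^-1 * B) ^+ 2))).
  apply: ler_pM; [|exact: cabs_ge0|by rewrite ler_wpM2l|].
    by rewrite mulr_ge0// exprn_ge0// expR_ge0.
  rewrite (le_trans h3)// ler_wpM2l// cn lerXn2r ?nnegrE ?mulr_ge0 ?invr_ge0//.
  by rewrite ler_wpM2l// invr_ge0.
have -> : n%:R * expR B * (8 * (n%:R^-1 * B) ^+ 2) = (8 * expR B * B ^+ 2) / n%:R.
  by field; rewrite gt_eqF.
by rewrite ler_pdivrMr// -ler_pdivrMl// [e^-1 * _]mulrC (le_trans _ (ltW nX))// lerDr mulr_ge0.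
Qed.

Lemma poly_approx_cexp (f : R[i] -> R[i]) : poly_approx f -> poly_approx (fun z => cexp (f z)).
Proof.
move=> fa; apply: poly_approx_lim => r e r01 e0.
have [M M0 fM] := poly_approx_bound r01 fa; have [n hn] := cexp_limit M0 e0.
exists (fun z => (1 + n%:R^-1 * f z) ^+ n); last by move=> z /fM /hn.
apply/poly_approxX/poly_approxD; first exact: poly_approx_cst.
by apply: poly_approxM => //; exact: poly_approx_cst.
Qed.

End ComplexExponential.

(** * Poisson and Herglotz integrals *)

Section PoissonHerglotz.
Context {R : realType}.
Implicit Types (z w : R[i]) (u v : R -> R) (f : R[i] -> R[i]) (t : R).

(* The Herglotz kernel (e(t) + z) / (e(t) - z). *)
Definition hk z t : R[i] := (1 + z * ee (- t)) / (1 - z * ee (- t)).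

(* The Poisson kernel (1 - |z|^2) / |e(t) - z|^2. *)
Definition pk z t : R := (1 - cabs z ^+ 2) / cabs (1 - z * ee (- t)) ^+ 2.

(** Section of the expansion 2 sum_(k >= 0) x^k - 1 of (1 + x) / (1 - x), with x = z e(-t). *)
Definition hk_part z n t : R[i] := 2 * \sum_(k < n) (z * ee (- t)) ^+ k - 1.

Lemma den_neq0 z t : inD z -> 1 - z * ee (- t) != 0.
Proof.
move=> zD; rewrite subr_eq0; apply/eqP => E.
have : cabs (1 : R[i]) < 1 by rewrite E cabsM cabs_ee mulr1.
by rewrite cabs1 ltxx.
Qed.

Lemma den_ge z t : 1 - cabs z <= cabs (1 - z * ee (- t)).
Proof.
rewrite lerBlDr -{1}cabs1 -{1}(subrK (z * ee (- t)) 1) (le_trans (cabsD _ _))//.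
by rewrite lerD2l cabsM cabs_ee mulr1.
Qed.

Lemma Re_hk z t : inD z -> complex.Re (hk z t) = pk z t.
Proof.
move=> zD; have d0 := den_neq0 t zD; have e1 : cabs (z * ee (- t)) = cabs z by rewrite cabsM cabs_ee mulr1.
rewrite /pk -e1 /hk; set x := z * _ in d0 e1 *.
have -> : (1 + x) / (1 - x) = ((cabs (1 - x) ^+ 2)^-1)%:C%C * ((1 + x) * (1 - x)^*%C).
  rewrite fmorphV/= -mul_conj.
  have c0 : (1 - x)^*%C != 0 by rewrite -cabs_eq0 cabs_conj cabs_eq0.
  move: d0 c0; move: (1 - x) ((1 - x)^*%C) => d c d0 c0.
  by field; rewrite c0 d0.
rewrite ReM /= mul0r subr0 mulrC; congr (_ / _); rewrite cabs_sqr.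
by case: x {d0 e1} => a b /=; ring.
Qed.

Lemma pk_ge0 z t : inD z -> 0 <= pk z t.
Proof.
move=> zD; rewrite divr_ge0 ?exprn_ge0 ?cabs_ge0// subr_ge0.
by rewrite exprn_ile1 ?cabs_ge0// ltW.
Qed.

Lemma pk0 t : pk 0 t = 1.
Proof. by rewrite /pk mul0r subr0 cabs0 cabs1 expr0n expr1n subr0 divr1. Qed.

Lemma cbddm_hk_part z n : cbddm (hk_part z n).
Proof.
apply: cbddmB; last exact: cbddm_cst.
apply: cbddmZ; apply: (@cbddm_sum _ _ (fun k t => (z * ee (- t)) ^+ k)) => k.
exact/cbddmX/cbddmZ/cbddm_eeN.
Qed.

Lemma hk_part_err z n t (r : R) : cabs z <= r -> r < 1 ->
  cabs (hk z t - hk_part z n t) <= 2 * r ^+ n / (1 - r).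
Proof.
move=> zr r1; have zD : inD z := le_lt_trans zr r1.
have d0 := den_neq0 t zD; have dg := den_ge z t.
have e1 : cabs (z * ee (- t)) = cabs z by rewrite cabsM cabs_ee mulr1.
rewrite /hk /hk_part; set x := z * _ in d0 e1 dg *.
have -> : (1 + x) / (1 - x) - (2 * \sum_(k < n) x ^+ k - 1) = 2 * x ^+ n / (1 - x).
  have E := subrX1 x n; apply: (mulIf d0); rewrite mulrBl divfK// [in RHS]divfK//.
  have -> : (2 * \sum_(k < n) x ^+ k - 1) * (1 - x) =
     - (2 * ((x - 1) * \sum_(k < n) x ^+ k)) - (1 - x) by ring.
  by rewrite -E; ring.
rewrite !cabsM cabsV cabsX e1.
have -> : cabs (2 : R[i]) = 2 by rewrite -[2](rmorph_nat (real_complex R)) cabs_real ger0_norm.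
have r0 : 0 < 1 - r by rewrite subr_gt0.
have dg' : 1 - r <= cabs (1 - x) by rewrite (le_trans _ dg)// lerD2l lerN2.
have z0 := cabs_ge0 z.
apply: ler_pM; rewrite ?mulr_ge0 ?exprn_ge0 ?invr_ge0 ?cabs_ge0//.
  by rewrite ler_wpM2l// lerXn2r ?nnegrE// (le_trans z0).
by rewrite lef_pV2 ?posrE// (lt_le_trans r0).
Qed.

Lemma hk_part_cvg (r e : R) : 0 <= r < 1 -> 0 < e -> exists N, forall n, (N <= n)%N ->
  forall z, cabs z <= r -> forall t, cabs (hk z t - hk_part z n t) <= e.
Proof.
move=> /andP[r0 r1] e0; have s0 : 0 < 1 - r by rewrite subr_gt0.
have c : (fun n => r ^+ n) @ \oo --> 0 by apply: cvg_expr; rewrite ger0_norm.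
have d0 : 0 < e * (1 - r) / 2 by rewrite divr_gt0// mulr_gt0.
have [N hN] := cvg0_ex c d0; exists N => n Nn z zr t.
rewrite (le_trans (hk_part_err n t zr r1))// ler_pdivrMr// -ler_pdivlMl// mulrC ltW//.
by rewrite (le_lt_trans (ler_norm _))// hN.
Qed.

Lemma cbddm_hk z : inD z -> cbddm (hk z).
Proof.
move=> zD; apply: cbddm_unif => e e0.
have z01 : 0 <= cabs z < 1 by rewrite cabs_ge0.
have [N hN] := hk_part_cvg z01 e0; exists (hk_part z N); first exact: cbddm_hk_part.
by move=> t; exact: (hN N (leqnn N) z (lexx _)).
Qed.

Lemma bddm_pk z : inD z -> bddm (pk z).
Proof.
move=> zD; have [b _] := cbddm_hk zD; move: b; congr bddm.
by apply/funext => t; rewrite Re_hk.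
Qed.

(** Up to a uniform error the Poisson kernel is the real part of [hk_part], a trigonometric
    polynomial with terms z^k e(-kt) and conj(z)^k e(kt); orthogonality picks out z^m. *)
Lemma cint_pk_eeX z m : inD z -> cint (fun t => (pk z t)%:C%C * ee t ^+ m) = z ^+ m.
Proof.
move=> zD; apply/eqP; rewrite -subr_eq0 -cabs_eq0 eq_le cabs_ge0 andbT.
apply/ler_addgt0Pr => e e0; rewrite add0r.
have z01 : 0 <= cabs z < 1 by rewrite cabs_ge0.
have [N hN] := hk_part_cvg z01 e0; pose n := maxn N m.+1.
pose q t := (complex.Re (hk_part z n t))%:C%C.
have bq : cbddm (fun t => q t * ee t ^+ m).
  apply: cbddmM; last exact/cbddmX/cbddm_ee.
  by apply: cbddm_real; case: (cbddm_hk_part z n).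
have -> : z ^+ m = cint (fun t => q t * ee t ^+ m).
  (* The conjugate terms survive integration only for k = m = 0, where they cancel the - 1 of
     [hk_part]. *)
  have qE t : q t * ee t ^+ m = - ee t ^+ m + (\sum_(k < n) z ^+ k * (ee t ^+ m * ee (- t) ^+ k)
      + \sum_(k < n) (z^*)%C ^+ k * (ee t ^+ (k + m) * ee (- t) ^+ 0)).
    have -> : q t = \sum_(k < n) (z * ee (- t)) ^+ k + \sum_(k < n) ((z * ee (- t)) ^+ k)^*%C - 1.
      rewrite /q /hk_part -big_split/=.
      have Rec (x : R[i]) : (complex.Re x)%:C%C = (x + x^*%C) / 2.
        apply: (mulIf (_ : 2 != 0)); first by rewrite pnatr_eq0.
        rewrite divfK ?pnatr_eq0//; apply: complex_eq; rewrite ?ReM ?ImM; case: x => a b /=; ring.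
      rewrite Rec rmorphB rmorphM rmorph1 rmorph_nat rmorph_sum/=.
      rewrite -[X in _ = X - 1](mulfK (_ : 2 != 0)) ?pnatr_eq0// -[X in _ - X](mulfV (_ : 2 != 0)) ?pnatr_eq0//.
      rewrite -mulrBl; congr (_ / _); rewrite big_split/=; ring.
    rewrite mulrBl mul1r addrC mulrDl !mulr_suml; congr (_ + (_ + _)).
      by apply: eq_bigr => k _; rewrite exprMn; ring.
    have cE : (ee (- t))^*%C = ee t by rewrite ee_conj opprK.
    apply: eq_bigr => k _; rewrite rmorphXn rmorphM [X in (_ * X) ^+ _]cE.
    by rewrite exprMn expr0 mulr1 exprD mulrA.
  under eq_fun do rewrite qE.
  have b1 a b : cbddm (fun t => ee t ^+ a * ee (- t) ^+ b :> R[i]).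
    by apply: cbddmM; apply: cbddmX; [exact: cbddm_ee|exact: cbddm_eeN].
  have b2 k : cbddm (fun t => z ^+ k * (ee t ^+ m * ee (- t) ^+ k)).
    exact: cbddmZ.
  have b3 k : cbddm (fun t => (z^*)%C ^+ k * (ee t ^+ (k + m) * ee (- t) ^+ 0)).
    exact: cbddmZ.
  have c1 := @cbddm_sum _ n _ b2; have c2 := @cbddm_sum _ n _ b3.
  have c0 : cbddm (fun t => - ee t ^+ m) by exact/cbddmN/cbddmX/cbddm_ee.
  rewrite cintD; [|exact: cbddm_citg|exact/cbddm_citg/cbddmD].
  rewrite cintD; [|exact: cbddm_citg|exact: cbddm_citg].
  rewrite (@cint_sum _ n (fun k t => z ^+ k * (ee t ^+ m * ee (- t) ^+ k))); last by move=> k; exact/cbddm_citg.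
  rewrite (@cint_sum _ n (fun k t => (z^*)%C ^+ k * (ee t ^+ (k + m) * ee (- t) ^+ 0))); last by move=> k; exact/cbddm_citg.
  rewrite (eq_bigr (fun k : 'I_n => z ^+ k * (m == k :> nat)%:R)); last first.
    by move=> k _; rewrite cintZ ?cint_eeXV//; exact/cbddm_citg/b1.
  rewrite [X in _ + (_ + X)](eq_bigr (fun k : 'I_n => (z^*)%C ^+ k * ((k + m)%N == 0%N)%:R)); last first.
    by move=> k _; rewrite cintZ ?cint_eeXV//; exact/cbddm_citg/b1.
  have mn : (m < n)%N := leq_maxr _ _.
  rewrite (bigD1 (Ordinal mn))//= eqxx mulr1 big1 ?addr0; last first.
    by move=> k km; rewrite eq_sym (negbTE (_ : nat_of_ord k != m)) ?mulr0.
  have n0 : (0 < n)%N by exact: leq_ltn_trans mn.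
  rewrite (bigD1 (Ordinal n0))//= expr0 mul1r add0n big1 ?addr0; last first.
    move=> k k0; rewrite addn_eq0 (negbTE (_ : nat_of_ord k != 0%N)) ?mulr0//.
  have -> : cint (fun t : R => - ee t ^+ m) = - (m == 0%N)%:R.
    rewrite -(cint_eeXV m 0) -[RHS]mulN1r -cintZ; last exact/cbddm_citg/b1.
    by congr cint; apply/funext => t; rewrite expr0 mulr1 mulN1r.
  by rewrite addrCA addNr addr0.
have bp : cbddm (fun t => (pk z t)%:C%C * ee t ^+ m).
  by apply: cbddmM; [exact/cbddm_real/bddm_pk|exact/cbddmX/cbddm_ee].
rewrite -[X in _ - X]mul1r -mulNr -cintZ; last exact: cbddm_citg.
rewrite -cintD; [|exact: cbddm_citg|exact/cbddm_citg/cbddmZ].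
rewrite -[leRHS]Int_cst; apply: cabs_cint.
- by apply/cbddm_citg/cbddmD => //; exact: cbddmZ.
- exact/bddm_itg/bddm_cst.
- move=> t _; rewrite mulNr mul1r -mulrBl cabsM cabsX cabs_ee expr1n mulr1 /q -Re_hk//.
  rewrite -rmorphB cabs_real/= -ReN -ReD (le_trans (Re_le_cabs _))//.
  by apply: hN => //; exact: leq_maxl.
Qed.

Lemma Int_pk z : inD z -> Int (pk z) = 1.
Proof.
move=> zD; have := cint_pk_eeX 0 zD; rewrite expr0.
under eq_fun do rewrite expr0 mulr1.
by rewrite cint_real => -[].
Qed.

Lemma poisson_horner (p : {poly R[i]}) z : inD z ->
  cint (fun t => (pk z t)%:C%C * p.[ee t]) = p.[z].
Proof.
move=> zD.
have b k : cbddm (fun t => p`_k * ((pk z t)%:C%C * ee t ^+ k)).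
  by apply/cbddmZ/cbddmM; [exact/cbddm_real/bddm_pk|exact/cbddmX/cbddm_ee].
have -> : (fun t => (pk z t)%:C%C * p.[ee t]) =
  (fun t => \sum_(k < size p) p`_k * ((pk z t)%:C%C * ee t ^+ k)).
  apply/funext => t; rewrite horner_coef mulr_sumr; apply: eq_bigr => k _.
  by rewrite mulrCA.
rewrite (@cint_sum _ _ (fun k t => p`_k * ((pk z t)%:C%C * ee t ^+ k))); last first.
  by move=> k; exact/cbddm_citg.
rewrite horner_coef; apply: eq_bigr => k _; rewrite cintZ ?cint_pk_eeX//.
apply/cbddm_citg/cbddmM; [exact/cbddm_real/bddm_pk|exact/cbddmX/cbddm_ee].
Qed.

(** Only a dilate of f is integrated: with r < 1 it is a uniform limit of polynomials on the closed
    disk, where [poisson_horner] applies. *)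
Lemma poisson_formula f z (r : R) : inD z -> 0 <= r < 1 -> poly_approx f ->
  cint (fun t => (pk z t)%:C%C * f (r%:C * ee t)%C) = f (r%:C%C * z).
Proof.
move=> zD r01 fa; apply/eqP; rewrite -subr_eq0 -cabs_eq0 eq_le cabs_ge0 andbT.
case/andP: (r01) => r0 r1.
apply/ler_addgt0Pr => e e0; rewrite add0r.
have e2 : 0 < e / 2 by rewrite divr_gt0.
have [p hp] := fa r _ r01 e2.
pose q := p \Po (r%:C%C *: 'X).
have qE w : q.[w] = p.[r%:C%C * w] by rewrite horner_comp hornerZ hornerX.
rewrite (le_trans (cabs_distl _ _ q.[z]))// [e]splitr lerD//; last first.
  rewrite qE cabsC hp// cabsM cabs_real ger0_norm// ler_piMr//; exact: ltW.
rewrite -poisson_horner//.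
have bf : cbddm (fun t => (pk z t)%:C%C * f (r%:C * ee t)%C).
  by apply: cbddmM; [exact/cbddm_real/bddm_pk|exact: poly_approx_bddm].
have bq : cbddm (fun t => (pk z t)%:C%C * q.[ee t]).
  apply: cbddmM; first exact/cbddm_real/bddm_pk.
  by under eq_fun do rewrite qE; exact: cbddm_horner.
rewrite -[X in _ - X]mul1r -mulNr -cintZ; last exact: cbddm_citg.
rewrite -cintD; [|exact: cbddm_citg|exact/cbddm_citg/cbddmZ].
rewrite [leRHS](_ : _ = Int (fun t => e / 2 * pk z t)); last first.
  by rewrite IntZ ?Int_pk ?mulr1//; exact/bddm_itg/bddm_pk.
apply: cabs_cint.
- by apply/cbddm_citg/cbddmD => //; exact: cbddmZ.
- exact/bddm_itg/bddmZ/bddm_pk.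
- move=> t _; rewrite mulNr mul1r -mulrBr cabsM cabs_real ger0_norm ?pk_ge0//.
  by rewrite mulrC ler_wpM2r ?pk_ge0// qE hp// cabs_rad ger0_norm.
Qed.

Lemma poisson_le f z (r : R) : inD z -> 0 <= r < 1 -> poly_approx f ->
  cabs (f (r%:C%C * z)) <= Int (fun t => pk z t * cabs (f (r%:C * ee t)%C)).
Proof.
move=> zD r01 fa; rewrite -poisson_formula//.
have bf := poly_approx_bddm r01 fa.
apply: cabs_cint.
- by apply/cbddm_citg/cbddmM => //; exact/cbddm_real/bddm_pk.
- by apply/bddm_itg/bddmM; [exact: bddm_pk|exact: bddm_cabs].
- by move=> t _; rewrite cabsM cabs_real ger0_norm ?pk_ge0.
Qed.

Lemma mean_value_le f (r : R) : 0 <= r < 1 -> poly_approx f ->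
  cabs (f 0) <= Int (fun t => cabs (f (r%:C * ee t)%C)).
Proof.
move=> r01 fa; have D0 : inD (0 : R[i]) by rewrite /inD cabs0.
have := poisson_le D0 r01 fa; rewrite mulr0.
by under eq_fun do rewrite pk0 mul1r.
Qed.

(** The Herglotz integral of u: analytic in z, with real part the Poisson integral of u. Its
    exponential [cexp (herg u z)] is the outer function of boundary modulus exp(u). *)
Definition herg u z : R[i] := cint (fun t => (u t)%:C%C * hk z t).

Lemma citgM u (g : R -> R[i]) : itg u -> cbddm g -> citg (fun t => (u t)%:C%C * g t).
Proof.
move=> ui [b1 b2]; split.
  under eq_fun do rewrite ReM /= mul0r subr0 mulrC; exact: itgM.
under eq_fun do rewrite ImM /= mul0r addr0 mulrC; exact: itgM.
Qed.

Lemma Re_herg u z : inD z -> complex.Re (herg u z) = Int (fun t => pk z t * u t).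
Proof.
move=> zD /=; congr Int; apply/funext => t; rewrite ReM /= mul0r subr0 Re_hk//.
by rewrite mulrC.
Qed.

Lemma herg0 u : herg u 0 = (Int u)%:C%C.
Proof.
rewrite /herg -cint_real; congr cint; apply/funext => t.
by rewrite /hk mul0r subr0 addr0 divr1 mulr1.
Qed.

(** Truncating the kernel gives a polynomial in z whose coefficients are built from Fourier
    coefficients of u; the error is the uniform kernel error times the L1 norm of u. *)
Lemma poly_approx_herg u : itg u -> poly_approx (herg u).
Proof.
move=> ui; apply: poly_approx_lim => r e r01 e0.
have A0 : 0 <= Int (fun t => `|u t|) by apply: Int_ge0.
have d0 : 0 < e / (Int (fun t => `|u t|) + 1) by rewrite divr_gt0// ltr_wpDl.
have [n hn] := hk_part_cvg r01 d0; have {}hn := hn n (leqnn n).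
exists (fun z => cint (fun t => (u t)%:C%C * hk_part z n t)).
  have E z : cint (fun t => (u t)%:C%C * hk_part z n t) =
    - cint (fun t => (u t)%:C%C * 1) + 2 * \sum_(k < n) cint (fun t => (u t)%:C%C * ee (- t) ^+ k) * z ^+ k.
    have b k : cbddm (fun t : R => ee (- t) ^+ k :> R[i]) by exact/cbddmX/cbddm_eeN.
    have i0 : citg (fun t => -1 * ((u t)%:C%C * 1)) by apply/citgZ/citgM => //; exact: cbddm_cst.
    have ik k : citg (fun t => (2 * z ^+ k) * ((u t)%:C%C * ee (- t) ^+ k)) by exact/citgZ/citgM.
    have iS : citg (fun t => \sum_(k < n) (2 * z ^+ k) * ((u t)%:C%C * ee (- t) ^+ k)).
      have -> : (fun t => \sum_(k < n) (2 * z ^+ k) * ((u t)%:C%C * ee (- t) ^+ k)) =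
        (fun t => (u t)%:C%C * \sum_(k < n) (2 * z ^+ k) * ee (- t) ^+ k).
        by apply/funext => t; rewrite mulr_sumr; apply: eq_bigr => k _; rewrite mulrCA.
      by apply: citgM => //; apply: (@cbddm_sum _ _ (fun k t => (2 * z ^+ k) * ee (- t) ^+ k)) => k; exact: cbddmZ.
    rewrite -mulN1r -cintZ; last by apply: citgM => //; exact: cbddm_cst.
    rewrite mulr_sumr (eq_bigr (fun k : 'I_n => cint (fun t => (2 * z ^+ k) * ((u t)%:C%C * ee (- t) ^+ k)))); last first.
      by move=> k _; rewrite cintZ; [ring|exact: citgM].
    rewrite -(@cint_sum _ n (fun k t => (2 * z ^+ k) * ((u t)%:C%C * ee (- t) ^+ k)))// -cintD//.
    congr cint; apply/funext => t; rewrite /hk_part mulrBr addrC mulN1r; congr (_ + _).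
    rewrite [LHS]mulrA mulr_sumr.
    by apply: eq_bigr => k _; rewrite exprMn; ring.
  under eq_fun do rewrite E.
  apply: poly_approxD; first exact: poly_approx_cst.
  apply: poly_approxM; first exact: poly_approx_cst.
  apply: (@poly_approx_sum _ _ (fun k z => cint (fun t => (u t)%:C%C * ee (- t) ^+ k) * z ^+ k)) => k.
  by apply: poly_approxM; [exact: poly_approx_cst|exact/poly_approxX/poly_approx_id].
move=> z zr; have zD : inD z by case/andP: r01 => _; exact: le_lt_trans.
rewrite /herg -[X in _ - X]mul1r -mulNr -cintZ; last by apply: citgM => //; exact: cbddm_hk_part.
rewrite -cintD; [|by apply: citgM => //; exact: cbddm_hk|by apply/citgZ/citgM => //; exact: cbddm_hk_part].
apply: (@le_trans _ _ (Int (fun t => e / (Int (fun t => `|u t|) + 1) * `|u t|))).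
  apply: cabs_cint.
  - apply: citgD; first by apply: citgM => //; exact: cbddm_hk.
    by apply/citgZ/citgM => //; exact: cbddm_hk_part.
  - exact/itgZ/itg_norm.
  - move=> t _; rewrite mulNr mul1r -mulrBr cabsM cabs_real mulrC ler_wpM2r//.
    exact: hn.
rewrite IntZ; last exact: itg_norm.
rewrite mulrAC -mulrA ler_piMr ?(ltW e0)// ler_pdivrMr; last by rewrite ltr_wpDl.
by rewrite mul1r lerDl.
Qed.

End PoissonHerglotz.

(** * Boundary values of Poisson integrals *)

Section BoundaryValues.
Context {R : realType}.
Local Notation mu := (@lebesgue_measure R).
Implicit Types (u : R -> R) (t x y s : R).

Lemma at_right0_ex (P : R -> Prop) : (\forall r \near (0 : R)^'+, P r) ->
  exists2 h : R, 0 < h & forall r, 0 < r < h -> P r.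
Proof.
move=> [h /= h0 H]; exists h => // r /andP[r0 rh]; apply: H => //=.
by rewrite sub0r normrN gtr0_norm.
Qed.

Lemma sin_small_lower x : `|x| <= 2^-1 -> `|x| / 2 <= `|sin x|.
Proof.
move=> x2; have [_ _ h] := sin_cos_taylor x.
have : `|x| <= `|sin x| + `|sin x - x|.
  by rewrite -{1}[x](subKr (sin x)) (le_trans (ler_normB _ _)).
have : `|x| ^+ 2 <= `|x| / 2 by rewrite expr2 ler_wpM2l.
by rewrite real_normK ?num_real//; lra.
Qed.

(* sin (pi x) has a simple zero at 0 and no other zero in ]-1, 1[. *)
Lemma sin_pi_lower (m : R) : m < 1 ->
  exists2 c : R, 0 < c & forall x, `|x| <= m -> c * x ^+ 2 <= sin (pi * x) ^+ 2.
Proof.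
move=> m1; have p0 := @pi_gt0 R; have p2 := @pi_ge2 R.
pose a : R := (2 * pi)^-1.
have a0 : 0 < a by rewrite invr_gt0 mulr_gt0.
have pa : pi * a = 2^-1 by rewrite /a invfM mulrCA divff ?mulr1// lt0r_neq0.
have small x : `|x| <= a -> x ^+ 2 <= sin (pi * x) ^+ 2.
  move=> xa; have h : `|pi * x| <= 2^-1.
    by rewrite normrM (gtr0_norm p0) -pa ler_pM2l.
  have := sin_small_lower h; rewrite normrM (gtr0_norm p0) => h2.
  rewrite -[x ^+ 2]real_normK ?num_real// -[sin _ ^+ 2]real_normK ?num_real//.
  rewrite lerXn2r ?nnegrE// (le_trans _ h2)// mulrAC.
  by rewrite ler_peMl// ler_pdivlMr ?mul1r.
have [am|ma] := leP m a.
  by exists 1 => // x xm; rewrite mul1r small// (le_trans xm).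
have [] := @EVT_min R (fun x => sin (pi * x)) a m (ltW ma).
  exact/continuous_subspaceT/continuous_sinM.
move=> b; rewrite in_itv/= => /andP[ab bm] hb.
have b0 : 0 < b by exact: lt_le_trans ab.
have k0 : 0 < sin (pi * b).
  by apply: sin_gt0_pi; rewrite mulr_gt0//= gtr_pMr// (le_lt_trans bm).
exists (Num.min 1 (sin (pi * b) ^+ 2)); first by rewrite lt_min ltr01 exprn_gt0.
move=> x xm; have [xa|ax] := leP `|x| a.
  by rewrite (le_trans _ (small _ xa))// ler_piMl ?sqr_ge0// ge_min lexx.
have x1 : x ^+ 2 <= 1.
  by rewrite -[x ^+ 2]real_normK ?num_real// exprn_ile1// (le_trans xm)// ltW.
apply: (@le_trans _ _ (sin (pi * b) ^+ 2)).
  rewrite -[leRHS]mulr1; apply: ler_pM => //; rewrite ?sqr_ge0//.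
    by rewrite le_min ler01 sqr_ge0.
  by rewrite ge_min lexx orbT.
have -> : sin (pi * x) ^+ 2 = sin (pi * `|x|) ^+ 2.
  by have [x0|x0] := leP 0 x; [rewrite ger0_norm|rewrite ltr0_norm// mulrN sinN sqrrN].
have hx : sin (pi * b) <= sin (pi * `|x|) by apply: hb; rewrite in_itv/= xm ltW.
by rewrite lerXn2r ?nnegrE ?(ltW k0)// (le_trans (ltW k0)).
Qed.

Lemma poisson_den s t y :
  cabs (1 - (s%:C * ee t)%C * ee (- y)) ^+ 2 = (1 - s) ^+ 2 + 4 * s * sin (pi * (t - y)) ^+ 2.
Proof.
rewrite -mulrA -eeD cabs_sqr.
have -> : complex.Re (1 - s%:C%C * ee (t - y)) = 1 - s * cos (2 * pi * (t - y)).
  by rewrite ReD ReN ReM /= mul0r subr0.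
have -> : complex.Im (1 - s%:C%C * ee (t - y)) = - (s * sin (2 * pi * (t - y))).
  by rewrite ImD ImN ImM /= mul0r addr0 add0r.
have -> : cos (2 * pi * (t - y)) = 1 - 2 * sin (pi * (t - y)) ^+ 2.
  rewrite (_ : 2 * pi * (t - y) = pi * (t - y) + pi * (t - y)); last by ring.
  by rewrite cosD -!expr2 cos2sin2; ring.
have -> : sin (2 * pi * (t - y)) = 2 * (sin (pi * (t - y)) * cos (pi * (t - y))).
  rewrite (_ : 2 * pi * (t - y) = pi * (t - y) + pi * (t - y)); last by ring.
  by rewrite sinD; ring.
set a := sin _; set b := cos _; have E : b ^+ 2 = 1 - a ^+ 2 by rewrite /a /b cos2sin2.
have -> : (- (s * (2 * (a * b)))) ^+ 2 = 4 * s ^+ 2 * a ^+ 2 * b ^+ 2 by ring.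
by rewrite E; ring.
Qed.

(** On each shell 2^(J-1) d <= x < 2^J d the single term j = J is enough. The point is to bound a
    Poisson-like kernel by indicators of balls, whose averages are controlled at Lebesgue points. *)
Lemma dyadic_kernel (d x : R) J : 0 < d -> 0 <= x -> x < 2 ^+ J * d ->
  d / (d ^+ 2 + x ^+ 2) <= \sum_(j < J.+1) (4 * 4 ^- j / d) * (x < 2 ^+ j * d)%R%:R.
Proof.
move=> d0 x0; have S0 n : 0 <= \sum_(j < n) (4 * 4 ^- j / d) * (x < 2 ^+ j * d)%R%:R.
  by apply: sumr_ge0 => j _; rewrite !mulr_ge0 ?invr_ge0 ?exprn_ge0// ltW.
have q0 : 0 < d ^+ 2 + x ^+ 2 by rewrite ltr_wpDr ?sqr_ge0// exprn_gt0.
elim: J => [|J IH] xJ.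
  rewrite big_ord_recl big_ord0 addr0 xJ expr0 invr1 !mulr1.
  rewrite ler_pdivrMr// mulrAC ler_pdivlMr// -expr2.
  have := sqr_ge0 x; have := sqr_ge0 d; lra.
have [/IH h|h] := ltP x (2 ^+ J * d).
  rewrite big_ord_recr/=; apply: (le_trans h); rewrite lerDl.
  by rewrite !mulr_ge0 ?invr_ge0 ?exprn_ge0// ltW.
rewrite big_ord_recr/= xJ mulr1.
apply: (@le_trans _ _ (4 * 4 ^- J.+1 / d)); last by rewrite lerDr S0.
have -> : 4 * 4 ^- J.+1 = (4 ^+ J)^-1 :> R.
  by rewrite exprS invfM mulrA divff ?mul1r// pnatr_eq0.
have : (2 ^+ J * d) ^+ 2 <= x ^+ 2 by rewrite lerXn2r ?nnegrE// mulr_ge0 ?exprn_ge0// ltW.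
rewrite exprMn -exprM mulnC exprM (_ : 2 ^+ 2 = 4 :> R); last by ring.
have K0 : (0 : R) < 4 ^+ J by rewrite exprn_gt0.
move=> h2; rewrite ler_pdivrMr// -invfM mulrC ler_pdivlMr ?mulr_gt0//.
have := sqr_ge0 d; rewrite mulrCA -expr2; lra.
Qed.

Lemma dyadic_scale (d h : R) : 0 < d -> d < h ->
  exists J : nat, h / 2 <= 2 ^+ J * d < h.
Proof.
move=> d0 dh.
have ex : exists J : nat, h / 2 <= 2 ^+ J * d.
  exists (Num.bound (h / d)); rewrite -ler_pdivrMr//.
  have h0 : 0 <= h / d by apply: divr_ge0; apply: ltW => //; exact: lt_trans dh.
  apply: (@le_trans _ _ (h / d)).
    rewrite ler_pM2r ?invr_gt0//; have := lt_trans d0 dh; lra.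
  apply: (le_trans (ltW (archi_boundP h0))).
  by rewrite -natrX ler_nat ltnW// ltn_expl.
pose J := ex_minn ex; exists J; rewrite /J; case: ex_minnP => k hk min.
rewrite hk/=; case: k hk min => [|k] hk min; first by rewrite expr0 mul1r.
rewrite ltNge; apply/negP => H.
have /min : h / 2 <= 2 ^+ k * d by rewrite ler_pdivrMr// mulrC mulrA -exprS.
by rewrite ltnn.
Qed.

Lemma ae_neq (a : R) : {ae mu, forall t, t != a}.
Proof.
exists [set a]; split; [exact: measurable_set1|exact: lebesgue_measure_set1|].
by move=> t /= /negP; rewrite negbK => /eqP.
Qed.

Lemma lebesgue_pt_ex u t (e : R) : lebesgue_pt u t -> 0 < e ->
  exists2 h : R, 0 < h & forall r, 0 < r < h ->
    (\int[mu]_(y in ball t r) (`|u y - u t|)%:E <= (2 * r * e)%:E)%E.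
Proof.
move=> /fine_cvgP[fin /cvgrPdist_lt c] e0.
have := at_right0_ex (filterI fin (c e e0)) => -[h h0 H]; exists h => // r rh.
have [] := H r rh; case/andP: rh => r0 _; rewrite /= /davg /iavg.
rewrite (lebesgue_measure_ball t (ltW r0)).
rewrite inver mulrn_eq0/= gt_eqF//.
set I := integral _ _ _.
move=> f1 f2; change (I <= (2 * r * e)%:E)%E; have I0 : (0 <= I)%E by apply: integral_ge0.
have r2 : 0 < r *+ 2 by rewrite pmulrn_lgt0.
case: I I0 f1 f2 => [i| |]//=; last by rewrite gt0_muley// lte_fin invr_gt0.
rewrite lee_fin => i0 _ /=; rewrite sub0r normrN ger0_norm ?mulr_ge0 ?invr_ge0 ?(ltW r2)//.
by rewrite lee_fin mulrC ltr_pdivrMr// mulr_natl mulrC => /ltW.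
Qed.

(** The ball may leave the unit interval, where g is not prescribed. In the application u is built
    from an extension by zero, for which the Lebesgue point estimate is known on the whole ball. *)
Lemma Int_ball_le u (g : R -> R) t r (M : R) : itg g -> (forall y, 0 <= u y) ->
  (forall y, 0 <= y <= 1 -> g y = u y) ->
  (\int[mu]_(y in ball t r) (u y)%:E <= M%:E)%E ->
  Int (fun y => \1_(ball t r) y * g y) <= M.
Proof.
move=> gi u0 gu; rewrite -lee_fin => H.
have bi : bddm (\1_(ball t r) : R -> R) by apply: bddm_indic; exact: measurable_ball.
rewrite -itg_EFin; last exact: itgM.
apply: le_trans H; rewrite integral_mkcond [leRHS]integral_mkcond.
apply: ge0_le_integral_nonmeas => y _.
  rewrite patchE; case: ifPn => //; rewrite inE/= in_itv/= => y01.
  by rewrite lee_fin mulr_ge0// ?gu.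
rewrite !patchE; case: ifPn; last by case: ifP => //; rewrite lee_fin.
rewrite inE/= in_itv/= => y01; rewrite indicE gu//; case: (_ \in _) => /=.
  by rewrite mul1r.
by rewrite mul0r.
Qed.

(** The limit exists at every Lebesgue point of u inside the unit interval: near t the kernel is
    split into dyadic balls, and far from t it is O(1 - s). *)
Lemma poisson_boundary_ex u : itg u ->
  {ae mu, forall t, 0 <= t <= 1 -> forall e : R, 0 < e -> exists2 d : R, 0 < d &
    forall s, 1 - d < s < 1 -> `|Int (fun y => pk (s%:C * ee t)%C y * u y) - u t| <= e}.
Proof.
move=> ui; pose u0 := u \_ `[0%R, 1%R]%classic.
have u0E y : 0 <= y <= 1 -> u0 y = u y.
  by move=> y01; rewrite /u0 patchE mem_set//= in_itv.
have L := lebesgue_differentiation (integrable_locally_restrict (@meas01 R) ui).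
move: (ae_imply2 (fun t => @conj _ _) L (ae_imply2 (fun t => @conj _ _) (ae_neq 0) (ae_neq 1))).
apply: ae_imply => t [lt [t0 t1]] t01 e e0.
(* Here t - y stays in a compact part of ]-1, 1[, away from the zeros of sin(pi x) at 1 and -1; this
   is why the endpoints t = 0 and t = 1 are discarded. Capping c at 1 lets the same constant also
   serve for (1 - s)^2 in [ge]. *)
have [c c0 hc] : exists2 c : R, 0 < c <= 1 & forall y, 0 <= y <= 1 ->
    c * (t - y) ^+ 2 <= sin (pi * (t - y)) ^+ 2.
  have [|c c0 hc] := @sin_pi_lower (Num.max t (1 - t)).
    case/andP: t01 => t0' t1'; rewrite gt_max lt_neqAle t1 t1'/= gtrBl.
    by rewrite lt_neqAle eq_sym t0.
  exists (Num.min 1 c); first by rewrite lt_min ltr01 c0/= ge_min lexx.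
  move=> y /andP[y0 y1]; apply: (le_trans _ (hc _ _)).
    by rewrite ler_wpM2r ?sqr_ge0// ge_min lexx orbT.
  by rewrite ler_norml le_max; case/andP: t01 => t0' t1'; apply/andP; split;
    [rewrite lerNl le_max; apply/orP; right; lra|apply/orP; left; lra].
case/andP: c0 => c0 c1.
(* With 64 the balls contribute at most (2 / c) (e c / 8) 2 = e / 2, and by the choice of [D] the
   far part contributes at most (2 / c) (e c / 16) = e / 8. *)
have e1 : 0 < e * c / 64 by rewrite divr_gt0// mulr_gt0.
have [h h0 hh] := lebesgue_pt_ex lt e1.
pose g y := `|u y - u t|.
have gi : itg g by apply: itg_norm; apply: itgB => //; exact/bddm_itg/bddm_cst.
have G0 : 0 <= Int g by apply: Int_ge0 => y; exact: normr_ge0.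
have hg r : 0 < r < h -> Int (fun y => \1_(ball t r) y * g y) <= 2 * r * (e * c / 64).
  move=> rh; apply: (@Int_ball_le (fun y => `|u0 y - u0 t|)) => //; last exact: hh.
  by move=> y y01; rewrite !u0E.
pose D := e * c * h ^+ 2 / (64 * (Int g + 1)).
have D0 : 0 < D.
  by rewrite divr_gt0 ?mulr_gt0 ?exprn_gt0// ltr_wpDl.
exists (Num.min (Num.min 2^-1 h) D); first by rewrite !lt_min h0 D0 !andbT invr_gt0.
move=> s /andP[s1' s1]; pose d := 1 - s.
have : d < Num.min (Num.min 2^-1 h) D by rewrite /d ltrBlDr addrC -ltrBlDr.
rewrite !lt_min => /andP[/andP[d2 dh] dD].
have d0 : 0 < d by rewrite subr_gt0.
have s2 : 2^-1 < s by move: d2; rewrite /d; lra.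
have s0 : 0 < s by rewrite (lt_trans _ s2).
have zD : inD (s%:C * ee t)%C by rewrite /inD cabs_rad gtr0_norm.
have [J /andP[J1 J2]] := dyadic_scale d0 dh.
(* The Poisson kernel is at most (2 / c) d / (d^2 + (t - y)^2). The dyadic sum handles |t - y| < 2^J
   d, with all radii below h, and the constant handles the rest, where |t - y| >= h / 2. *)
pose ker y := (2 / c) * (\sum_(j < J.+1) (4 * 4 ^- j / d) * \1_(ball t (2 ^+ j * d)) y + 4 * d / h ^+ 2).
have pker y : 0 <= y <= 1 -> pk (s%:C * ee t)%C y <= ker y.
  move=> y01; rewrite /pk poisson_den cabs_rad (gtr0_norm s0).
  apply: (@le_trans _ _ (2 / c * (d / (d ^+ 2 + (t - y) ^+ 2)))).
    have q0 : 0 < d ^+ 2 + (t - y) ^+ 2 by rewrite ltr_wpDr ?sqr_ge0// exprn_gt0.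
    have ge : c * (d ^+ 2 + (t - y) ^+ 2) <= (1 - s) ^+ 2 + 4 * s * sin (pi * (t - y)) ^+ 2.
      have A1 : c * d ^+ 2 <= (1 - s) ^+ 2 by rewrite -/d ler_piMl ?sqr_ge0.
      have A2 : sin (pi * (t - y)) ^+ 2 <= 4 * s * sin (pi * (t - y)) ^+ 2.
        by rewrite ler_peMl ?sqr_ge0//; lra.
      by rewrite mulrDr lerD// (le_trans (hc _ y01)).
    have cq0 : 0 < c * (d ^+ 2 + (t - y) ^+ 2) by rewrite mulr_gt0.
    rewrite [leRHS]mulf_div; apply: ler_pM.
    - by rewrite subr_ge0 exprn_ile1 ?ltW.
    - by rewrite invr_ge0 (le_trans (ltW cq0)).
    - by rewrite /d expr2; nra.
    - by rewrite lef_pV2 ?posrE// (lt_le_trans cq0).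
  rewrite /ker ler_pM2l ?divr_gt0//.
  have xx : (t - y) ^+ 2 = `|t - y| ^+ 2 by rewrite real_normK ?num_real.
  rewrite xx; have [lt'|ge'] := ltP `|t - y| (2 ^+ J * d).
    rewrite (le_trans (dyadic_kernel d0 (normr_ge0 _) lt'))//.
    rewrite (eq_bigr (fun j : 'I_J.+1 => 4 * 4 ^- j / d * \1_(ball t (2 ^+ j * d)) y)); last first.
      move=> j _; rewrite indicE; congr (_ * _); congr (_%:R); congr nat_of_bool.
      by apply/idP/idP; rewrite inE.
    by rewrite lerDl mulr_ge0 ?invr_ge0 ?sqr_ge0// mulr_ge0// ltW.
  have hx : h / 2 <= `|t - y| := le_trans J1 ge'.
  apply: (@le_trans _ _ (4 * d / h ^+ 2)); last first.
    rewrite lerDr sumr_ge0// => j _; apply: mulr_ge0; last by rewrite indicE.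
    by rewrite !mulr_ge0 ?invr_ge0 ?exprn_ge0// ltW.
  have h4 : (h / 2) ^+ 2 <= `|t - y| ^+ 2 by rewrite lerXn2r ?nnegrE// divr_ge0// ltW.
  have h2 : 0 < h ^+ 2 by rewrite exprn_gt0.
  rewrite -mulrA mulrCA ler_wpM2l ?(ltW d0)// ler_pdivlMr// mulrC ler_pdivrMr.
    by move: h4; rewrite expr_div_n; have := sqr_ge0 d; lra.
  by rewrite ltr_wpDr ?sqr_ge0// exprn_gt0.
have bi r : bddm (\1_(ball t r) : R -> R) by apply: bddm_indic; exact: measurable_ball.
have bp := bddm_pk zD.
have -> : Int (fun y => pk (s%:C * ee t)%C y * u y) - u t =
  Int (fun y => pk (s%:C * ee t)%C y * (u y - u t)).
  rewrite -{1}[u t]mulr1 -[X in _ - _ * X](Int_pk zD) -IntZ; last exact: bddm_itg.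
  rewrite -IntB; [|exact: itgM|exact/itgZ/bddm_itg].
  by congr Int; apply/funext => y; ring.
have ii : itg (fun y => u y - u t) by apply: itgB => //; exact/bddm_itg/bddm_cst.
apply: (le_trans (Int_norm (itgM bp ii))).
have b1 j : itg (fun y => (4 * 4 ^- j / d) * (\1_(ball t (2 ^+ j * d)) y * g y)).
  exact/itgZ/itgM.
apply: (@le_trans _ _ (2 / c * (\sum_(j < J.+1) (4 * 4 ^- j / d) * (2 * (2 ^+ j * d) * (e * c / 64))
   + 4 * d / h ^+ 2 * Int g))).
  have E : (fun y => ker y * g y) = (fun y => 2 / c * (\sum_(j < J.+1) (4 * 4 ^- j / d) *
     (\1_(ball t (2 ^+ j * d)) y * g y) + 4 * d / h ^+ 2 * g y)).
    apply/funext => y; rewrite /ker -[LHS]mulrA [X in _ * X = _]mulrDl mulr_suml; congr (_ * (_ + _)).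
    by apply: eq_bigr => j _; rewrite mulrA.
  have bk : bddm ker.
    apply/bddmZ/bddmD; last exact: bddm_cst.
    by apply: (@bddm_sum _ _ (fun j y => (4 * 4 ^- j / d) * \1_(ball t (2 ^+ j * d)) y)) => j; exact: bddmZ.
  apply: (@le_trans _ _ (Int (fun y => ker y * g y))).
    apply: Int_le; [exact/itg_norm/itgM|exact: itgM|].
    move=> y y01; rewrite normrM (ger0_norm (pk_ge0 _ zD)) ler_wpM2r//; exact: pker.
  have iS : itg (fun y => \sum_(j < J.+1) (4 * 4 ^- j / d) * (\1_(ball t (2 ^+ j * d)) y * g y)).
    have -> : (fun y => \sum_(j < J.+1) (4 * 4 ^- j / d) * (\1_(ball t (2 ^+ j * d)) y * g y)) =
      (fun y => (\sum_(j < J.+1) (4 * 4 ^- j / d) * \1_(ball t (2 ^+ j * d)) y) * g y).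
      by apply/funext => y; rewrite mulr_suml; apply: eq_bigr => j _; rewrite mulrA.
    apply: itgM => //.
    by apply: (@bddm_sum _ _ (fun j y => (4 * 4 ^- j / d) * \1_(ball t (2 ^+ j * d)) y)) => j; exact: bddmZ.
  rewrite E IntZ; last by apply: itgD => //; exact: itgZ.
  rewrite ler_pM2l ?divr_gt0// IntD//; last exact: itgZ.
  rewrite IntZ// lerD2r (@Int_sum _ _ (fun j y => (4 * 4 ^- j / d) * (\1_(ball t (2 ^+ j * d)) y * g y)))//.
  apply: ler_sum => j _; rewrite IntZ; last exact: itgM.
  rewrite ler_wpM2l//; first by rewrite !mulr_ge0 ?invr_ge0 ?exprn_ge0// ltW.
  apply: hg; rewrite mulr_gt0 ?exprn_gt0//= (le_lt_trans _ J2)// ler_pM2r//.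
  by rewrite ler_weXn2l ?ler1n// -ltnS.
have -> : \sum_(j < J.+1) (4 * 4 ^- j / d) * (2 * (2 ^+ j * d) * (e * c / 64)) =
   (e * c / 8) * \sum_(j < J.+1) 2^-1 ^+ j.
  rewrite mulr_sumr; apply: eq_bigr => j _.
  rewrite exprVn (_ : 4 = 2 ^+ 2 :> R); last by ring.
  by rewrite -exprM mulnC exprM; field; rewrite (gt_eqF d0) expf_neq0.
have geo : \sum_(j < J.+1) (2^-1 : R) ^+ j <= 2.
  rewrite [leRHS](_ : 2 = (1 - 2^-1)^-1 :> R); last by field.
  by apply: geo_sum_le; exact: half01.
have h2 : 0 < h ^+ 2 by rewrite exprn_gt0.
have t2 : 4 * d / h ^+ 2 * Int g <= e * c / 16.
  have : d * (64 * (Int g + 1)) <= e * c * h ^+ 2.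
    by rewrite -ler_pdivlMr ?ltW// mulr_gt0// ltr_wpDl.
  by move=> dG; rewrite [leLHS]mulrAC ler_pdivrMr//; nra.
rewrite mulrC mulrA ler_pdivrMr//.
have : e * c / 8 * \sum_(j < J.+1) (2^-1 : R) ^+ j <= e * c / 8 * 2.
  by rewrite ler_pM2l// divr_gt0// mulr_gt0.
have := mulr_gt0 e0 c0; lra.
Qed.

End BoundaryValues.

(** * Fatou's theorem *)

Section Parseval.
Context {R : realType}.
Implicit Types (f : R[i] -> R[i]) (p : {poly R[i]}).

Lemma parseval (c : nat -> R[i]) n :
  Int (fun t => cabs (\sum_(k < n) c k * ee t ^+ k) ^+ 2) = \sum_(k < n) cabs (c k) ^+ 2.
Proof.
pose F t := \sum_(k < n) c k * ee t ^+ k.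
have bF : cbddm F.
  by apply: (@cbddm_sum _ _ (fun k t => c k * ee t ^+ k)) => k; exact/cbddmZ/cbddmX/cbddm_ee.
have b k : cbddm (fun t => F t * ee (- t) ^+ k) by apply: cbddmM => //; exact/cbddmX/cbddm_eeN.
suff : (Int (fun t => cabs (F t) ^+ 2))%:C%C = (\sum_(k < n) cabs (c k) ^+ 2)%:C%C by move=> [].
rewrite -cint_real.
have -> : (fun t => (cabs (F t) ^+ 2)%:C%C) =
  (fun t => \sum_(k < n) (c k)^*%C * (F t * ee (- t) ^+ k)).
  apply/funext => t; rewrite -mul_conj.
  have -> : (F t)^*%C = \sum_(k < n) (c k)^*%C * ee (- t) ^+ k.
    rewrite /F [LHS]rmorph_sum; apply: eq_bigr => k _.
    by rewrite rmorphM rmorphXn [X in _ * X ^+ _]ee_conj.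
  by rewrite mulr_sumr; apply: eq_bigr => k _; rewrite mulrCA.
rewrite (@cint_sum _ _ (fun k t => (c k)^*%C * (F t * ee (- t) ^+ k))); last first.
  by move=> k; exact/citgZ/cbddm_citg.
rewrite rmorph_sum; apply: eq_bigr => k _; rewrite cintZ; last exact/cbddm_citg.
have := cint_horner (\poly_(j < n) c j) 1 k.
rewrite coef_poly ltn_ord expr1n mulr1.
have -> : (fun t : R => (\poly_(j < n) c j).[(1%:C * ee t)%C] * ee (- t) ^+ k) =
   (fun t => F t * ee (- t) ^+ k).
  by apply/funext => t; rewrite mul1r horner_poly.
by move=> ->; rewrite mulrC mul_conj.
Qed.

Lemma cabs_dist_sub (z w : R[i]) : `|cabs z - cabs w| <= cabs (z - w).
Proof.
rewrite ler_norml; apply/andP; split.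
  by rewrite lerNl opprB lerBlDr [cabs (z - w)]cabsC -{1}[w](subrK z) cabsD.
by rewrite lerBlDr -{1}[z](subrK w) cabsD.
Qed.

(** By Parseval this holds term by term: (a - b)^2 <= a^2 - b^2 for 0 <= b <= a, with a = r^k and b
    = s^k. *)
Lemma poly_L2_cauchy p (r s : R) : 0 <= s -> s <= r ->
  Int (fun t => cabs (p.[(r%:C * ee t)%C] - p.[(s%:C * ee t)%C]) ^+ 2) <=
  Int (fun t => cabs p.[(r%:C * ee t)%C] ^+ 2) - Int (fun t => cabs p.[(s%:C * ee t)%C] ^+ 2).
Proof.
move=> s0 sr; have r0 : 0 <= r := le_trans s0 sr.
have E (x : R) : (fun t => cabs p.[(x%:C * ee t)%C] ^+ 2) =
  (fun t => cabs (\sum_(k < size p) (p`_k * x%:C%C ^+ k) * ee t ^+ k) ^+ 2).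
  apply/funext => t; rewrite horner_coef; congr (cabs _ ^+ _); apply: eq_bigr => k _.
  by rewrite exprMn mulrA.
have E2 : (fun t => cabs (p.[(r%:C * ee t)%C] - p.[(s%:C * ee t)%C]) ^+ 2) =
  (fun t => cabs (\sum_(k < size p) (p`_k * (r%:C%C ^+ k - s%:C%C ^+ k)) * ee t ^+ k) ^+ 2).
  apply/funext => t; rewrite !horner_coef -sumrB; congr (cabs _ ^+ _); apply: eq_bigr => k _.
  by rewrite !exprMn; ring.
have I x : Int (fun t => cabs p.[(x%:C * ee t)%C] ^+ 2) = \sum_(k < size p) cabs (p`_k * x%:C%C ^+ k) ^+ 2.
  by rewrite E (@parseval (fun k => p`_k * x%:C%C ^+ k)).
apply: (@le_trans _ _ (\sum_(k < size p) cabs (p`_k * (r%:C%C ^+ k - s%:C%C ^+ k)) ^+ 2)).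
  by rewrite E2 (@parseval (fun k => p`_k * (r%:C%C ^+ k - s%:C%C ^+ k))).
rewrite (I r) (I s) -sumrB; apply: ler_sum => k _; rewrite !cabsM !exprMn -mulrBr ler_wpM2l ?sqr_ge0//.
rewrite -!rmorphXn -rmorphB !cabs_real !real_normK ?num_real//=.
have sk : 0 <= s ^+ k by rewrite exprn_ge0.
have : s ^+ k <= r ^+ k by rewrite lerXn2r ?nnegrE.
by move: (s ^+ k) (r ^+ k) sk => a b; nra.
Qed.

(** This serves as a Cauchy criterion: the quadratic means increase with the radius and stay below
    1, so the dilates of f form an L2 Cauchy family as the radius tends to 1. *)
Lemma analytic_L2_cauchy f (r s : R) : poly_approx f ->
  (forall z, inD z -> cabs (f z) <= 1) -> 0 <= s -> s <= r -> r < 1 ->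
  Int (fun t => cabs (f (r%:C * ee t)%C - f (s%:C * ee t)%C) ^+ 2) <=
  Int (fun t => cabs (f (r%:C * ee t)%C) ^+ 2) - Int (fun t => cabs (f (s%:C * ee t)%C) ^+ 2).
Proof.
move=> fa f1 s0 sr r1; have r0 : 0 <= r := le_trans s0 sr.
have r01 : 0 <= r < 1 by rewrite r0. have s01 : 0 <= s < 1 by rewrite s0 (le_lt_trans sr).
(* 26 = 20 + 3 + 3: replacing f by p costs 20 e in the L2 distance ([A1]) and 3 e in each of the two
   quadratic means ([A2]). *)
apply/ler_addgt0Pr => e' e'0; pose e := Num.min 1 (e' / 26).
have e0 : 0 < e by rewrite lt_min ltr01 divr_gt0.
have e1 : e <= 1 by rewrite ge_min lexx.
have ee' : 26 * e <= e' by rewrite mulrC -ler_pdivlMr// ge_min lexx orbT.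
have [p hp] := fa r e r01 e0.
have hr (t : R) : cabs (f (r%:C * ee t)%C - p.[(r%:C * ee t)%C]) <= e.
  by apply: hp; rewrite cabs_rad ger0_norm.
have hs (t : R) : cabs (f (s%:C * ee t)%C - p.[(s%:C * ee t)%C]) <= e.
  by apply: hp; rewrite cabs_rad ger0_norm.
have fr (t : R) : cabs (f (r%:C * ee t)%C) <= 1 by apply: f1; rewrite /inD cabs_rad ger0_norm.
have fs (t : R) : cabs (f (s%:C * ee t)%C) <= 1.
  by apply: f1; rewrite /inD cabs_rad ger0_norm// (le_lt_trans sr).
have bf := poly_approx_bddm r01 fa; have bs := poly_approx_bddm s01 fa.
have bpr := cbddm_horner p r; have bps := cbddm_horner p s.
have sq (g : R -> R[i]) : cbddm g -> itg (fun t => cabs (g t) ^+ 2).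
  by move=> bg; exact/bddm_itg/bddmX/bddm_cabs.
have P := poly_L2_cauchy p s0 sr.
have A1 : Int (fun t => cabs (f (r%:C * ee t)%C - f (s%:C * ee t)%C) ^+ 2) <=
   Int (fun t => cabs (p.[(r%:C * ee t)%C] - p.[(s%:C * ee t)%C]) ^+ 2) + 20 * e.
  rewrite -[20 * e]Int_cst -IntD; [|exact/sq/cbddmB|exact/bddm_itg/bddm_cst].
  apply: Int_le; [exact/sq/cbddmB|apply: itgD; [exact/sq/cbddmB|exact/bddm_itg/bddm_cst]|].
  move=> t _; have := hr t; have := hs t; have := fr t; have := fs t.
  set a := f _; set b := f _; set c := p.[_]; set d := p.[_] => h1 h2 h3 h4.
  have h5 : cabs (b - a) <= cabs (d - c) + 2 * e.
    rewrite (_ : b - a = (d - c) + ((b - d) - (a - c))); last by ring.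
    rewrite (le_trans (cabsD _ _))// lerD2l (le_trans (cabsB _ _))//; lra.
  have h6 : cabs (d - c) <= cabs (b - a) + 2 * e.
    rewrite (_ : d - c = (b - a) - ((b - d) - (a - c))); last by ring.
    rewrite (le_trans (cabsB _ _))// lerD2l (le_trans (cabsB _ _))//; lra.
  have h7 : cabs (b - a) <= 2 by rewrite (le_trans (cabsB _ _))//; lra.
  have := cabs_ge0 (b - a); have := cabs_ge0 (d - c).
  move: (cabs (b - a)) (cabs (d - c)) h5 h6 h7 => x y h5 h6 h7 y0 x0.
  have h8 : x ^+ 2 <= (y + 2 * e) ^+ 2 by rewrite lerXn2r ?nnegrE//; lra.
  nra.
have A2 (x : R) (g : R -> R[i]) : (forall t, cabs (g t) <= 1) -> cbddm g ->
   (forall t, cabs (g t - p.[(x%:C * ee t)%C]) <= e) ->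
   `|Int (fun t => cabs (g t) ^+ 2) - Int (fun t => cabs p.[(x%:C * ee t)%C] ^+ 2)| <= 3 * e.
  move=> g1 bg hg; have bpx := cbddm_horner p x.
  rewrite -IntB; [|exact: sq|exact: sq].
  rewrite (le_trans (Int_norm _))//; first by apply: itgB; exact: sq.
  rewrite -[leRHS]Int_cst; apply: Int_le; [|exact/bddm_itg/bddm_cst|].
    by apply: itg_norm; apply: itgB; exact: sq.
  move=> t _; have := le_trans (cabs_dist_sub _ _) (hg t); have := g1 t.
  have := cabs_ge0 (g t); have := cabs_ge0 p.[(x%:C * ee t)%C].
  move: (cabs (g t)) (cabs p.[_]) => a b b0 a0 a1 h.
  rewrite subr_sqr normrM [`|a + b|]ger0_norm ?addr_ge0// [leRHS]mulrC ler_pM ?addr_ge0//.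
  by move: h; rewrite ler_norml => /andP[]; lra.
have := A2 r _ fr bf hr; have := A2 s _ fs bs hs; rewrite !ler_norml => /andP[] + + /andP[].
lra.
Qed.

Lemma radial_continuous f (z : R[i]) (e : R) : poly_approx f -> inD z -> 0 < e ->
  exists2 d : R, 0 < d & forall s, 1 - d < s <= 1 -> cabs (f (s%:C%C * z) - f z) <= e.
Proof.
move=> fa zD e0; have z01 : 0 <= cabs z < 1 by rewrite cabs_ge0.
have e3 : 0 < e / 3 by rewrite divr_gt0.
have [p hp] := fa _ _ z01 e3.
pose L := \sum_(k < size p) cabs p`_k * k%:R.
have L0 : 0 <= L by apply: sumr_ge0 => k _; rewrite mulr_ge0 ?cabs_ge0.
exists (Num.min 1 (e / 3 / (L + 1))); first by rewrite lt_min ltr01 divr_gt0// ltr_wpDl.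
move=> s /andP[s1 s2]; have : 1 - s < Num.min 1 (e / 3 / (L + 1)) by rewrite ltrBlDr addrC -ltrBlDr.
rewrite lt_min => /andP[sa sb]; have s0 : 0 < s by lra.
have sz : cabs (s%:C%C * z) <= cabs z.
  by rewrite cabsM cabs_real gtr0_norm// ler_piMl ?cabs_ge0.
have P : cabs (p.[s%:C%C * z] - p.[z]) <= e / 3.
  apply: (@le_trans _ _ (L * (1 - s))).
    rewrite !horner_coef -sumrB (le_trans (cabs_sum _ _ _))// mulr_suml; apply: ler_sum => k _.
    rewrite -mulrBr cabsM -mulrA ler_wpM2l ?cabs_ge0//.
    have z1 : cabs z <= 1 by exact: ltW.
    rewrite (le_trans (cabs_subXX _ (le_trans sz z1) z1))// expr1n mulr1 ler_wpM2l//.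
    rewrite -{2}[z]mul1r -mulrBl cabsM -(rmorph1 (real_complex R)) -rmorphB cabs_real distrC.
    by rewrite ger0_norm ?subr_ge0// ler_piMr// subr_ge0.
  move: sb; rewrite ltr_pdivlMr ?ltr_wpDl// => sb; nra.
rewrite (_ : f _ - f z = (f (s%:C%C * z) - p.[s%:C%C * z]) + (p.[s%:C%C * z] - p.[z])
   - (f z - p.[z])); last by ring.
rewrite (le_trans (cabsB _ _))//; have := cabsD (f (s%:C%C * z) - p.[s%:C%C * z]) (p.[s%:C%C * z] - p.[z]).
have := hp _ sz; have := hp _ (lexx _); lra.
Qed.

End Parseval.

(** * Boundary function and radial limits of a bounded analytic function *)

Section FatouTheorem.
Context {R : realType}.
Local Notation mu := (@lebesgue_measure R).
Implicit Types (f : R[i] -> R[i]) (t : R).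

Lemma nneseries_le_ub (u : nat -> \bar R) (K : \bar R) : (forall n, (0 <= u n)%E) ->
  (forall n, (\sum_(0 <= i < n) u i <= K)%E) -> (\sum_(0 <= i <oo) u i <= K)%E.
Proof.
move=> u0 uK; apply: lime_le; last by apply: nearW.
by apply: is_cvg_nneseries => n _ _; exact: u0.
Qed.

Lemma summable_ae (h : nat -> R -> R) (K : R) : (forall j, bddm (h j)) ->
  (forall j t, 0 <= h j t) -> (forall n, \sum_(j < n) Int (h j) <= K) ->
  {ae mu, forall t, 0 <= t <= 1 -> (\sum_(0 <= j <oo) (h j t)%:E < +oo)%E}.
Proof.
move=> bh h0 hK.
have m j : measurable_fun (`[0%R, 1%R]%classic : set R) (fun t => (h j t)%:E).
  by apply/measurable_EFinP/measurable_funTS; case: (bh j).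
have mW : measurable_fun (`[0%R, 1%R]%classic : set R) (fun t => \sum_(0 <= j <oo) (h j t)%:E)%E.
  have := @ge0_emeasurable_sum _ _ R (`[0%R, 1%R]%classic : set R)
    (fun j t => (h j t)%:E) xpredT.
  by apply => //= j t _ _; rewrite lee_fin.
have W0 t : (0 <= \sum_(0 <= j <oo) (h j t)%:E)%E.
  by apply: nneseries_ge0 => n _ _; rewrite lee_fin.
have IW : mu.-integrable `[0%R, 1%R] (fun t => \sum_(0 <= j <oo) (h j t)%:E)%E.
  apply/integrableP; split => //.
  under eq_integral do rewrite gee0_abs//.
  rewrite integral_nneseries//; last by move=> n t _; rewrite lee_fin.
  apply: (@le_lt_trans _ _ K%:E); last exact: ltry.
  apply: nneseries_le_ub.
    by move=> n; apply: integral_ge0 => t _; rewrite lee_fin.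
  move=> n; under eq_bigr do rewrite (itg_EFin (bddm_itg (bh _))).
  by rewrite sumEFin lee_fin big_mkord.
have := @integrable_ae _ _ _ mu _ (@meas01 R) _ IW.
apply: ae_imply => t ht t01.
have := ht _; rewrite /= in_itv/= => /(_ t01).
by rewrite ge0_fin_numE.
Qed.

Lemma summable_cvg (a h : nat -> R) : (forall j, `|a j.+1 - a j| <= h j) ->
  (\sum_(0 <= j <oo) (h j)%:E < +oo)%E -> cvgn a.
Proof.
move=> ah hs; have h0 j : 0 <= h j := le_trans (normr_ge0 _) (ah j).
have -> : a = (fun n => a 0%N + series (telescope a) n).
  by apply/funext => n; exact: eq_sum_telescope.
apply: is_cvgD; first exact: is_cvg_cst.
apply: (@normed_cvg _ R^o); apply: nondecreasing_is_cvgn.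
  by apply: nondecreasing_series => n _ _; exact: normr_ge0.
exists (fine (\sum_(0 <= j <oo) (h j)%:E)%E) => _ [n _ <-].
rewrite -lee_fin fineK; last first.
  by rewrite ge0_fin_numE// nneseries_ge0// => j _ _; rewrite lee_fin.
rewrite /series/= -sumEFin; apply: (le_trans _ (nneseries_lim_ge n _)).
  by apply: lee_sum => j _; rewrite lee_fin; exact: ah.
by move=> j _ _; rewrite lee_fin.
Qed.

Lemma mono_bounded_ex (M : R -> R) (K : R) : (forall s r, 0 <= s -> s <= r -> r < 1 -> M s <= M r) ->
  (forall r, 0 <= r < 1 -> M r <= K) -> forall e : R, 0 < e ->
  exists2 rho, 0 <= rho < 1 & forall r, rho <= r -> r < 1 -> M r <= M rho + e.
Proof.
move=> mM MK e e0; pose S := [set M r | r in [set r : R | 0 <= r < 1]].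
have hS : has_sup S.
  split; first by exists (M 0); exists 0 => //=; rewrite lexx ltr01.
  by exists K => _ [r r01 <-]; exact: MK.
have [_ [rho rho01 <-] h] := sup_adherent e0 hS.
exists rho => // r rr r1; move: h; rewrite ltrBlDr => h.
apply: (le_trans _ (ltW h)); apply: ub_le_sup; first by case: hS.
by exists r => //=; rewrite r1 andbT; case/andP: rho01 => rho0 _; exact: le_trans rr.
Qed.

(* Along radii increasing fast to 1 the dilates converge almost everywhere,
   because consecutive L2 distances are summable. *)
Lemma boundary_function f : poly_approx f -> (forall z, inD z -> cabs (f z) <= 1) ->
  exists g : R -> R[i], [/\ cbddm g, forall t, cabs (g t) <= 1 &
    forall z, inD z -> f z = cint (fun t => (pk z t)%:C%C * g t)].
Proof.
move=> fa f1.
pose M r := Int (fun t => cabs (f (r%:C * ee t)%C) ^+ 2).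
have sq r : 0 <= r < 1 -> itg (fun t => cabs (f (r%:C * ee t)%C) ^+ 2).
  by move=> r01; exact/bddm_itg/bddmX/bddm_cabs/poly_approx_bddm.
have mM s r : 0 <= s -> s <= r -> r < 1 -> M s <= M r.
  move=> s0 sr r1; rewrite -subr_ge0; apply: (le_trans _ (analytic_L2_cauchy fa f1 s0 sr r1)).
  by apply: Int_ge0 => t; exact: sqr_ge0.
have MK r : 0 <= r < 1 -> M r <= 1.
  move=> r01; rewrite -[leRHS]Int_cst; apply: Int_le; [exact: sq|exact/bddm_itg/bddm_cst|].
  move=> t _; rewrite exprn_ile1 ?cabs_ge0// f1// /inD cabs_rad ger0_norm; by case/andP: r01.
(* An increment 4^-j of the quadratic mean is the square of an L2 distance 2^-j, so the distances
   between consecutive dilates are summable. *)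
have ex (j : nat) : exists rho, 0 <= rho < 1 /\ forall r, rho <= r -> r < 1 -> M r <= M rho + (4 ^+ j)^-1.
  have e0 : (0 : R) < (4 ^+ j)^-1 by rewrite invr_gt0 exprn_gt0.
  by have [rho ? ?] := mono_bounded_ex mM MK e0; exists rho.
have /choice[rho hrho] := ex.
(* Passing [rho j] gives the L2 estimate, passing 1 - 1/j forces convergence to 1, and monotonicity
   is what [analytic_L2_cauchy] asks for. *)
pose r := fix r (j : nat) : R := match j with
  | 0%N => rho 0%N
  | k.+1 => Num.max (r k) (Num.max (rho k.+1) (1 - k.+1%:R^-1)) end.
have r01 j : 0 <= r j < 1.
  elim: j => [|j IH] /=; first by case: (hrho 0%N).
  case/andP: IH => r0 r1; rewrite le_max r0/= !gt_max r1/=.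
  case: (hrho j.+1) => /andP[_ ->] _ /=.
  by rewrite ltrBlDr ltrDl invr_gt0.
have rS j : r j <= r j.+1 by rewrite /= le_max lexx.
have rrho j : rho j <= r j by case: j => [|j]/=; rewrite ?lexx// !le_max lexx orbT.
have rto1 (d : R) : 0 < d -> exists N, forall n, (N <= n)%N -> 1 - d < r n <= 1.
  move=> d0; have [N hN] := cvg0_ex (@cvg_harmonic R) d0.
  exists N.+1 => -[//|n] Nn; have /andP[_ r1] := r01 n.+1; rewrite (ltW r1) andbT.
  have : 1 - n.+1%:R^-1 <= r n.+1 by rewrite /= !le_max lexx !orbT.
  apply: lt_le_trans; rewrite ltrD2l ltrN2 (le_lt_trans (ler_norm _))//.
  exact: hN.
pose F j t := f ((r j)%:C * ee t)%C.
have bF j : cbddm (F j) by exact: poly_approx_bddm.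
have F1 j t : cabs (F j t) <= 1.
  by apply: f1; case/andP: (r01 j) => r0 r1; rewrite /inD cabs_rad ger0_norm.
pose h j t := cabs (F j.+1 t - F j t).
have bh j : bddm (h j) by exact/bddm_cabs/cbddmB.
have h0 j t : 0 <= h j t by exact: cabs_ge0.
have hI j : Int (h j) <= 2 * 2^-1 ^+ j.
  have L2 : Int (fun t => h j t ^+ 2) <= (4 ^+ j)^-1.
    have /andP[rj0 rj1] := r01 j; have /andP[rS0 rS1] := r01 j.+1.
    apply: (le_trans (analytic_L2_cauchy fa f1 rj0 (rS j) rS1)).
    have [/andP[rho0 _] H] := hrho j; have := H _ (le_trans (rrho j) (rS j)) rS1.
    by have := mM _ _ rho0 (rrho j) rj1; rewrite /M; lra.
  (* x <= 2^j x^2 + 2^-j *)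
  apply: (@le_trans _ _ (Int (fun t => 2 ^+ j * h j t ^+ 2 + 2^-1 ^+ j))).
    apply: Int_le; first exact: bddm_itg.
      by apply: bddm_itg; apply: bddmD; [exact/bddmZ/bddmX|exact: bddm_cst].
    move=> t _; rewrite exprVn; have p0 : (0 : R) < 2 ^+ j by rewrite exprn_gt0.
    rewrite -(ler_pM2l p0) mulrDr divff ?gt_eqF//.
    by have := h0 j t; move: (2 ^+ j) (h j t) p0 => a x a0 x0; have := sqr_ge0 (a * x - 1); nra.
  rewrite IntD; [|exact/bddm_itg/bddmZ/bddmX|exact/bddm_itg/bddm_cst].
  rewrite Int_cst IntZ; last exact/bddm_itg/bddmX.
  rewrite mulrDl mul1r lerD2r exprVn -ler_pdivlMl ?exprn_gt0// -invfM -exprMn.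
  by rewrite (_ : 2 * 2 = 4 :> R)//; ring.
have hK n : \sum_(j < n) Int (h j) <= 4.
  apply: (@le_trans _ _ (\sum_(j < n) 2 * 2^-1 ^+ j)); first by apply: ler_sum => j _.
  rewrite -mulr_sumr (_ : 4 = 2 * (1 - 2^-1)^-1 :> R); last by field.
  by rewrite ler_pM2l// geo_sum_le// half01.
(* Off A the dilates are replaced by 0, so that the limit exists, and is measurable, at every t; A
   has full measure in the unit interval. *)
pose A : set R := [set t | (\sum_(0 <= j <oo) (h j t)%:E < +oo)%E].
have mA : measurable A.
  rewrite -[A]setTI; apply: measurable_lte => //.
  have := @ge0_emeasurable_sum _ _ R (setT : set R) (fun j t => (h j t)%:E) xpredT.
  apply => //= [j t _ _|j _]; first by rewrite lee_fin.
  by apply/measurable_EFinP; case: (bh j).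
have aeA := summable_ae bh h0 hK.
have bA : bddm (\1_A : R -> R) by exact: bddm_indic.
have cv (P : R[i] -> R) : (forall z w, `|P z - P w| <= cabs (z - w)) ->
   forall t, cvgn (fun j => \1_A t * P (F j t)).
  move=> hP t; rewrite indicE; have [tA|tA] := boolP (t \in A); last first.
    by under eq_fun do rewrite mul0r; exact: is_cvg_cst.
  under eq_fun do rewrite mul1r.
  by apply: (@summable_cvg _ (fun j => h j t)) => [j|]; [exact: hP|rewrite inE in tA].
have LRe z w : `|complex.Re z - complex.Re w| <= cabs (z - w) :> R by rewrite -ReN -ReD Re_le_cabs.
have LIm z w : `|complex.Im z - complex.Im w| <= cabs (z - w) :> R by rewrite -ImN -ImD Im_le_cabs.
pose gr t := limn (fun j => \1_A t * complex.Re (F j t)).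
pose gi t := limn (fun j => \1_A t * complex.Im (F j t)).
have cr t : (fun j => \1_A t * complex.Re (F j t)) @ \oo --> gr t := cv _ LRe t.
have ci t : (fun j => \1_A t * complex.Im (F j t)) @ \oo --> gi t := cv _ LIm t.
have ind1 t x : `|x| <= 1 -> `|\1_A t * x| <= 1 :> R.
  by rewrite indicE; case: (_ \in _); rewrite ?mul1r ?mul0r ?normr0.
have bgr : bddm gr.
  apply: (@bddm_cvg _ (fun j t => \1_A t * complex.Re (F j t)) _ 1) => //.
    by move=> j; apply: measurable_funM; [case: bA|case: (bF j) => -[]].
  by move=> j t; apply: ind1; rewrite (le_trans (Re_le_cabs _)).
have bgi : bddm gi.
  apply: (@bddm_cvg _ (fun j t => \1_A t * complex.Im (F j t)) _ 1) => //.
    by move=> j; apply: measurable_funM; [case: bA|case: (bF j) => _ []].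
  by move=> j t; apply: ind1; rewrite (le_trans (Im_le_cabs _)).
exists (fun t => (gr t +i* gi t)%C); split => //.
- move=> t; rewrite -(@ler_pXn2r _ 2%N) ?nnegrE ?cabs_ge0// expr1n cabs_sqr/=.
  have c2 : (fun j => (\1_A t * complex.Re (F j t)) ^+ 2 + (\1_A t * complex.Im (F j t)) ^+ 2)
     @ \oo --> gr t ^+ 2 + gi t ^+ 2.
    by apply: cvgD; apply: cvgM.
  rewrite -(cvg_lim _ c2)//; apply: limr_le; first by apply/cvg_ex; eexists; exact: c2.
  apply: nearW => j; rewrite !exprMn -mulrDr -cabs_sqr.
  rewrite indicE; case: (_ \in _); rewrite ?expr0n ?mul0r// expr1n mul1r.
  by rewrite exprn_ile1 ?cabs_ge0.
move=> z zD; have bp := bddm_pk zD.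
(* Stated for a Lipschitz P so as to cover the real and the imaginary part. P(f(r_j z)) tends to
   P(f(z)) by continuity along the radius, and to the Poisson integral of G by dominated
   convergence. *)
have key (P : R[i] -> R) (G : R -> R) : (forall z w, `|P z - P w| <= cabs (z - w)) ->
  (forall j, P (f ((r j)%:C%C * z)) = Int (fun t => pk z t * P (F j t))) ->
  (forall t, (fun j => \1_A t * P (F j t)) @ \oo --> G t) ->
  (forall j, measurable_fun setT (fun t => P (F j t))) -> measurable_fun setT G ->
  (forall w, `|P w| <= cabs w) ->
  P (f z) = Int (fun t => pk z t * G t).
  move=> hP hI' cG mP mG P1.
  have c1 : (fun j => P (f ((r j)%:C%C * z))) @ \oo --> P (f z).
    apply/cvgrPdist_le => e e0; have [d d0 hd] := radial_continuous fa zD e0.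
    have [N hN] := rto1 _ d0; exists N => // n Nn /=.
    by rewrite (le_trans (hP _ _))// cabsC hd// hN.
  have c2 : (fun j => P (f ((r j)%:C%C * z))) @ \oo --> Int (fun t => pk z t * G t).
    under eq_fun do rewrite hI'.
    apply: (@Int_dct _ _ _ (pk z)) => //.
    - by move=> n; apply: measurable_funM => //; case: bp.
    - by apply: measurable_funM => //; case: bp.
    - apply: ae_imply aeA => t At t01; apply: cvgM; first exact: cvg_cst.
      have := cG t; rewrite indicE mem_set; last exact: At.
      by under eq_fun do rewrite mul1r.
    - exact: bddm_itg.
    - move=> n t; rewrite normrM (ger0_norm (pk_ge0 _ zD)) ler_piMr ?pk_ge0//.
      by rewrite (le_trans (P1 _)).
  by rewrite -(cvg_lim _ c1)// -(cvg_lim _ c2).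
have PF j : f ((r j)%:C%C * z) = cint (fun t => (pk z t)%:C%C * F j t).
  by rewrite -poisson_formula.
apply: complex_eq => /=.
- rewrite (key (@complex.Re R) gr)//.
  + by congr Int; apply/funext => t; rewrite mul0r subr0.
  + by move=> j; rewrite PF /=; congr Int; apply/funext => t; rewrite ReM /= mul0r subr0.
  + by move=> j; case: (bF j) => -[].
  + by case: bgr.
  + exact: Re_le_cabs.
- rewrite (key (@complex.Im R) gi)//.
  + by congr Int; apply/funext => t; rewrite mul0r addr0.
  + by move=> j; rewrite PF /=; congr Int; apply/funext => t; rewrite ImM /= mul0r addr0.
  + by move=> j; case: (bF j) => _ [].
  + by case: bgi.
  + exact: Im_le_cabs.
Qed.

(** The function g is built along one sequence of radii only. Since f is its Poisson integral, the
    Lebesgue points of its real and imaginary parts yield the full radial limit. *)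
Theorem fatou_radial_limit f : poly_approx f -> (forall z, inD z -> cabs (f z) <= 1) ->
  exists g : R -> R[i], [/\ cbddm g, forall t, cabs (g t) <= 1,
    forall z, inD z -> f z = cint (fun t => (pk z t)%:C%C * g t) &
    {ae mu, forall t, 0 <= t <= 1 -> radial_limit f t (g t)}].
Proof.
move=> fa f1; have [g [bg g1 fg]] := boundary_function fa f1; exists g; split => //.
have [br bi] := bg.
have := poisson_boundary_ex (bddm_itg br); have := poisson_boundary_ex (bddm_itg bi).
apply: ae_imply2 => t hi hr t01; apply/cvgrPdist_le => e e0.
have e2 : 0 < e / 2 by rewrite divr_gt0.
have [d1 d10 h1] := hr t01 _ e2; have [d2 d20 h2] := hi t01 _ e2.
exists (Num.min 1 (Num.min d1 d2)); first by rewrite /= !lt_min d10 d20 ltr01.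
move=> s /=; rewrite !lt_min => /andP[s3 /andP[s1 s2]] s4.
have ls : 1 - s = `|1 - s| by rewrite gtr0_norm// subr_gt0.
have s0 : 0 < s by move: s3; rewrite -ls; lra.
have sD : inD (s%:C * ee t)%C by rewrite /inD cabs_rad gtr0_norm.
rewrite sub0r normrN ger0_norm ?cabs_ge0// (le_trans (cabs_le_ReIm _))//.
rewrite [e]splitr fg// !ReD !ImD !ReN !ImN /=; apply: lerD.
- under eq_fun do rewrite ReM /= mul0r subr0.
  by apply: h1; rewrite s4 andbT; move: s1; rewrite -ls; lra.
- under eq_fun do rewrite ImM /= mul0r addr0.
  by apply: h2; rewrite s4 andbT; move: s2; rewrite -ls; lra.
Qed.

End FatouTheorem.

(** * Hardy norms *)

Section HardyNorm.
Context {R : realType}.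
Local Notation mu := (@lebesgue_measure R).
Implicit Types (f g : @cfun R) (p : R).

Lemma rad_inD (r t : R) : 0 <= r < 1 -> inD (r%:C * ee t)%C.
Proof. by move=> /andP[r0 r1]; rewrite /inD cabs_rad ger0_norm. Qed.

Lemma powRK (x p : R) : 0 <= x -> 0 < p -> (x `^ p) `^ p^-1 = x.
Proof. by move=> x0 p0; rewrite -powRrM divff ?gt_eqF// powRr1. Qed.

Lemma powRVK (x p : R) : 0 <= x -> 0 < p -> (x `^ p^-1) `^ p = x.
Proof. by move=> x0 p0; rewrite -powRrM mulVf ?gt_eqF// powRr1. Qed.

Lemma hp_norm_ge0 p f : 0 <= hp_norm p f.
Proof. exact: powR_ge0. Qed.

Lemma circ_mean_ge0 p f r : (0 <= circ_mean p f r)%E.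
Proof. by apply: integral_ge0 => t _; rewrite lee_fin powR_ge0. Qed.

Lemma hp_sup_ge0 p f : (0 <= hp_sup p f)%E.
Proof.
apply: (le_trans (circ_mean_ge0 p f 0)); apply: ereal_sup_ubound.
by exists 0 => //=; rewrite lexx ltr01.
Qed.

Lemma in_Hp_poly_approx p f : in_Hp p f -> poly_approx f.
Proof. by move=> [/analytic_poly_approx]. Qed.

Lemma bddm_powR (u : R -> R) p : 0 <= p -> bddm u -> (forall t, 0 <= u t) ->
  bddm (fun t => u t `^ p).
Proof.
move=> p0 [mu' [M hM]] u0; split.
  exact: (measurableT_comp (measurable_powR p)).
exists (M `^ p) => t; rewrite ger0_norm ?powR_ge0// ge0_ler_powR ?nnegrE//.
  by rewrite (le_trans (normr_ge0 _) (hM t)).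
by rewrite (le_trans _ (hM t))// ler_norm.
Qed.

Lemma bddm_cabs_powR p f (r : R) : 0 <= p -> 0 <= r < 1 -> poly_approx f ->
  bddm (fun t => cabs (f (r%:C * ee t)%C) `^ p).
Proof.
move=> p0 r01 fa; apply: bddm_powR => //; last by move=> t; exact: cabs_ge0.
exact/bddm_cabs/poly_approx_bddm.
Qed.

Lemma circ_meanE p f r : 0 <= p -> 0 <= r < 1 -> poly_approx f ->
  circ_mean p f r = (Int (fun t => cabs (f (r%:C * ee t)%C) `^ p))%:E.
Proof. by move=> p0 r01 fa; rewrite -itg_EFin//; exact/bddm_itg/bddm_cabs_powR. Qed.

Lemma hp_supE p f : 0 < p -> in_Hp p f -> hp_sup p f = (hp_norm p f `^ p)%:E.
Proof.
move=> p0 [_ fin]; rewrite /hp_norm powRVK ?fine_ge0 ?hp_sup_ge0//.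
by rewrite fineK// ge0_fin_numE ?hp_sup_ge0.
Qed.

Lemma Int_circ_le p f r : 0 < p -> 0 <= r < 1 -> in_Hp p f ->
  Int (fun t => cabs (f (r%:C * ee t)%C) `^ p) <= hp_norm p f `^ p.
Proof.
move=> p0 r01 fH; rewrite -lee_fin -circ_meanE ?(ltW p0)//; last exact: in_Hp_poly_approx fH.
by rewrite -hp_supE//; apply: ereal_sup_ubound; exists r.
Qed.

Lemma in_Hp_le p f (B : R) : 0 < p -> 0 <= B -> poly_approx f ->
  (forall r, 0 <= r < 1 -> Int (fun t => cabs (f (r%:C * ee t)%C) `^ p) <= B `^ p) ->
  in_Hp p f /\ hp_norm p f <= B.
Proof.
move=> p0 B0 fa fB.
have h : (hp_sup p f <= (B `^ p)%:E)%E.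
  by apply: ge_ereal_sup => _ [r r01 <-]; rewrite circ_meanE ?(ltW p0)// lee_fin fB.
have fin : (hp_sup p f < +oo)%E := le_lt_trans h (ltry _).
have fH : in_Hp p f by split => //; exact: poly_approx_analytic.
split=> //; rewrite -(powRK B0 p0) -[leLHS](powRK (hp_norm_ge0 p f) p0).
rewrite ge0_ler_powR ?nnegrE ?powR_ge0 ?invr_ge0 ?(ltW p0)//.
by rewrite -lee_fin -hp_supE.
Qed.

Lemma in_Hp_bounded p f (B : R) : 0 < p -> 0 <= B -> poly_approx f ->
  (forall z, inD z -> cabs (f z) <= B) -> in_Hp p f /\ hp_norm p f <= B.
Proof.
move=> p0 B0 fa fB; apply: in_Hp_le => // r r01.
rewrite -[leRHS]Int_cst; apply: Int_le.
- by apply/bddm_itg/bddm_cabs_powR => //; exact: ltW.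
- exact/bddm_itg/bddm_cst.
- move=> t _; rewrite ge0_ler_powR ?nnegrE ?cabs_ge0 ?(ltW p0)//.
  exact/fB/rad_inD.
Qed.

Lemma hp_norm_mono p f g : 0 < p -> poly_approx f -> in_Hp p g ->
  (forall z, inD z -> cabs (f z) <= cabs (g z)) -> in_Hp p f /\ hp_norm p f <= hp_norm p g.
Proof.
move=> p0 fa gH fg; have ga := in_Hp_poly_approx gH.
apply: in_Hp_le => //; first exact: hp_norm_ge0.
move=> r r01; apply: (le_trans _ (Int_circ_le p0 r01 gH)); apply: Int_le.
- by apply/bddm_itg/bddm_cabs_powR => //; exact: ltW.
- by apply/bddm_itg/bddm_cabs_powR => //; exact: ltW.
- move=> t _; rewrite ge0_ler_powR ?nnegrE ?cabs_ge0 ?(ltW p0)//.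
  exact/fg/rad_inD.
Qed.

Lemma in_HpZ p f (c : R[i]) : 0 < p -> in_Hp p f ->
  in_Hp p (fun z => c * f z) /\ hp_norm p (fun z => c * f z) <= cabs c * hp_norm p f.
Proof.
move=> p0 fH; have fa := in_Hp_poly_approx fH.
apply: in_Hp_le => //; first by rewrite mulr_ge0 ?cabs_ge0 ?hp_norm_ge0.
  by apply: poly_approxM => //; exact: poly_approx_cst.
move=> r r01; under eq_fun do rewrite cabsM powRM ?cabs_ge0//.
rewrite IntZ; last by apply/bddm_itg/bddm_cabs_powR => //; exact: ltW.
by rewrite powRM ?cabs_ge0 ?hp_norm_ge0// ler_wpM2l ?powR_ge0// Int_circ_le.
Qed.

(* Convexity with weights a / (a + b) and b / (a + b), taken with a and b
   slightly above the two norms, gives Minkowski's inequality. *)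
Lemma powR_add_convex p (a b x y : R) : 1 <= p -> 0 < a -> 0 < b -> 0 <= x -> 0 <= y ->
  (x + y) `^ p <= (a + b) `^ p * (a / (a + b) * (x `^ p / a `^ p) + b / (a + b) * (y `^ p / b `^ p)).
Proof.
move=> p1 a0 b0 x0 y0; have p0 : 0 < p by exact: lt_le_trans p1.
have ab : 0 < a + b by rewrite addr_gt0.
have ab0 : a + b != 0 by rewrite gt_eqF.
have divR (u v : R) : 0 <= u -> 0 < v -> u `^ p / v `^ p = (u / v) `^ p.
  move=> u0 v0; rewrite powRM ?invr_ge0 ?(ltW v0)//; congr (_ * _).
  rewrite -[v^-1]powR_inv1 ?ltW// -powRrM mulN1r -[LHS]powR_inv1 ?powR_ge0//.
  by rewrite -powRrM mulrN1.
rewrite (divR x a)// (divR y b)//.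
have w0 : 0 <= a / (a + b) by rewrite divr_ge0// ltW.
have w1 : a / (a + b) <= 1 by rewrite ler_pdivrMr// mul1r lerDl ltW.
have -> : b / (a + b) = 1 - a / (a + b) by field.
have xa : 0 <= x / a by rewrite divr_ge0// ltW.
have yb : 0 <= y / b by rewrite divr_ge0// ltW.
have C : (a / (a + b) * (x / a) + (1 - a / (a + b)) * (y / b)) `^ p <=
     a / (a + b) * (x / a) `^ p + (1 - a / (a + b)) * (y / b) `^ p.
  by apply: (convex_powR p1 (Itv01 w0 w1)); rewrite inE/= in_itv/= andbT.
apply: (le_trans _ (ler_wpM2l (powR_ge0 _ _) C)).
rewrite -powRM; [|exact: ltW|].
  rewrite (_ : (a + b) * _ = x + y)//.
  by field; rewrite ab0 !gt_eqF.
by rewrite addr_ge0// mulr_ge0// subr_ge0.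
Qed.

Lemma in_HpD p f g : 1 <= p -> in_Hp p f -> in_Hp p g ->
  in_Hp p (fun z => f z + g z) /\
  hp_norm p (fun z => f z + g z) <= hp_norm p f + hp_norm p g.
Proof.
move=> p1 fH gH; have p0 : 0 < p by exact: lt_le_trans p1.
have fa := in_Hp_poly_approx fH; have ga := in_Hp_poly_approx gH.
have fga := poly_approxD fa ga.
have key (a b : R) : hp_norm p f < a -> hp_norm p g < b -> in_Hp p (fun z => f z + g z) /\
    hp_norm p (fun z => f z + g z) <= a + b.
  move=> fa' gb'.
  have a0 : 0 < a by exact: le_lt_trans (hp_norm_ge0 p f) fa'.
  have b0 : 0 < b by exact: le_lt_trans (hp_norm_ge0 p g) gb'.
  have ab : 0 < a + b by rewrite addr_gt0.
  apply: in_Hp_le => //; first exact: ltW.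
  move=> r r01.
  have bf : bddm (fun t => cabs (f (r%:C * ee t)%C) `^ p) by apply: bddm_cabs_powR => //; exact: ltW.
  have bg : bddm (fun t => cabs (g (r%:C * ee t)%C) `^ p) by apply: bddm_cabs_powR => //; exact: ltW.
  pose ca := a / (a + b) / a `^ p; pose cb := b / (a + b) / b `^ p.
  apply: (@le_trans _ _ (Int (fun t => (a + b) `^ p * (ca * cabs (f (r%:C * ee t)%C) `^ p +
      cb * cabs (g (r%:C * ee t)%C) `^ p)))).
    apply: Int_le.
    - apply: bddm_itg; exact: (@bddm_cabs_powR p (fun z => f z + g z) r (ltW p0) r01 fga).
    - by apply: bddm_itg; apply: bddmZ; apply: bddmD; apply: bddmZ.
    move=> t _; set x := cabs (f _); set y := cabs (g _).
    apply: (@le_trans _ _ ((x + y) `^ p)).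
      by rewrite ge0_ler_powR ?nnegrE ?addr_ge0 ?cabs_ge0 ?(ltW p0)// cabsD.
    apply: (le_trans (powR_add_convex p1 a0 b0 (cabs_ge0 _) (cabs_ge0 _))).
    rewrite le_eqVlt; apply/orP; left; apply/eqP; rewrite -/x -/y /ca /cb.
    by move: (x `^ p) (y `^ p) ((a + b) `^ p) (a `^ p) (b `^ p) => *; ring.
  rewrite IntZ; last by apply: bddm_itg; apply: bddmD; apply: bddmZ.
  rewrite IntD; [|by apply: bddm_itg; exact: bddmZ|by apply: bddm_itg; exact: bddmZ].
  rewrite !IntZ; [|exact: bddm_itg|exact: bddm_itg].
  rewrite -[leRHS]mulr1 ler_wpM2l ?powR_ge0//.
  have ap : 0 < a `^ p by exact: powR_gt0.
  have bp : 0 < b `^ p by exact: powR_gt0.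
  have I1 : Int (fun t => cabs (f (r%:C * ee t)%C) `^ p) <= a `^ p.
    apply: (le_trans (Int_circ_le p0 r01 fH)).
    by apply: ge0_ler_powR; rewrite ?nnegrE ?hp_norm_ge0// ltW.
  have I2 : Int (fun t => cabs (g (r%:C * ee t)%C) `^ p) <= b `^ p.
    apply: (le_trans (Int_circ_le p0 r01 gH)).
    by apply: ge0_ler_powR; rewrite ?nnegrE ?hp_norm_ge0// ltW.
  apply: (@le_trans _ _ (a / (a + b) + b / (a + b))); last first.
    by rewrite -mulrDl divff// gt_eqF.
  apply: lerD; rewrite /ca /cb mulrAC ler_pdivrMr//.
  - by rewrite ler_wpM2l// divr_ge0// ltW.
  - by rewrite ler_wpM2l// divr_ge0// ltW.
split.
  by case: (key (hp_norm p f + 1) (hp_norm p g + 1)) => //; rewrite ltrDl.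
apply/ler_addgt0Pr => e e0; have e2 : 0 < e / 2 by rewrite divr_gt0.
case: (key (hp_norm p f + e / 2) (hp_norm p g + e / 2)); rewrite ?ltrDl// => _ h.
by rewrite (le_trans h)// addrACA -splitr.
Qed.

Lemma in_Hp0 p : 0 < p -> in_Hp p (fun=> 0 : R[i]) /\ hp_norm p (fun=> 0 : R[i]) <= 0.
Proof.
move=> p0; apply: in_Hp_bounded => //; first exact: poly_approx_cst.
by move=> z _; rewrite cabs0.
Qed.

Lemma in_Hp_sum p n (F : nat -> @cfun R) : 1 <= p -> (forall k, in_Hp p (F k)) ->
  in_Hp p (fun z => \sum_(k < n) F k z) /\
  hp_norm p (fun z => \sum_(k < n) F k z) <= \sum_(k < n) hp_norm p (F k).
Proof.
move=> p1 FH; have p0 : 0 < p by exact: lt_le_trans p1.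
elim: n => [|n [IH1 IH2]].
  by under eq_fun do rewrite big_ord0; rewrite big_ord0; exact: in_Hp0.
under eq_fun do rewrite big_ord_recr/=; rewrite big_ord_recr/=.
have [h1 h2] := in_HpD p1 IH1 (FH n); split => //.
by rewrite (le_trans h2)// lerD2r.
Qed.

(* The constant 2 avoids Jensen's inequality: [x <= a (1 + (x / a)^p)]. *)
Lemma Int_cabs_le p f r : 1 <= p -> 0 <= r < 1 -> in_Hp p f ->
  Int (fun t => cabs (f (r%:C * ee t)%C)) <= 2 * hp_norm p f.
Proof.
move=> p1 r01 fH; have p0 : 0 < p by exact: lt_le_trans p1.
have fa := in_Hp_poly_approx fH.
apply/ler_addgt0Pr => e e0; pose a := hp_norm p f + e / 2.
have e2 : 0 < e / 2 by rewrite divr_gt0.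
have a0 : 0 < a by rewrite ltr_wpDl ?hp_norm_ge0.
have ap : 0 < a `^ p by exact: powR_gt0.
have bf : bddm (fun t => cabs (f (r%:C * ee t)%C) `^ p) by apply: bddm_cabs_powR => //; exact: ltW.
apply: (@le_trans _ _ (Int (fun t => a + a / a `^ p * cabs (f (r%:C * ee t)%C) `^ p))).
  apply: Int_le.
  - exact/bddm_itg/bddm_cabs/poly_approx_bddm.
  - by apply: bddm_itg; apply: bddmD; [exact: bddm_cst|exact: bddmZ].
  move=> t _; set x := cabs _; have x0 : 0 <= x := cabs_ge0 _.
  have [xa|ax] := leP x a.
    by rewrite (le_trans xa)// lerDl mulr_ge0 ?powR_ge0// divr_ge0 ?powR_ge0// ltW.
  rewrite (le_trans _ (_ : a / a `^ p * x `^ p <= _)) ?lerDr ?(ltW a0)//.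
  have xa1 : 1 <= x / a by rewrite ler_pdivlMr// mul1r ltW.
  have := le1r_powR xa1 p1.
  have -> : (x / a) `^ p = x `^ p / a `^ p.
    rewrite powRM ?invr_ge0 ?(ltW a0)//; congr (_ * _).
    rewrite -[a^-1]powR_inv1 ?ltW// -powRrM mulN1r -[RHS]powR_inv1 ?powR_ge0//.
    by rewrite -powRrM mulrN1.
  by rewrite ler_pdivrMr// mulrC [a / _ * _]mulrAC -mulrA.
rewrite IntD; [|exact/bddm_itg/bddm_cst|by apply: bddm_itg; exact: bddmZ].
rewrite Int_cst IntZ; last exact: bddm_itg.
have : a / a `^ p * Int (fun t => cabs (f (r%:C * ee t)%C) `^ p) <= a.
  rewrite mulrAC ler_pdivrMr// ler_wpM2l ?(ltW a0)//.
  rewrite (le_trans (Int_circ_le p0 r01 fH))// ge0_ler_powR ?nnegrE ?hp_norm_ge0 ?(ltW p0)//.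
  - exact: ltW.
  - by rewrite lerDl ltW.
by rewrite /a; move: (hp_norm p f) (_ * Int _) => x y; lra.
Qed.

Lemma bernoulli_le (r : R) n : 0 <= r <= 1 -> 1 - r ^+ n <= n%:R * (1 - r).
Proof.
move=> /andP[r0 r1]; elim: n => [|n IH]; first by rewrite expr0 subrr mul0r.
rewrite (_ : 1 - r ^+ n.+1 = (1 - r) + r * (1 - r ^+ n)); last by rewrite exprS; ring.
rewrite -natr1 mulrDl mul1r addrC lerD2r (le_trans _ IH)// ler_piMl//.
by rewrite subr_ge0 exprn_ile1.
Qed.

(** Cauchy's estimate on the circle of radius 1 - d, as d tends to 0; Bernoulli's inequality bounds
    the loss c (1 - (1 - d)^n) by c n d, which d is chosen to keep below e. *)
Lemma coef_Hp_le p f n : 1 <= p -> in_Hp p f -> cabs (coef f n) <= 2 * hp_norm p f.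
Proof.
move=> p1 fH; have fa := in_Hp_poly_approx fH; set c := cabs _; set B := 2 * _.
have c0 : 0 <= c := cabs_ge0 _.
apply/ler_addgt0Pr => e e0; pose d := Num.min 2^-1 (e / (c * n%:R + 1)).
have cn : 0 <= c * n%:R by rewrite mulr_ge0.
have cn0 : 0 < c * n%:R + 1 by rewrite ltr_wpDl.
have d0 : 0 < d by rewrite lt_min invr_gt0 ltr0n/= divr_gt0.
have d1 : d < 1 by rewrite gt_min; apply/orP; left; lra.
have r01 : 0 <= 1 - d < 1 by apply/andP; split; lra.
have r01' : 0 <= 1 - d <= 1 by apply/andP; split; lra.
have key : c * (1 - d) ^+ n <= B.
  by rewrite (le_trans (coef_le n r01 fa))// (Int_cabs_le p1).
have de : c * (n%:R * d) <= e.
  rewrite mulrA; apply: (@le_trans _ _ (c * n%:R * (e / (c * n%:R + 1)))).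
    by rewrite ler_wpM2l// ge_min lexx orbT.
  by rewrite mulrC mulrAC ler_pdivrMr// ler_pM2l// lerDl.
have := bernoulli_le n r01'; rewrite subKr => bern.
have := ler_wpM2l c0 bern; rewrite mulrBr mulr1.
by move: key de; move: B (c * (n%:R * d)) (c * (1 - d) ^+ n) => *; lra.
Qed.

End HardyNorm.

(** * Nuclear operators are summing *)

Section NuclearSumming.
Context {R : realType}.
Implicit Types (f g : @cfun R) (p : R) (x : @cfun R -> R[i]).

Lemma dual_linear0 p x : 0 < p -> dual_Hp p x -> x (fun=> 0) = 0.
Proof.
move=> p0 [lin _]; have [H0 _] := @in_Hp0 R p p0.
have := lin 1 _ _ H0 H0; rewrite !mul1r addr0.
by move=> /(congr1 (fun y => y - x (fun=> 0))); rewrite subrr addrK.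
Qed.

Lemma dual_linearZ p x (c : R[i]) f : 0 < p -> dual_Hp p x -> in_Hp p f ->
  x (fun z => c * f z) = c * x f.
Proof.
move=> p0 dx fH; have [H0 _] := @in_Hp0 R p p0.
have := dx.1 c _ _ fH H0; rewrite (dual_linear0 p0 dx) addr0 => <-.
by congr x; apply/funext => z; rewrite addr0.
Qed.

Lemma dual_linear_sum p x n (c : nat -> R[i]) (F : nat -> @cfun R) : 1 <= p -> dual_Hp p x ->
  (forall k, in_Hp p (F k)) ->
  x (fun z => \sum_(k < n) c k * F k z) = \sum_(k < n) c k * x (F k).
Proof.
move=> p1 dx FH; have p0 : 0 < p by exact: lt_le_trans p1.
elim: n => [|n IH].
  by rewrite big_ord0 -[RHS](dual_linear0 p0 dx); congr x; apply/funext => z; rewrite big_ord0.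
rewrite big_ord_recr/= -IH addrC -dx.1//; last first.
  have H k : in_Hp p (fun z => c k * F k z) by case: (in_HpZ (c k) p0 (FH k)).
  by case: (@in_Hp_sum _ _ n _ p1 H).
by congr x; apply/funext => z; rewrite big_ord_recr/= addrC.
Qed.

(** Scaling f to norm 1 is the whole argument, except for norm 0, where the constant C of [dual_Hp]
    already gives x f = 0. *)
Lemma dual_norm_bound p x : 0 < p -> dual_Hp p x ->
  exists2 d : R, dual_norm p x = d%:E & 0 <= d /\ forall f, in_Hp p f -> cabs (x f) <= d * hp_norm p f.
Proof.
move=> p0 dx; have [lin [C hC]] := dx.
have [H0 n0] := @in_Hp0 R p p0.
have ge : (0 <= dual_norm p x)%E.
  apply: (@le_trans _ _ (cabs (x (fun=> 0)))%:E); first by rewrite lee_fin cabs_ge0.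
  by apply: ereal_sup_ubound; exists (fun=> 0) => //; split => //; rewrite (le_trans n0).
have le : (dual_norm p x <= `|C|%:E)%E.
  apply: ge_ereal_sup => _ [f [fH f1] <-]; rewrite lee_fin (le_trans (hC f fH))//.
  by rewrite (le_trans (ler_norm _))// normrM ler_piMr// ger0_norm ?hp_norm_ge0.
have fin : dual_norm p x \is a fin_num by rewrite ge0_fin_numE// (le_lt_trans le)// ltry.
exists (fine (dual_norm p x)); first by rewrite fineK.
split; first exact: fine_ge0.
move=> f fH; have [f0|f0] := eqVneq (hp_norm p f) 0.
  by have := hC f fH; rewrite f0 !mulr0.
have fp : 0 < hp_norm p f by rewrite lt_neqAle eq_sym f0 hp_norm_ge0.
rewrite -ler_pdivrMr// -lee_fin fineK//.
pose c : R[i] := ((hp_norm p f)^-1)%:C%C.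
have cc : cabs c = (hp_norm p f)^-1 by rewrite cabs_real ger0_norm// invr_ge0 ltW.
have [gH gn] := in_HpZ c p0 fH.
apply: ereal_sup_ubound; exists (fun z => c * f z).
  by split => //; rewrite (le_trans gn)// cc mulVf.
by rewrite (dual_linearZ c p0 dx fH) cabsM cc mulrC.
Qed.

Lemma dual_ball0 p : dual_ball p (fun=> 0 : R[i]).
Proof.
split; first split.
- by move=> a f g _ _; rewrite mulr0 addr0.
- by exists 0 => f _; rewrite cabs0 mul0r.
- by move=> f _; rewrite cabs0 hp_norm_ge0.
Qed.

(** Divided by its dual norm, each functional of the nuclear expansion lies in the dual ball, so its
    absolute values at the given vectors sum to at most that norm times the weak supremum b.
    Exchanging the sums over vectors and over functionals gives the constant S, the nuclear sum. *)
Lemma nuclear_summing p (T : @cfun R -> @cfun R) : 1 <= p ->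
  (forall f, in_Hp p f -> in_Hp p (T f)) -> nuclear_Hp p T -> summing_Hp p 1 T.
Proof.
move=> p1 TH [xs [ys [hx [hy [hS hT]]]]]; have p0 : 0 < p by exact: lt_le_trans p1.
have ex n : exists d : R, dual_norm p (xs n) = d%:E /\
    (0 <= d /\ forall f, in_Hp p f -> cabs (xs n f) <= d * hp_norm p f).
  by have [d ? ?] := dual_norm_bound p0 (hx n); exists d.
have /choice[d hd] := ex.
have dE n : dual_norm p (xs n) = (d n)%:E by case: (hd n).
have d0 n : 0 <= d n by case: (hd n) => _ [].
have dle n f : in_Hp p f -> cabs (xs n f) <= d n * hp_norm p f by case: (hd n) => _ [_]; apply.
pose u n := d n * hp_norm p (ys n).
have u0 n : 0 <= u n by rewrite mulr_ge0 ?hp_norm_ge0.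
have hS' : (\sum_(0 <= n <oo) (u n)%:E < +oo)%E.
  by move: hS; under eq_eseriesr do rewrite dE -EFinM.
have S0 : (0 <= \sum_(0 <= n <oo) (u n)%:E)%E by apply: nneseries_ge0 => n _ _; rewrite lee_fin.
pose S := fine (\sum_(0 <= n <oo) (u n)%:E)%E.
have SE : (\sum_(0 <= n <oo) (u n)%:E)%E = S%:E by rewrite fineK// ge0_fin_numE.
have Sge N : \sum_(m < N) u m <= S.
  rewrite -lee_fin -SE -sumEFin -(big_mkord xpredT (fun m => (u m)%:E)).
  by apply: nneseries_lim_ge => m _ _; rewrite lee_fin.
have S0' : 0 <= S by rewrite fine_ge0.
(* The 1 makes the constant positive when S is 0. *)
exists (S + 1); split; first by rewrite ltr_wpDl.
move=> n F FH; rewrite invr1.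
have sumpow (G : 'I_n -> R) : (forall k, 0 <= G k) -> (\sum_(k < n) G k `^ 1) `^ 1 = \sum_(k < n) G k.
  move=> G0; rewrite powRr1; last by apply: sumr_ge0 => k _; exact: powR_ge0.
  by apply: eq_bigr => k _; rewrite powRr1.
rewrite sumpow; last by move=> k; exact: hp_norm_ge0.
set B := ereal_sup _.
have inB x : dual_ball p x -> ((\sum_(k < n) cabs (x (F k)))%:E <= B)%E.
  move=> xb; apply: ereal_sup_ubound; exists x => //.
  by rewrite sumpow// => k; exact: cabs_ge0.
have B0 : (0 <= B)%E.
  apply: (le_trans _ (inB _ (dual_ball0 p))); rewrite lee_fin.
  by apply: sumr_ge0 => k _; exact: cabs_ge0.
have [Boo|Boo] := eqVneq B +oo%E.
  by rewrite Boo gt0_muley ?leey// lte_fin ltr_wpDl.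
have Bfin : B \is a fin_num by rewrite ge0_fin_numE// ltey.
pose b := fine B; have BE : B = b%:E by rewrite fineK.
have b0 : 0 <= b by rewrite fine_ge0.
rewrite BE -EFinM lee_fin.
have xb m : \sum_(k < n) cabs (xs m (F k)) <= d m * b.
  have [dm|dm] := eqVneq (d m) 0.
    rewrite dm mul0r big1// => k _; apply/eqP; rewrite eq_le cabs_ge0 andbT.
    by rewrite (le_trans (dle _ _ (FH k)))// dm mul0r.
  have dp : 0 < d m by rewrite lt_neqAle eq_sym dm d0.
  pose c : R[i] := ((d m)^-1)%:C%C.
  have cc : cabs c = (d m)^-1 by rewrite cabs_real ger0_norm// invr_ge0 ltW.
  have : dual_ball p (fun f => c * xs m f).
    split; first split.
    - move=> a f g fH gH; rewrite (hx m).1//; ring.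
    - exists 1 => f fH; rewrite cabsM cc mul1r ler_pdivrMl//; exact: dle.
    - move=> f fH; rewrite cabsM cc ler_pdivrMl//; exact: dle.
  move/inB; rewrite BE lee_fin => h.
  rewrite -ler_pdivrMl// mulr_sumr; apply: (le_trans _ h).
  by apply: ler_sum => k _; rewrite cabsM cc.
apply: (@le_trans _ _ (S * b)); last by rewrite ler_wpM2r// lerDl.
apply/ler_addgt0Pr => e e0.
(* One truncation index M serves all n vectors, and their n errors e / (n + 1) add up to at most
   e. *)
have en : 0 < e / (n%:R + 1) by rewrite divr_gt0// ltr_wpDl.
have ex2 (k : 'I_n) : exists N, forall m, (N <= m)%N ->
   hp_norm p (fun z => T (F k) z - \sum_(i < m) xs i (F k) * ys i z) <= e / (n%:R + 1).
  have [N hN] := cvg0_ex (hT _ (FH k)) en; exists N => m Nm.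
  by have := hN m Nm; rewrite ger0_norm ?hp_norm_ge0// => /ltW.
have /choice[N hN] := ex2.
pose M := (\max_(k < n) N k)%N.
have hM k := hN k M (leq_bigmax k).
have step k : hp_norm p (T (F k)) <= e / (n%:R + 1) + \sum_(i < M) cabs (xs i (F k)) * hp_norm p (ys i).
  pose G z := \sum_(i < M) xs i (F k) * ys i z.
  have H i : in_Hp p (fun z => xs i (F k) * ys i z) by case: (in_HpZ (xs i (F k)) p0 (hy i)).
  have [GH Gn] := @in_Hp_sum _ _ M _ p1 H.
  have [NH _] := in_HpZ (-1) p0 GH.
  have [DH _] := in_HpD p1 (TH _ (FH k)) NH.
  have [_] := in_HpD p1 DH GH.
  rewrite (_ : (fun z => _) = T (F k)); last by apply/funext => z; ring.
  move=> /le_trans; apply; apply: lerD.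
    apply: (le_trans _ (hM k)); rewrite le_eqVlt; apply/orP; left; apply/eqP.
    by congr (hp_norm p _); apply/funext => z; rewrite mulN1r.
  apply: (le_trans Gn); apply: ler_sum => i _.
  by case: (in_HpZ (xs i (F k)) p0 (hy i)).
apply: (@le_trans _ _ (\sum_(k < n) (e / (n%:R + 1) + \sum_(i < M) cabs (xs i (F k)) * hp_norm p (ys i)))).
  by apply: ler_sum => k _; exact: step.
rewrite big_split/= addrC; apply: lerD; last first.
  rewrite sumr_const card_ord -[leLHS]mulr_natl mulrCA ler_piMr ?(ltW e0)//.
  by rewrite ler_pdivrMr ?ltr_wpDl// mul1r lerDl.
rewrite exchange_big/=; apply: (@le_trans _ _ (\sum_(i < M) u i * b)).
  apply: ler_sum => i _; rewrite -mulr_suml /u mulrAC ler_wpM2r ?hp_norm_ge0//.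
by rewrite -mulr_suml ler_wpM2r.
Qed.

End NuclearSumming.

(** * Summing implies log-integrability *)

Section SummingLog.
Context {R : realType}.
Local Notation mu := (@lebesgue_measure R).
Implicit Types (f g w phi : @cfun R) (p r : R).

Lemma limn_einf_ge (u : nat -> \bar R) c N : (forall n, (N <= n)%N -> (c <= u n)%E) ->
  (c <= limn_einf u)%E.
Proof.
move=> h; rewrite limn_einf_lim; apply: lime_ge; first exact: is_cvg_einfs.
exists N => // n /= Nn; apply: le_ereal_inf_tmp => _ [k /= nk <-]; apply: h.
exact: leq_trans nk.
Qed.

Lemma limn_einf_le (u : nat -> \bar R) c : (forall n, (u n <= c)%E) -> (limn_einf u <= c)%E.
Proof.
move=> h; rewrite limn_einf_lim; apply: lime_le; first exact: is_cvg_einfs.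
apply: nearW => n; apply: (le_trans _ (h n)); apply: ereal_inf_lbound.
by exists n => /=.
Qed.

Lemma poly_approx_monom k : poly_approx (fun z : R[i] => z ^+ k).
Proof. exact/poly_approxX/poly_approx_id. Qed.

Lemma monom_Hp p k : 0 < p -> in_Hp p (fun z : R[i] => z ^+ k) /\ hp_norm p (fun z : R[i] => z ^+ k) <= 1.
Proof.
move=> p0; apply: in_Hp_bounded => //; first exact: poly_approx_monom.
by move=> z zD; rewrite cabsX exprn_ile1 ?cabs_ge0// ltW.
Qed.

(* Split at the level N^(3/4), using |h| <= N and the L2 norm. *)
Lemma unimodular_sum_norm p N (eta : nat -> R[i]) : 1 <= p -> (0 < N)%N ->
  (forall k, cabs (eta k) = 1) ->
  hp_norm p (fun z => \sum_(k < N) eta k * z ^+ k) <= 2 * N%:R `^ (1 - (4 * p)^-1).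
Proof.
move=> p1 N0 e1; have p0 : 0 < p by exact: lt_le_trans p1.
pose h z := \sum_(k < N) eta k * z ^+ k.
have ha : poly_approx h.
  apply: (@poly_approx_sum _ _ (fun k z => eta k * z ^+ k)) => k.
  by apply: poly_approxM; [exact: poly_approx_cst|exact: poly_approx_monom].
pose n : R := N%:R; have n1 : 1 <= n by rewrite /n ler1n.
have n0 : 0 < n by exact: lt_le_trans n1.
have powR0' (a : R) : 0 <= n `^ a by exact: powR_ge0.
have nD (a b : R) : n `^ (a + b) = n `^ a * n `^ b by rewrite powRD// lt0r_neq0// implybT.
suff [] : in_Hp p h /\ hp_norm p h <= 2 * n `^ (1 - (4 * p)^-1) by [].
apply: in_Hp_le => //; first by rewrite mulr_ge0.
move=> r r01; case/andP: (r01) => r0 r1.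
have L2 : Int (fun t => cabs (h (r%:C * ee t)%C) ^+ 2) <= n.
  have -> : (fun t => cabs (h (r%:C * ee t)%C) ^+ 2) =
    (fun t => cabs (\sum_(k < N) (eta k * r%:C%C ^+ k) * ee t ^+ k) ^+ 2).
    apply/funext => t; congr (cabs _ ^+ _); apply: eq_bigr => k _.
    by rewrite exprMn mulrA.
  rewrite (@parseval _ (fun k => eta k * r%:C%C ^+ k)).
  apply: (@le_trans _ _ (\sum_(k < N) (1 : R))); last by rewrite sumr_const card_ord.
  apply: ler_sum => k _; rewrite cabsM e1 mul1r cabsX cabs_real ger0_norm//.
  by rewrite exprn_ile1 ?exprn_ge0// exprn_ile1// ltW.
have hN t : cabs (h (r%:C * ee t)%C) <= n.
  rewrite (le_trans (cabs_sum _ _ _))//.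
  apply: (@le_trans _ _ (\sum_(k < N) (1 : R))); last by rewrite sumr_const card_ord.
  apply: ler_sum => k _; rewrite cabsM e1 mul1r cabsX cabs_rad ger0_norm//.
  by rewrite exprn_ile1// ltW.
(* The splitting integrates to at most n^(3p/4) + n^(p - 1/2). As p >= 1, both exponents are at most
   p - 1/4, and 2 <= 2^p absorbs the two terms. *)
pose lam := n `^ (3 / 4); have lam0 : 0 < lam by exact: powR_gt0.
have bh := bddm_cabs (poly_approx_bddm r01 ha).
apply: (@le_trans _ _ (Int (fun t => lam `^ p + n `^ p / lam ^+ 2 * cabs (h (r%:C * ee t)%C) ^+ 2))).
  apply: Int_le.
  - by apply: bddm_itg; apply: bddm_cabs_powR => //; exact: ltW.
  - by apply: bddm_itg; apply: bddmD; [exact: bddm_cst|exact/bddmZ/bddmX].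
  move=> t _; have := hN t; have := cabs_ge0 (h (r%:C * ee t)%C).
  move: (cabs _) => y y0 yn; have [yl|ly] := leP y lam.
    have : y `^ p <= lam `^ p.
      by apply: ge0_ler_powR; rewrite ?nnegrE// ltW.
    move=> /le_trans; apply; rewrite lerDl mulr_ge0 ?sqr_ge0// divr_ge0 ?sqr_ge0//.
  have : y `^ p <= n `^ p.
    by apply: ge0_ler_powR; rewrite ?nnegrE// ltW.
  move=> /le_trans; apply; apply: (@le_trans _ _ (n `^ p / lam ^+ 2 * y ^+ 2)).
    rewrite -mulrA ler_peMr// ler_pdivlMl ?exprn_gt0// mulr1.
    by rewrite lerXn2r ?nnegrE// ltW.
  by rewrite lerDr powR_ge0.
rewrite IntD; [|exact/bddm_itg/bddm_cst|exact/bddm_itg/bddmZ/bddmX].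
rewrite Int_cst IntZ; last exact/bddm_itg/bddmX.
have B : (2 * n `^ (1 - (4 * p)^-1)) `^ p = 2 `^ p * n `^ (p - 4^-1).
  rewrite powRM ?powR_ge0// -powRrM; congr (_ * _ `^ _).
  by field; rewrite gt_eqF.
have two : 2 <= 2 `^ p :> R by apply: le1r_powR => //; rewrite ler1n.
have t1 : lam `^ p <= n `^ (p - 4^-1).
  rewrite /lam -powRrM; apply: ler_powR => //; lra.
have t2 : n `^ p / lam ^+ 2 * Int (fun t => cabs (h (r%:C * ee t)%C) ^+ 2) <= n `^ (p - 4^-1).
  apply: (@le_trans _ _ (n `^ p / lam ^+ 2 * n)).
    by rewrite ler_wpM2l// divr_ge0 ?sqr_ge0.
  have -> : lam ^+ 2 = n `^ (3 / 2).
    by rewrite -powR_mulrn ?(ltW lam0)// /lam -powRrM; congr (_ `^ _); field.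
  rewrite -powRN -nD -[X in _ * X <= _](powRr1 (ltW n0)) -nD; apply: ler_powR => //; lra.
rewrite B; have q0 := powR0' (p - 4^-1).
apply: (le_trans (lerD t1 t2)).
by move: (n `^ (p - 4^-1)) q0 (2 `^ p) two => q q0 c c2; nra.
Qed.

(** Unimodular factors turn each x(z^k) into its modulus, so the sum is the value of x at one
    polynomial with unimodular coefficients. *)
Lemma dual_ball_monomials p N x : 1 <= p -> (0 < N)%N -> dual_ball p x ->
  \sum_(k < N) cabs (x (fun z : R[i] => z ^+ k)) <= 2 * N%:R `^ (1 - (4 * p)^-1).
Proof.
move=> p1 N0 [dx xb]; have p0 : 0 < p by exact: lt_le_trans p1.
have ex (k : nat) : exists c, cabs c = 1 /\ c * x (fun z : R[i] => z ^+ k) = (cabs (x (fun z : R[i] => z ^+ k)))%:C%C.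
  by have [c ? ?] := Re_rotation (x (fun z : R[i] => z ^+ k)); exists c.
have /choice[eta heta] := ex.
have e1 k : cabs (eta k) = 1 by case: (heta k).
apply: (le_trans _ (unimodular_sum_norm p1 N0 e1)).
have mH k : in_Hp p (fun z : R[i] => z ^+ k) by case: (monom_Hp k p0).
have hH : in_Hp p (fun z => \sum_(k < N) eta k * z ^+ k).
  have H k : in_Hp p (fun z => eta k * z ^+ k) by case: (in_HpZ (eta k) p0 (mH k)).
  by case: (@in_Hp_sum _ _ N _ p1 H).
apply: (le_trans _ (xb _ hH)).
rewrite (@dual_linear_sum _ p x N eta (fun k z => z ^+ k) p1 dx mH).
rewrite (eq_bigr (fun k : 'I_N => (cabs (x (fun z : R[i] => z ^+ k)))%:C%C)); last first.
  by move=> k _; case: (heta k).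
rewrite -rmorph_sum cabs_real ler_norm//.
Qed.

(** In the dual ball each |x(z^k)| is at most 1, hence so is comparable its r-th power: it is at
    most |x(z^k)| itself, and [dual_ball_monomials] serves every r. This gives N A^r <= C^r 2 N^(1 -
    1/(4p)) for A = ||w phi^N||_p, that is d = 1 / (4 p r); the passage to the L1 mean costs a
    factor 2. *)
Lemma summing_decay p r w phi : 1 <= r -> 1 <= p -> analytic_on_D phi ->
  (forall z, inD z -> inD (phi z)) -> weight_Hp p phi w ->
  summing_Hp p r (weighted_comp w phi) ->
  exists C d : R, [/\ 0 <= C, 0 < d & forall N rho, (0 < N)%N -> 0 <= rho < 1 ->
    Int (fun t => cabs (w (rho%:C * ee t)%C) * cabs (phi (rho%:C * ee t)%C) ^+ N) <=
      C * N%:R `^ (- d)].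
Proof.
move=> r1 p1 /analytic_poly_approx pa pD [wH [_ [TH _]]] [C [C0 hC]].
have p0 : 0 < p by exact: lt_le_trans p1.
have r0 : 0 < r by exact: lt_le_trans r1.
have wa := in_Hp_poly_approx wH.
exists (2 * (C * 2 `^ r^-1)), ((4 * p)^-1 / r); split.
- by rewrite !mulr_ge0 ?powR_ge0// ltW.
- by rewrite divr_gt0// invr_gt0 mulr_gt0.
move=> N rho N0 rho01.
pose n : R := N%:R; have n1 : 1 <= n by rewrite /n ler1n.
have n0 : 0 < n by exact: lt_le_trans n1.
have nD (a b : R) : n `^ (a + b) = n `^ a * n `^ b by rewrite powRD// lt0r_neq0// implybT.
have mH k : in_Hp p (fun z : R[i] => z ^+ k) by case: (monom_Hp k p0).
pose g k : @cfun R := fun z => w z * phi z ^+ k.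
have gH k : in_Hp p (g k) by exact: (TH _ (mH k)).
pose A := hp_norm p (g N).
have gA k : (k <= N)%N -> A <= hp_norm p (g k).
  move=> kN; have h z : inD z -> cabs (g N z) <= cabs (g k z).
    move=> zD; rewrite !cabsM !cabsX ler_wpM2l ?cabs_ge0// ler_wiXn2l ?cabs_ge0//.
    exact/ltW/pD.
  by case: (hp_norm_mono p0 (in_Hp_poly_approx (gH N)) (gH k) h).
have A0 : 0 <= A := hp_norm_ge0 _ _.
have S := hC N (fun k z => z ^+ k) (fun k => mH k).
have ub : (ereal_sup [set ((\sum_(k < N) (cabs (x (fun z : R[i] => z ^+ k))) `^ r) `^ r^-1)%:E
    | x in dual_ball p] <= ((2 * n `^ (1 - (4 * p)^-1)) `^ r^-1)%:E)%E.
  apply: ge_ereal_sup => _ [x xb <-]; rewrite lee_fin.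
  apply: ge0_ler_powR; rewrite ?nnegrE ?invr_ge0 ?(ltW r0)//.
  - by apply: sumr_ge0 => k _; exact: powR_ge0.
  - by rewrite mulr_ge0 ?powR_ge0.
  apply: (le_trans _ (dual_ball_monomials p1 N0 xb)); apply: ler_sum => k _.
  have x1 : cabs (x (fun z : R[i] => z ^+ k)) <= 1.
    by rewrite (le_trans (xb.2 _ (mH k)))//; case: (monom_Hp k p0).
  have [->|x0] := eqVneq (cabs (x (fun z : R[i] => z ^+ k))) 0.
    by rewrite powR0// gt_eqF.
  by rewrite ge1r_powR// x1 andbT lt_neqAle eq_sym x0 cabs_ge0.
have key : (n * A `^ r) `^ r^-1 <= C * (2 * n `^ (1 - (4 * p)^-1)) `^ r^-1.
  rewrite -lee_fin EFinM; apply: (le_trans _ (lee_wpmul2l _ ub)); last by rewrite lee_fin ltW.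
  apply: (le_trans _ S); rewrite lee_fin; apply: ge0_ler_powR; rewrite ?nnegrE ?invr_ge0 ?(ltW r0)//.
  - by rewrite mulr_ge0 ?powR_ge0// ltW.
  - by apply: sumr_ge0 => k _; exact: powR_ge0.
  rewrite /n mulr_natl -[X in _ *+ X](card_ord N) -sumr_const; apply: ler_sum => k _.
  have Ak : A <= hp_norm p (weighted_comp w phi (fun z => z ^+ k)).
    exact: (gA k (ltnW (ltn_ord k))).
  apply: (ge0_ler_powR (ltW r0) _ _ Ak); rewrite nnegrE; first exact: A0.
  exact: hp_norm_ge0.
have Ale : A <= C * 2 `^ r^-1 * n `^ (- ((4 * p)^-1 / r)).
  move: key; rewrite powRM ?(ltW n0) ?powR_ge0// powRK//.
  rewrite powRM ?powR_ge0// -powRrM mulrBl mul1r nD => key.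
  have q0 : 0 < n `^ r^-1 by exact: powR_gt0.
  by rewrite -(ler_pM2l q0) (le_trans key)// le_eqVlt; apply/orP; left; apply/eqP; ring.
apply: (@le_trans _ _ (2 * A)); last by rewrite -!mulrA ler_pM2l// mulrA.
have := Int_cabs_le p1 rho01 (gH N).
by rewrite /g; under eq_fun do rewrite cabsM cabsX.
Qed.

(** Section of a gap series that grows like (1 - x)^(-c) with 2^c = b. A finite section is bounded
    on [0, 1], and the leading 1 keeps its logarithm nonnegative. *)
Definition lacunary (b : R) J (x : R) : R := 1 + \sum_(j < J) b ^+ j * x ^+ (2 ^ j).

Lemma lacunary_ge1 b J x : 0 <= b -> 0 <= x -> 1 <= lacunary b J x.
Proof.
by move=> b0 x0; rewrite lerDl; apply: sumr_ge0 => j _; rewrite mulr_ge0// exprn_ge0.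
Qed.

Lemma lacunary_ge b J j x : 0 <= b -> 0 <= x -> (j < J)%N ->
  b ^+ j * x ^+ (2 ^ j) <= lacunary b J x.
Proof.
move=> b0 x0 jJ; rewrite /lacunary (bigD1 (Ordinal jJ))//= addrCA lerDl addr_ge0//.
by apply: sumr_ge0 => i _; rewrite mulr_ge0// exprn_ge0.
Qed.

Lemma lacunary_bound p r w phi : 1 <= r -> 1 <= p -> analytic_on_D phi ->
  (forall z, inD z -> inD (phi z)) -> weight_Hp p phi w ->
  summing_Hp p r (weighted_comp w phi) ->
  exists b K : R, [/\ 1 < b, 0 < K & forall J rho, 0 <= rho < 1 ->
    Int (fun t => cabs (w (rho%:C * ee t)%C) * lacunary b J (cabs (phi (rho%:C * ee t)%C))) <= K].
Proof.
move=> r1 p1 phia pD ww sw.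
have [C [d [C0 d0 hC]]] := summing_decay r1 p1 phia pD ww sw.
have pa := analytic_poly_approx phia; have wH := ww.1; have wa := in_Hp_poly_approx wH.
(* With this b the factor (2^j)^(-d) is b^(-2j), so the j-th term is at most C b^(-j). *)
pose b : R := 2 `^ (d / 2).
have b1 : 1 < b.
  by rewrite /b /powR pnatr_eq0/= expR_gt1 mulr_gt0 ?divr_gt0// ln_gt0// ltr1n.
have b0 : 0 < b by exact: lt_trans b1.
have bi : 0 <= b^-1 < 1 by rewrite invr_ge0 (ltW b0)/= invf_lt1.
(* The summands account for the leading 1 of [lacunary] and for the geometric series; the last 1
   makes K positive. *)
pose K := 2 * hp_norm p w + C * (1 - b^-1)^-1 + 1.
have i0 : 0 <= (1 - b^-1)^-1 by rewrite invr_ge0 subr_ge0; case/andP: bi => _ /ltW.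
exists b, K; split => //.
  by rewrite ltr_wpDl// addr_ge0// mulr_ge0// hp_norm_ge0.
move=> J rho rho01.
have bw := bddm_cabs (poly_approx_bddm rho01 wa).
have bp := bddm_cabs (poly_approx_bddm rho01 pa).
pose T j t := b ^+ j * (cabs (w (rho%:C * ee t)%C) * cabs (phi (rho%:C * ee t)%C) ^+ (2 ^ j)).
have bT j : bddm (T j) by apply/bddmZ/bddmM => //; exact: bddmX.
have -> : (fun t => cabs (w (rho%:C * ee t)%C) * lacunary b J (cabs (phi (rho%:C * ee t)%C))) =
  (fun t => cabs (w (rho%:C * ee t)%C) + \sum_(j < J) T j t).
  apply/funext => t; rewrite mulrDr mulr1 mulr_sumr; congr (_ + _).
  by apply: eq_bigr => j _; rewrite mulrCA.
rewrite IntD; [|exact: bddm_itg|exact/bddm_itg/bddm_sum].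
rewrite Int_sum; last by move=> j; exact: bddm_itg.
rewrite /K -[leLHS]addr0; apply: lerD => //; apply: lerD; first exact: Int_cabs_le.
apply: (@le_trans _ _ (\sum_(j < J) C * b^-1 ^+ j)); last first.
  by rewrite -mulr_sumr ler_wpM2l// geo_sum_le.
apply: ler_sum => j _; rewrite /T IntZ; last by apply/bddm_itg/bddmM => //; exact: bddmX.
have := hC _ rho (_ : 0 < 2 ^ j)%N rho01; rewrite expn_gt0/= => /(_ isT) h.
apply: (@le_trans _ _ (b ^+ j * (C * (2 ^ j)%:R `^ (- d)))).
  by rewrite ler_wpM2l ?exprn_ge0// ltW.
rewrite mulrCA ler_wpM2l//.
have -> : (2 ^ j)%:R `^ (- d) = (b ^+ j)^-1 ^+ 2.
  rewrite natrX powRN -powR_mulrn// -powRrM exprVn -exprM -powR_mulrn ?(ltW b0)// /b -powRrM.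
  by congr (_ `^ _)^-1; rewrite natrM; field.
by rewrite expr2 mulrA divff ?mul1r ?exprVn// expf_neq0// gt_eqF.
Qed.

(* The mean value inequality for [w1(rho z)] times the outer function with
   boundary modulus [exp v]. *)
Lemma outer_mean_le (w1 : R[i] -> R[i]) (v : R -> R) (rho : R) : poly_approx w1 -> bddm v ->
  0 <= rho < 1 ->
  cabs (w1 0) * expR (Int v) <= Int (fun t => cabs (w1 (rho%:C * ee t)%C) * expR (v t)).
Proof.
move=> wa bv rho01; case/andP: (rho01) => rho0 rho1; have [mv [M hM]] := bv.
have M0 : 0 <= M by exact: le_trans (normr_ge0 _) (hM 0).
have ha := poly_approx_herg (bddm_itg bv).
have wra : poly_approx (fun z => w1 (rho%:C%C * z)).
  apply: (@poly_approx_comp _ w1 (fun z => rho%:C%C * z)) => //.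
    move=> r /andP[r0 r1]; exists rho => // z zr; rewrite cabsM cabs_real ger0_norm//.
    by rewrite ler_piMr// (le_trans zr)// ltW.
  by apply: poly_approxM; [exact: poly_approx_cst|exact: poly_approx_id].
have Ga := poly_approxM wra (poly_approx_cexp ha).
have [B B0 hB] := poly_approx_bound rho01 wa.
(* The mean value inequality is applied on circles of radius s_n < 1, since the outer function lives
   inside the disk. As s_n tends to 1, the Poisson integrals of v tend to v almost everywhere and
   stay below M, so B exp(M) is a majorant. *)
pose s (n : nat) : R := 1 - n.+1%:R^-1.
have s01 n : 0 <= s n < 1.
  rewrite /s subr_ge0 invf_le1// ler1n/= ltrBlDr ltrDl invr_gt0//.
pose U n t := cabs (w1 (rho%:C%C * ((s n)%:C * ee t)%C)) *
  expR (Int (fun y => pk ((s n)%:C * ee t)%C y * v y)).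
have UE n t : U n t = cabs (w1 (rho%:C%C * ((s n)%:C * ee t)%C) * cexp (herg v ((s n)%:C * ee t)%C)).
  by rewrite cabsM cabs_cexp Re_herg//; exact: rad_inD.
have le n : cabs (w1 0) * expR (Int v) <= Int (U n).
  have := mean_value_le (s01 n) Ga; rewrite mulr0 herg0 cexp_real cabsM cabs_real.
  rewrite ger0_norm ?expR_ge0// => h; apply: (le_trans h); rewrite le_eqVlt; apply/orP; left.
  by apply/eqP; congr Int; apply/funext => t; rewrite UE.
have wle z : inD z -> cabs (w1 (rho%:C%C * z)) <= B.
  move=> zD; apply: hB; rewrite cabsM cabs_real ger0_norm// ler_piMr//; exact: ltW.
have c : (fun n => Int (U n)) @ \oo --> Int (fun t => cabs (w1 (rho%:C * ee t)%C) * expR (v t)).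
  apply: (@Int_dct _ _ _ (fun=> B * expR M)).
  - move=> n; have := bddm_cabs (poly_approx_bddm (s01 n) Ga) => -[+ _].
    by congr (measurable_fun _ _); apply/funext => t; rewrite UE.
  - apply: measurable_funM; last exact: measurableT_comp.
    by case: (bddm_cabs (poly_approx_bddm rho01 wa)).
  - apply: ae_imply (poisson_boundary_ex (bddm_itg bv)) => t ht t01.
    have sto1 (d : R) : 0 < d -> exists N, forall n, (N <= n)%N -> 1 - d < s n < 1.
      move=> d0; have [N hN] := cvg0_ex (@cvg_harmonic R) d0; exists N => n Nn.
      case/andP: (s01 n) => _ ->; rewrite andbT /s ltrD2l ltrN2.
      by rewrite (le_lt_trans (ler_norm _))// hN.
    apply: cvgM.
      have zD := rad_inD t rho01.
      apply/cvgrPdist_le => e e0; have [d d0 hd] := radial_continuous wa zD e0.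
      have [N hN] := sto1 _ d0; exists N => // n Nn /=.
      rewrite (le_trans (cabs_dist_sub _ _))// cabsC.
      rewrite (_ : rho%:C%C * _ = (s n)%:C%C * (rho%:C * ee t)%C); last by rewrite mulrCA.
      by apply: hd; case/andP: (hN n Nn) => -> /ltW ->.
    have cE : (fun n => Int (fun y => pk ((s n)%:C * ee t)%C y * v y)) @ \oo --> v t.
      apply/cvgrPdist_le => e e0; have [d d0 hd] := ht t01 e e0.
      by have [N hN] := sto1 _ d0; exists N => // n Nn /=; rewrite distrC hd// hN.
    by apply: (cvg_comp _ _ cE); exact: continuous_expR.
  - exact/bddm_itg/bddm_cst.
  - move=> n t; have zD := rad_inD t (s01 n).
    rewrite ger0_norm ?mulr_ge0 ?cabs_ge0 ?expR_ge0//.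
    apply: ler_pM; rewrite ?cabs_ge0 ?expR_ge0 ?wle//.
    rewrite ler_expR; have bp := bddm_pk zD.
    apply: (@le_trans _ _ (Int (fun y => M * pk ((s n)%:C * ee t)%C y))).
      apply: Int_le; [exact/bddm_itg/bddmM|exact/bddm_itg/bddmZ|].
      by move=> y _; rewrite mulrC ler_wpM2r ?pk_ge0// (le_trans _ (hM y))// ler_norm.
    by rewrite (IntZ M (bddm_itg bp)) Int_pk// mulr1.
rewrite -(cvg_lim _ c)//; apply: limr_ge; first by apply/cvg_ex; eexists; exact: c.
by apply: nearW => n; exact: le.
Qed.

(** If w vanishes at 0 the mean value inequality there says nothing. Some Taylor coefficient is
    nonzero, since w is not identically 0; m is the first such index and w1 the sum of the shifted
    series. *)
Lemma factor_zero w : analytic_on_D w -> (exists z, inD z /\ w z != 0) ->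
  exists m w1, [/\ poly_approx w1, w1 0 != 0 & forall z, inD z -> w z = z ^+ m * w1 z].
Proof.
move=> [a wa] [z0 [z0D wz0]].
have ex : exists m, a m != 0.
  apply: contrapT => /forallNP H; move/negP: wz0; apply.
  have a0 k : a k = 0 by apply/eqP/negPn/negP; exact: H.
  have := wa _ z0D; under eq_fun do (rewrite big1; last by move=> k _; rewrite a0 mul0r).
  under eq_fun do rewrite sub0r cabsN.
  move=> /(cvg_unique _ (cvg_cst _)); rewrite -cabs_eq0.
  by move=> /(_ _) h; apply/eqP; rewrite -h.
pose m := ex_minn ex; have am : a m != 0 by rewrite /m; case: ex_minnP.
have mmin k : (k < m)%N -> a k = 0.
  rewrite /m; case: ex_minnP => j _ jmin kj; apply/eqP; apply: contraLR kj => /jmin.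
  by rewrite -leqNgt.
pose w1 z := if z == 0 then a m else w z / z ^+ m.
have w1c z : inD z -> (fun n => cabs (\sum_(k < n) a (k + m)%N * z ^+ k - w1 z)) @ \oo --> 0.
  move=> zD; apply: ex_cvg0 => e e0; rewrite /w1; have [z00|zn0] := eqVneq z 0.
    exists 1%N => -[//|n] _; rewrite big_ord_recl/= expr0 mulr1 add0n big1 ?addr0 ?subrr ?cabs0 ?normr0 ?(ltW e0)//.
    by move=> k _; rewrite z00 exprS mul0r mulr0.
  have zm : 0 < cabs z ^+ m by rewrite exprn_gt0// cabs_gt0.
  have [N hN] := cvg0_ex (wa z zD) (mulr_gt0 e0 zm); exists N => n Nn.
  have := hN (m + n)%N (leq_trans Nn (leq_addl _ _)); rewrite !ger0_norm ?cabs_ge0//.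
  rewrite big_split_ord/= big1 ?add0r; last by move=> k _; rewrite mmin ?mul0r.
  have zm0 : z ^+ m != 0 by rewrite expf_neq0.
  have -> : \sum_(i < n) a (m + i)%N * z ^+ (m + i) - w z =
     (\sum_(k < n) a (k + m)%N * z ^+ k - w z / z ^+ m) * z ^+ m.
    rewrite mulrBl divfK// mulr_suml; congr (_ - _); apply: eq_bigr => k _.
    by rewrite addnC exprD mulrA.
  by rewrite cabsM cabsX ltr_pM2r// => /ltW.
exists m, w1; split.
- by apply: analytic_poly_approx; exists (fun k => a (k + m)%N).
- by rewrite /w1 eqxx.
- move=> z zD; rewrite /w1; have [->|zn0] := eqVneq z 0; last first.
    by rewrite mulrC divfK// expf_neq0.
  have [m0|m0] := posnP m.
    rewrite m0 expr0 mul1r; have := wa 0 (_ : inD 0); rewrite /inD cabs0 => /(_ ltr01) c.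
    apply/eqP; rewrite -subr_eq0 -cabs_eq0 eq_le cabs_ge0 andbT.
    apply/ler_addgt0Pr => e e0; have [N hN] := cvg0_ex c e0.
    have := hN N.+1 (leqnSn N); rewrite big_ord_recl/= expr0 mulr1 big1 ?addr0; last first.
      by move=> k _; rewrite exprS mul0r mulr0.
    by rewrite ger0_norm ?cabs_ge0// cabsC add0r => /ltW.
  rewrite expr0n gtn_eqF// mul0r; have := wa 0 (_ : inD 0); rewrite /inD cabs0 => /(_ ltr01) c.
  apply/eqP; rewrite -cabs_eq0 eq_le cabs_ge0 andbT.
  apply/ler_addgt0Pr => e e0; have [N hN] := cvg0_ex c e0.
  have := hN N.+1 (leqnSn N); rewrite big_ord_recl/= expr0 mulr1 mmin// big1 ?addr0 ?sub0r; last first.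
    by move=> k _; rewrite exprS mul0r mulr0.
  by rewrite cabsN ger0_norm ?cabs_ge0// add0r => /ltW.
Qed.

End SummingLog.

(** * From the lacunary bound to the log integral *)

Section SummingLogConclusion.
Context {R : realType}.
Local Notation mu := (@lebesgue_measure R).
Implicit Types (w phi : @cfun R) (p r : R).

Lemma bddm_lacunary (b : R) J (u : R -> R) : bddm u -> bddm (fun t => lacunary b J (u t)).
Proof.
move=> bu; apply: bddmD; first exact: bddm_cst.
by apply: (@bddm_sum _ _ (fun j t => b ^+ j * u t ^+ (2 ^ j))) => j; exact/bddmZ/bddmX.
Qed.

Lemma bddm_ln (u : R -> R) : bddm u -> (forall t, 1 <= u t) -> bddm (fun t => ln (u t)).
Proof.
move=> [mu' [M hM]] u1; split; first exact: (measurableT_comp (@measurable_ln R)).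
exists M => t; have u0 : 0 < u t by exact: lt_le_trans (u1 t).
rewrite ger0_norm ?ln_ge0// (le_trans (ltW (ln_sublinear u0)))//.
by rewrite (le_trans _ (hM t))// ler_norm.
Qed.

(** On circles of radius at least 1/2 one has |w1| <= 2^m |w|, so the bound on |w| F(|phi|) passes
    to w1, whose value at 0 is nonzero. The constant then depends neither on the section J nor on
    the radius. *)
Lemma summing_log_mean p r w phi : 1 <= r -> 1 <= p -> analytic_on_D phi ->
  (forall z, inD z -> inD (phi z)) -> weight_Hp p phi w ->
  summing_Hp p r (weighted_comp w phi) ->
  exists b K : R, [/\ 1 < b, 0 <= K & forall J rho, 2^-1 <= rho < 1 ->
    Int (fun t => ln (lacunary b J (cabs (phi (rho%:C * ee t)%C)))) <= K].
Proof.
move=> r1 p1 phia pD ww sw.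
have [b [K [b1 K0 hK]]] := lacunary_bound r1 p1 phia pD ww sw.
have pa := analytic_poly_approx phia; have [wH [wz _]] := ww.
have wa := in_Hp_poly_approx wH.
have [m [w1 [w1a w10 wE]]] := factor_zero wH.1 wz.
have b0 : 0 <= b by rewrite ltW// (lt_trans _ b1).
have c0 : 0 < cabs (w1 0) by rewrite cabs_gt0.
exists b, `|ln (2 ^+ m * K / cabs (w1 0))|; split => // J rho /andP[rho2 rho1].
have rho0 : 0 < rho by exact: lt_le_trans rho2.
have rho01 : 0 <= rho < 1 by rewrite rho1 ltW.
pose u t := lacunary b J (cabs (phi (rho%:C * ee t)%C)).
have bu : bddm u by exact/bddm_lacunary/bddm_cabs/poly_approx_bddm.
have u1 t : 1 <= u t by apply: lacunary_ge1 => //; exact: cabs_ge0.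
have u0 t : 0 < u t by exact: lt_le_trans (u1 t).
have bv := bddm_ln bu u1.
have bw := bddm_cabs (poly_approx_bddm rho01 wa).
have bw1 := bddm_cabs (poly_approx_bddm rho01 w1a).
have H : cabs (w1 0) * expR (Int (fun t => ln (u t))) <= 2 ^+ m * K.
  apply: (le_trans (outer_mean_le w1a bv rho01)).
  apply: (@le_trans _ _ (Int (fun t => 2 ^+ m * (cabs (w (rho%:C * ee t)%C) * u t)))); last first.
    rewrite IntZ; last by apply: bddm_itg; exact: bddmM.
    by rewrite ler_pM2l ?exprn_gt0//; exact: hK.
  apply: Int_le.
  - apply: bddm_itg; apply: bddmM => //.
    move: bu; congr bddm; apply/funext => t; by rewrite lnK ?posrE.
  - by apply: bddm_itg; apply: bddmZ; exact: bddmM.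
  move=> t _; rewrite lnK ?posrE// mulrA ler_wpM2r ?(ltW (u0 t))//.
  rewrite (wE _ (rad_inD t rho01)) cabsM cabsX cabs_rad (gtr0_norm rho0) mulrA -exprMn.
  rewrite ler_peMl ?cabs_ge0// exprn_ege1// mulrC -ler_pdivrMr// mul1r//.
have P0 : 0 < 2 ^+ m * K / cabs (w1 0) by rewrite divr_gt0// mulr_gt0// exprn_gt0.
rewrite -/u (le_trans _ (ler_norm _))// -ler_expR lnK ?posrE//.
by rewrite ler_pdivlMr// mulrC.
Qed.

Lemma phi_starP phi (t : R) : (exists2 L, radial_limit phi t L & phi_star phi t = L) \/
  phi_star phi t = 0.
Proof.
rewrite /phi_star; case: pselect => [h|h]; last by right.
by left; exists (projT1 (cid h)) => //; exact: (projT2 (cid h)).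
Qed.

(* With 2^-(j+1) < 1 - y <= 2^-j one has y^(2^j) >= 1/4 unless j = 0. *)
Lemma dyadic_log (y : R) : 0 <= y < 1 -> exists2 j : nat,
  ln (1 - y)^-1 <= j.+1%:R * ln 2 & (j = 0%N \/ 4^-1 <= y ^+ (2 ^ j)).
Proof.
move=> /andP[y0 y1]; have d0 : 0 < 1 - y by rewrite subr_gt0.
have ex : exists j : nat, 1 < 2 ^+ j.+1 * (1 - y).
  exists (Num.bound (1 - y)^-1); rewrite -ltr_pdivrMr// mul1r.
  have i0 : 0 <= (1 - y)^-1 by rewrite invr_ge0 ltW.
  apply: (lt_le_trans (archi_boundP i0)); rewrite -natrX ler_nat.
  by rewrite (leq_trans _ (leq_pexp2l (isT : 0 < 2)%N (leqnSn _)))// ltnW// ltn_expl.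
have [j hj jmin] := ex_minnP ex; exists j.
  rewrite mulr_natl -lnXn// ler_ln ?posrE ?invr_gt0 ?exprn_gt0//.
  by rewrite -(ler_pM2r d0) mulVf ?gt_eqF// ltW.
case: j hj jmin => [|j] hj jmin; first by left.
right; have h : 2 ^+ j.+1 * (1 - y) <= 1.
  by rewrite leNgt; apply/negP => /jmin; rewrite ltnn.
have y01 : 0 <= y <= 1 by rewrite y0 ltW.
(* Bernoulli's inequality with exponent 2^(j+1) would only give a lower bound 0. With exponent 2^j
   it gives 1/2, and squaring gives 1/4. *)
have := bernoulli_le (2 ^ j) y01; rewrite natrX => hb.
have h2 : 2^-1 <= y ^+ (2 ^ j).
  by move: h; rewrite exprS -mulrA; move: (2 ^+ j * (1 - y)) (y ^+ (2 ^ j)) hb => A B; lra.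
rewrite expnS mulnC exprM; move: (y ^+ (2 ^ j)) h2 => B; nra.
Qed.

(** In Fatou's lemma the radius and the order of the section grow together: a fixed j is eventually
    below n, so the lower limit sees every dyadic term. *)
Theorem summing_log p r w phi : 1 <= r -> 1 <= p -> analytic_on_D phi ->
  (forall z, inD z -> inD (phi z)) -> weight_Hp p phi w ->
  summing_Hp p r (weighted_comp w phi) ->
  (\int[mu]_(t in `[0%R, 1%R]) log_integrand phi t < +oo)%E.
Proof.
move=> r1 p1 phia pD ww sw; have pa := analytic_poly_approx phia.
have [b [K [b1 K0 hK]]] := summing_log_mean r1 p1 phia pD ww sw.
have b0 : 0 < b by exact: lt_trans b1.
pose beta := ln b; have beta0 : 0 < beta by rewrite ln_gt0.
have l2 : (0 : R) < ln 2 by rewrite ln_gt0// ltr1n.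
(* c1 converts powers of b into powers of 2, and c2 is such that c1 (j ln b - ln 8) + c2 = (j + 1)
   ln 2, the bound of [dyadic_log]. *)
pose c1 := ln 2 / beta; have c10 : 0 < c1 by rewrite divr_gt0.
have l8 : (0 : R) <= ln 8 by rewrite ln_ge0// ler1n.
pose c2 := ln 2 + c1 * ln 8; have c20 : 0 <= c2 by apply: addr_ge0; [exact: ltW|apply: mulr_ge0 => //; exact: ltW].
(* The shift by 2 keeps all radii at least 1/2, the range of [summing_log_mean]. *)
pose rho (n : nat) : R := 1 - n.+2%:R^-1.
have rho2 n : 2^-1 <= rho n < 1.
  rewrite /rho ltrBlDr ltrDl invr_gt0 ltr0n andbT.
  have : (n.+2%:R : R)^-1 <= 2^-1 by rewrite lef_pV2 ?posrE ?ltr0n// ler_nat.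
  by move: (n.+2%:R^-1) => x; lra.
have rho01 n : 0 <= rho n < 1.
  by case/andP: (rho2 n) => h ->; rewrite andbT (le_trans _ h)// invr_ge0.
pose y n (t : R) := cabs (phi ((rho n)%:C * ee t)%C).
have y0 n t : 0 <= y n t by exact: cabs_ge0.
have y1 n t : y n t <= 1 by exact/ltW/pD/rad_inD.
pose V n t := ln (lacunary b n (y n t)).
have lac1 n t : 1 <= lacunary b n (y n t) by apply: lacunary_ge1 => //; exact: ltW.
have V0 n t : 0 <= V n t by rewrite ln_ge0.
have bV n : bddm (V n).
  by apply: bddm_ln => //; exact/bddm_lacunary/bddm_cabs/poly_approx_bddm.
pose U n t := c1 * V n t + c2.
have bU n : bddm (U n) by apply: bddmD; [exact: bddmZ|exact: bddm_cst].
have U0 n t : c2 <= U n t by rewrite lerDr mulr_ge0// ltW.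
have low j t (l : R) : (forall e : R, 0 < e -> exists N, forall n, (N <= n)%N -> `|y n t - l| <= e) ->
    0 <= l -> 4^-1 <= l ^+ (2 ^ j) ->
    ((c1 * (j%:R * beta - ln 8) + c2)%:E <= limn_einf (fun n => (U n t)%:E))%E.
  move=> yl l0 lj.
  have cy : (fun n => y n t ^+ (2 ^ j)) @ \oo --> l ^+ (2 ^ j).
    have c : (fun n => y n t) @ \oo --> l.
      apply/cvgrPdist_le => e e0; have [N hN] := yl e e0; exists N => // n Nn /=.
      by rewrite distrC hN.
    elim: (2 ^ j)%N => [|k IH]; first by under eq_fun do rewrite expr0; exact: cvg_cst.
    under eq_fun do rewrite exprS; rewrite exprS; exact: cvgM.
  (* The limit is at least 1/4, so values within 1/8 of it are at least 1/8; this is the source of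
     [ln 8]. *)
  have e8 : (0 : R) < 8^-1 by rewrite invr_gt0.
  move/cvgrPdist_le: cy => /(_ _ e8)[N _ hN].
  apply: (@limn_einf_ge _ _ _ (maxn N j.+1)) => n; rewrite geq_max => /andP[Nn jn].
  rewrite lee_fin lerD2r ler_pM2l//.
  have h := hN n Nn; have h8 : 8^-1 <= y n t ^+ (2 ^ j).
    by move: h; rewrite /= ler_norml => /andP[_]; move: (l ^+ _) (y n t ^+ _) lj => A B; lra.
  have h9 := lacunary_ge (ltW b0) (y0 n t) jn.
  have bj : 0 < b ^+ j by rewrite exprn_gt0.
  have -> : j%:R * beta - ln 8 = ln (b ^+ j * 8^-1).
    by rewrite lnM ?posrE// lnV ?posrE// lnXn// mulr_natl.
  rewrite ler_ln ?posrE ?mulr_gt0//; last by exact: lt_le_trans (lac1 n t).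
  by apply: (le_trans _ h9); rewrite ler_pM2l.
have point t : (log_integrand phi t <= limn_einf (fun n => (U n t)%:E))%E.
  have base : (c2%:E <= limn_einf (fun n => (U n t)%:E))%E.
    by apply: (@limn_einf_ge _ _ _ 0%N) => n _; rewrite lee_fin U0.
  (* Where there is no radial limit, [phi_star] has the default value 0 and the integrand is 0. *)
  rewrite /log_integrand; case: (phi_starP phi t) => [[L radL ->]|->]; last first.
    by rewrite cabs0 ltr01 subr0 invr1 ln1; apply: le_trans base; rewrite lee_fin.
  have yl (e : R) : 0 < e -> exists N, forall n, (N <= n)%N -> `|y n t - cabs L| <= e.
    move=> e0; have /cvgrPdist_le/(_ e e0)[d /= d0 hd] := radL.
    have [N hN] := cvg0_ex (@cvg_harmonic R) d0; exists N => n Nn.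
    rewrite (le_trans (cabs_dist_sub _ _))//.
    have := hd (rho n); rewrite sub0r normrN ger0_norm ?cabs_ge0//; apply.
      rewrite /ball_/= /rho subKr ger0_norm ?invr_ge0//.
      apply: le_lt_trans (hN n Nn); rewrite ger0_norm/= ?invr_ge0//.
      by rewrite lef_pV2 ?posrE ?ltr0n// ler_nat.
    by case/andP: (rho01 n).
  have L0 := cabs_ge0 L.
  case: ifPn => L1.
    have L01 : 0 <= cabs L < 1 by rewrite L0.
    have [j hj [j0|jy]] := dyadic_log L01.
      apply: le_trans base; rewrite lee_fin (le_trans hj)// j0 mul1r lerDl mulr_ge0//; exact: ltW.
    apply: le_trans (low j t (cabs L) yl L0 jy); rewrite lee_fin (le_trans hj)//.
    rewrite /c2 /c1 -natr1 le_eqVlt; apply/orP; left; apply/eqP.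
    by field; rewrite gt_eqF.
  have L1' : cabs L = 1.
    apply/eqP; rewrite eq_le [X in _ && X]leNgt L1 andbT.
    apply/ler_addgt0Pr => e e0; have [N hN] := yl e e0.
    by have := hN N (leqnn N); have := y1 N t; rewrite ler_norml => + /andP[]; lra.
  (* Here |L| = 1, so [low] applies with every j and the lower limit exceeds any A. *)
  rewrite leye_eq; apply/eqP/eqyP => A A0.
  pose j := Num.bound (A / (c1 * beta) + ln 8 / beta).
  have : A / (c1 * beta) + ln 8 / beta < j%:R.
    by apply: archi_boundP; rewrite addr_ge0// divr_ge0// ltW// mulr_gt0.
  have cb : 0 < c1 * beta by rewrite mulr_gt0.
  move=> hj; apply: (le_trans _ (low j t (cabs L) yl L0 _)); last by rewrite L1' expr1n; lra.
  have h : c1 * beta * (A / (c1 * beta) + ln 8 / beta) < c1 * beta * j%:R by rewrite ltr_pM2l.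
  move: h; have -> : c1 * beta * (A / (c1 * beta) + ln 8 / beta) = A + c1 * ln 8.
    by field; rewrite !gt_eqF.
  rewrite lee_fin (_ : c1 * (j%:R * beta - ln 8) = c1 * beta * j%:R - c1 * ln 8); last by ring.
  move=> h; apply: (@le_trans _ _ (c1 * beta * j%:R - c1 * ln 8)); last by rewrite lerDl.
  by rewrite lerBrDr ltW.
have log0 t : (0 <= log_integrand phi t)%E.
  rewrite /log_integrand; case: ifPn => // L1; rewrite lee_fin ln_ge0//.
  by rewrite invf_ge1 ?subr_gt0// gerBl cabs_ge0.
apply: (@le_lt_trans _ _ (c1 * K + c2)%:E); last exact: ltry.
apply: (le_trans (ge0_le_integral_nonmeas (fun t _ => log0 t) (fun t _ => point t))).
apply: (@le_trans _ _ (limn_einf (fun n => \int[mu]_(t in `[0%R, 1%R]) (U n t)%:E)%E)).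
  apply: fatou; first exact: meas01.
    by move=> n; apply/measurable_EFinP/measurable_funTS; case: (bU n).
  by move=> n t _; rewrite lee_fin (le_trans c20).
apply: limn_einf_le => n; rewrite itg_EFin; last exact: bddm_itg.
rewrite lee_fin IntD; [|exact/bddm_itg/bddmZ|exact/bddm_itg/bddm_cst].
rewrite Int_cst lerD2r IntZ; last exact: bddm_itg.
by rewrite ler_pM2l//; exact: hK.
Qed.

End SummingLogConclusion.

(** * Log-integrability implies nuclearity *)

Section OuterNuclear.
Context {R : realType}.
Local Notation mu := (@lebesgue_measure R).
Implicit Types (f g w phi : @cfun R) (p : R).

(** L will be the log integrand, for which only monotonicity of the integral is used. That needs an
    inequality at every point, so f is first set to 0 on a measurable null set; f itself is
    measurable and its integral does not change. *)
Lemma ae_le_itg (f : R -> R) (L : R -> \bar R) : measurable_fun setT f -> (forall t, 0 <= f t) ->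
  {ae mu, forall t, 0 <= t <= 1 -> ((f t)%:E <= L t)%E} -> (forall t, (0 <= L t)%E) ->
  (\int[mu]_(t in `[0%R, 1%R]) L t < +oo)%E ->
  itg f /\ ((Int f)%:E <= \int[mu]_(t in `[0%R, 1%R]) L t)%E.
Proof.
move=> mf f0 [A [mA A0 sub]] L0 Loo.
pose f' t := \1_(~` A) t * f t.
have mf' : measurable_fun setT f'.
  by apply: measurable_funM => //; apply: measurable_indic; exact: measurableC.
have le : (\int[mu]_(t in `[0%R, 1%R]) (f' t)%:E <= \int[mu]_(t in `[0%R, 1%R]) L t)%E.
  apply: ge0_le_integral_nonmeas => t.
    by move=> _; rewrite lee_fin mulr_ge0// indicE.
  rewrite /= in_itv/= => t01; rewrite /f' indicE; have [tA|tA] := boolP (t \in ~` A); last first.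
    by rewrite mul0r.
  rewrite mul1r; apply: contrapT => H; move: tA; rewrite inE; apply; apply: sub => /= K.
  exact/H/K.
have eq : (\int[mu]_(t in `[0%R, 1%R]) (f t)%:E = \int[mu]_(t in `[0%R, 1%R]) (f' t)%:E)%E.
  apply: ae_eq_integral; first exact: meas01.
  - by apply/measurable_EFinP; exact: measurable_funTS.
  - by apply/measurable_EFinP; exact: measurable_funTS.
  exists A; split => // t /= H; apply: contrapT => tA; apply: H => _.
  by rewrite /f' indicE mem_set ?mul1r.
have fi : itg f.
  apply/integrableP; split; first by apply/measurable_EFinP; exact: measurable_funTS.
  under eq_integral do rewrite /= ger0_norm//.
  by apply: le_lt_trans Loo; apply: le_trans le; rewrite -eq.
by split => //; rewrite -itg_EFin// eq.
Qed.

Lemma radial_limit_unique f (t : R) (L1 L2 : R[i]) : radial_limit f t L1 -> radial_limit f t L2 -> L1 = L2.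
Proof.
move=> h1 h2; apply/eqP; rewrite -subr_eq0 -cabs_eq0 eq_le cabs_ge0 andbT.
apply/ler_addgt0Pr => e e0; rewrite add0r; have e2 : 0 < e / 2 by rewrite divr_gt0.
have /cvgrPdist_le/(_ _ e2) n1 := h1; have /cvgrPdist_le/(_ _ e2) n2 := h2.
have [r [/= r1 r2]] := @filter_ex _ (1 : R)^'- (at_left_proper_filter _) _ (filterI n1 n2).
rewrite (le_trans (cabs_distl _ _ (f (r%:C * ee t)%C)))// [e]splitr; apply: lerD.
  by move: r1; rewrite sub0r normrN ger0_norm ?cabs_ge0// cabsC.
by move: r2; rewrite sub0r normrN ger0_norm ?cabs_ge0.
Qed.

(* Jensen's inequality for the Poisson kernel and the convex function
   [x |-> ln (1 - x)^-1]. *)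
Lemma log_majorant phi : poly_approx phi -> (forall z, inD z -> inD (phi z)) ->
  (\int[mu]_(t in `[0%R, 1%R]) log_integrand phi t < +oo)%E ->
  exists2 u : R -> R, itg u & forall z, inD z ->
    - ln (1 - cabs (phi z)) <= Int (fun t => pk z t * u t).
Proof.
move=> pa pD Loo.
have p1 z : inD z -> cabs (phi z) <= 1 by move=> /pD /ltW.
have [g [bg g1 pg aeg]] := fatou_radial_limit pa p1.
have bX := bddm_cabs bg; pose X t := cabs (g t).
pose E : set R := [set t | 1 <= X t].
have mE : measurable E.
  rewrite -[E]setTI; have [mX _] := bX.
  have := mX measurableT _ (measurable_itv `[1%R, +oo[).
  by congr (measurable (_ `&` _)); apply/seteqP; split => t /=; rewrite in_itv/= andbT.
have bE : bddm (\1_E : R -> R) by exact: bddm_indic.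
(* The boundary modulus is reset to 0 on E, so that u is finite everywhere; E turns out to be
   null. *)
pose X' t := X t * (1 - \1_E t).
have bX' : bddm X' by apply: bddmM => //; apply: bddmB => //; exact: bddm_cst.
have XE t : X t = X' t + \1_E t * X t by rewrite /X'; ring.
have X'0 t : 0 <= X' t < 1.
  rewrite /X' indicE; have [tE|tE] := boolP (t \in E); first by rewrite subrr mulr0 lexx ltr01.
  rewrite subr0 mulr1 cabs_ge0/= ltNge; apply/negP => h; move/negP: tE; apply.
  by rewrite inE.
have X'0' t : 0 <= X' t by case/andP: (X'0 t).
have d0 t : 0 < 1 - X' t by rewrite subr_gt0; case/andP: (X'0 t).
pose u t := - ln (1 - X' t).
have u0 t : 0 <= u t by rewrite /u -lnV ?posrE// ln_ge0// invf_ge1// gerBl.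
have mu' : measurable_fun setT u.
  rewrite (_ : u = (fun t => (-1) * ln (1 - X' t))); last by apply/funext => t; rewrite mulN1r.
  apply: measurable_funM; first exact: measurable_cst.
  apply: (measurableT_comp (@measurable_ln R)).
  by apply: measurable_funB; [exact: measurable_cst|case: bX'].
have log0 t : (0 <= log_integrand phi t)%E.
  rewrite /log_integrand; case: ifPn => // L1; rewrite lee_fin ln_ge0//.
  by rewrite invf_ge1 ?subr_gt0// gerBl cabs_ge0.
(* The log integrand is +oo almost everywhere on E, so it dominates every multiple of [\1_E] there;
   a large M then forces the integral of [\1_E] to be 0. *)
have key (M : R) : 0 <= M -> itg (fun t => u t + M * \1_E t) /\
   ((Int (fun t => (u t + M * \1_E t)))%:E <= \int[mu]_(t in `[0%R, 1%R]) log_integrand phi t)%E.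
  move=> M0; apply: ae_le_itg => //.
  - by apply: measurable_funD => //; case: (bddmZ M bE).
  - by move=> t; rewrite addr_ge0// mulr_ge0// indicE.
  apply: ae_imply aeg => t ht t01; rewrite /log_integrand.
  have -> : phi_star phi t = g t.
    rewrite /phi_star; case: pselect => [h|[]]; last by exists (g t); exact: ht.
    exact: radial_limit_unique (projT2 (cid h)) (ht t01).
  rewrite -/(X t); case: ifPn => Xt; last exact: leey.
  rewrite /u /X' indicE memNset; last by rewrite /E/=; apply/negP; rewrite -ltNge.
  by rewrite subr0 mulr1 mulr0 addr0 lee_fin lnV// posrE subr_gt0.
have [ui _] := key 0 (lexx 0); have {}ui : itg u.
  by move: ui; congr itg; apply/funext => t; rewrite mul0r addr0.
have iE := bddm_itg bE.
have L0 : (0 <= \int[mu]_(t in `[0%R, 1%R]) log_integrand phi t)%E by apply: integral_ge0.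
pose l := fine (\int[mu]_(t in `[0%R, 1%R]) log_integrand phi t)%E.
have lE : (\int[mu]_(t in `[0%R, 1%R]) log_integrand phi t = l%:E)%E by rewrite fineK// ge0_fin_numE.
have IE0 : Int (\1_E) = 0.
  have h0 : 0 <= Int (\1_E) by apply: Int_ge0 => t; rewrite indicE.
  have hu : 0 <= Int u by exact: Int_ge0.
  have hM (M : R) : 0 <= M -> M * Int (\1_E) <= l.
    move=> M0; have [_] := key M M0; rewrite lE lee_fin IntD//; last exact: itgZ.
    by rewrite IntZ//; move: (Int u) (M * _) hu => a b; lra.
  apply/eqP; rewrite eq_le h0 andbT leNgt; apply/negP => h.
  have l0 : 0 <= l by rewrite fine_ge0.
  have := hM ((l + 1) / Int (\1_E)); rewrite divfK ?gt_eqF// => /(_ _)/= H.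
  have : l + 1 <= l by apply: H; rewrite divr_ge0// ?addr_ge0// ltW.
  lra.
exists u => // z zD; have bp := bddm_pk zD.
pose y := cabs (phi z); have y1 : y < 1 := pD z zD.
(* The modulus of phi(z) is at most the Poisson integral of X. The part over E is at most N times
   the integral of [\1_E], which is 0. *)
have yX : y <= Int (fun t => pk z t * X' t).
  have [N hN] : exists N, forall t, pk z t <= N.
    by have [_ [N hN]] := bp; exists N => t; exact: le_trans (ler_norm _) (hN t).
  apply: (@le_trans _ _ (Int (fun t => pk z t * X' t + N * \1_E t))).
    rewrite /y pg//; apply: cabs_cint.
    - by apply: cbddm_citg; apply: cbddmM => //; exact: cbddm_real.
    - by apply: bddm_itg; apply: bddmD; [exact: bddmM|exact: bddmZ].
    move=> t _; rewrite cabsM cabs_real (ger0_norm (pk_ge0 _ zD)) -/(X t) {1}XE mulrDr lerD2l.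
    rewrite mulrCA mulrC ler_wpM2r ?indicE// (le_trans _ (hN t))//.
    by rewrite ler_piMr ?pk_ge0//; exact: g1.
  rewrite IntD; [|by apply: bddm_itg; exact: bddmM|by apply: bddm_itg; exact: bddmZ].
  by rewrite IntZ// IE0 mulr0 addr0.
have dy : 0 < 1 - y by rewrite subr_gt0.
(* The tangent at y of -ln(1 - x) lies below the graph. Integrated against the Poisson kernel, of
   mass 1, its linear term is nonnegative by [yX]. *)
have tangent t : - ln (1 - y) + (X' t - y) / (1 - y) <= u t.
  rewrite /u; have a0 : 0 < (1 - X' t) / (1 - y) by rewrite divr_gt0.
  have : ln ((1 - X' t) / (1 - y)) <= (1 - X' t) / (1 - y) - 1.
    rewrite -ler_expR lnK ?posrE//; have := expR_ge1Dx ((1 - X' t) / (1 - y) - 1).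
    by rewrite addrC subrK.
  rewrite lnM ?posrE ?invr_gt0// lnV ?posrE//.
  have -> : (X' t - y) / (1 - y) = - ((1 - X' t) / (1 - y) - 1).
    by field; rewrite gt_eqF.
  by move: (ln _) (ln _) (_ / _) => *; lra.
apply: (@le_trans _ _ (Int (fun t => (- ln (1 - y) - y / (1 - y)) * pk z t + (1 - y)^-1 * (pk z t * X' t)))).
  rewrite IntD; [|by apply: bddm_itg; exact: bddmZ|by apply: bddm_itg; apply: bddmZ; exact: bddmM].
  rewrite (IntZ _ (bddm_itg bp)) (IntZ _ (bddm_itg (bddmM bp bX'))) Int_pk// mulr1 -addrA lerDl addrC -[X in _ - X]mulrC -mulrBr mulr_ge0 ?invr_ge0 ?(ltW dy)//.
  by rewrite subr_ge0.
apply: Int_le.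
- by apply: bddm_itg; apply: bddmD; apply: bddmZ => //; exact: bddmM.
- exact: itgM.
move=> t _; apply: (le_trans _ (ler_wpM2l (pk_ge0 t zD) (tangent t))).
by rewrite le_eqVlt; apply/orP; left; apply/eqP; ring.
Qed.

(** The weight is the exponential of -2 times the Herglotz integral of the majorant u. The last
    conclusion comes from the majorant as well, without the maximum principle: it is at most some M
    on |z| <= r, so 1 - |phi| >= exp(-M) there. This is what makes f o phi analytic. *)
Lemma log_outer phi : poly_approx phi -> (forall z, inD z -> inD (phi z)) ->
  (\int[mu]_(t in `[0%R, 1%R]) log_integrand phi t < +oo)%E ->
  exists w, [/\ poly_approx w, w 0 != 0,
    forall z, inD z -> cabs (w z) <= (1 - cabs (phi z)) ^+ 2 &
    forall r : R, 0 <= r < 1 -> exists2 s : R, 0 <= s < 1 &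
      forall z, cabs z <= r -> cabs (phi z) <= s].
Proof.
move=> pa pD Loo; have [u ui hu] := log_majorant pa pD Loo.
have ha := poly_approx_herg ui.
have d0 z : inD z -> 0 < 1 - cabs (phi z) by move=> /pD; rewrite subr_gt0.
exists (fun z => cexp (- 2 * herg u z)); split.
- by apply: poly_approx_cexp; apply: poly_approxM => //; exact: poly_approx_cst.
- by rewrite -cabs_gt0 cabs_cexp expR_gt0.
- move=> z zD; rewrite cabs_cexp -[X in _ <= X ^+ 2]lnK ?posrE ?d0// -expRM_natl ler_expR.
  have -> : complex.Re (- 2 * herg u z) = - 2 * complex.Re (herg u z).
    by rewrite ReM /=; ring.
  rewrite Re_herg//; have := hu z zD.
  by move: (ln _) (Int _) => a b; lra.
- move=> r r01; have [M M0 hM] := poly_approx_bound r01 ha.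
  exists (1 - expR (- M)).
    by rewrite subr_ge0 -expR0 ler_expR oppr_le0 M0/= expR0 gtrBl expR_gt0.
  move=> z zr; have zD : inD z by case/andP: r01 => _; exact: le_lt_trans.
  have h : - ln (1 - cabs (phi z)) <= M.
    rewrite (le_trans (hu z zD))// -Re_herg// (le_trans _ (hM z zr))//.
    by rewrite (le_trans (ler_norm _))// Re_le_cabs.
  rewrite lerBrDr addrC -lerBrDr -[leRHS]lnK ?posrE ?d0// ler_expR.
  by rewrite lerNl.
Qed.

(** The bound is written as a difference so that it telescopes in [decay_sum]. *)
Lemma poly_decay (x : R) n : 0 <= x <= 1 ->
  (1 - x) ^+ 2 * x ^+ n <= 2 / n.+1%:R - 2 / n.+2%:R.
Proof.
move=> /andP[x0 x1].
(* For x < 1 the weights (k + 1) (1 - x)^2 x^k sum to 1. The left side keeps the tail k > n in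
   closed form and replaces x^k by the smaller x^n for k <= n, where 1 + ... + (n + 1) = (n + 1) (n
   + 2) / 2. Passing from n to n + 1 lowers it by (n + 1) (n + 2) / 2 times (1 - x)^3 x^n. *)
have Q : (n%:R + 1) * (n%:R + 2) / 2 * ((1 - x) ^+ 2 * x ^+ n) +
    (n%:R + 2) * (x * x ^+ n) - (n%:R + 1) * (x ^+ 2 * x ^+ n) <= 1.
  elim: n => [|n IH]; first by rewrite expr0; nra.
  apply: (le_trans _ IH); rewrite -subr_ge0 -[n.+1%:R]natr1 (exprS x n).
  set m : R := n%:R; set X := x ^+ n.
  have -> : (m + 1) * (m + 2) / 2 * ((1 - x) ^+ 2 * X) + (m + 2) * (x * X) - (m + 1) * (x ^+ 2 * X)
    - ((m + 1 + 1) * (m + 1 + 2) / 2 * ((1 - x) ^+ 2 * (x * X)) +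
       (m + 1 + 2) * (x * (x * X)) - (m + 1 + 1) * (x ^+ 2 * (x * X))) =
    (m + 1) * (m + 2) / 2 * (1 - x) ^+ 3 * X by field.
  have m0 : 0 <= m by rewrite ler0n.
  have y0 : 0 <= 1 - x by rewrite subr_ge0.
  by rewrite !mulr_ge0 ?invr_ge0 ?exprn_ge0// addr_ge0.
have X0 : 0 <= x ^+ n by rewrite exprn_ge0.
have m0 : (0 : R) <= n%:R by rewrite ler0n.
have E : 2 / n.+1%:R - 2 / n.+2%:R = 1 / ((n%:R + 1) * (n%:R + 2) / 2) :> R.
  rewrite -[n.+2%:R]natr1 -[n.+1%:R]natr1 -addrA (_ : 1 + 1 = 2)//.
  by field; apply/andP; split; rewrite gt_eqF// ltr_wpDl.
rewrite E ler_pdivlMr; last by rewrite divr_gt0// mulr_gt0// ltr_wpDl.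
rewrite mulrC; apply: (le_trans _ Q); rewrite -addrA lerDl subr_ge0.
rewrite expr2 -mulrA; apply: ler_pM => //; rewrite ?addr_ge0 ?mulr_ge0//.
  by rewrite lerD2l ler1n.
by rewrite ler_piMl// mulr_ge0.
Qed.

Lemma decay_sum (N M : nat) : (N <= M)%N ->
  \sum_(N <= k < M) (2 / k.+1%:R - 2 / k.+2%:R) <= 2 / N.+1%:R :> R.
Proof.
move=> NM.
rewrite (eq_bigr (fun k => - (2 / k.+2%:R) - - (2 / k.+1%:R))); last by move=> k _; rewrite opprK addrC.
rewrite (telescope_sumr (fun k => - (2 / k.+1%:R)))// opprK addrC gerBl divr_ge0//.
Qed.

(** * Boundedness and nuclearity for the outer weight *)

Section WithWeight.
Context (phi w : @cfun R) (p : R).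
Context (p1 : 1 <= p) (pa : poly_approx phi) (wa : poly_approx w).
Context (pD : forall z, inD z -> inD (phi z)).
Context (wle : forall z, inD z -> cabs (w z) <= (1 - cabs (phi z)) ^+ 2).
Context (pb : forall r : R, 0 <= r < 1 -> exists2 s : R, 0 <= s < 1 &
  forall z, cabs z <= r -> cabs (phi z) <= s).

Let p0 : 0 < p. Proof. exact: lt_le_trans p1. Qed.

Lemma weight_monomial_le n z : inD z -> cabs (w z * phi z ^+ n) <= 2 / n.+1%:R - 2 / n.+2%:R.
Proof.
move=> zD; have y01 : 0 <= cabs (phi z) <= 1 by rewrite cabs_ge0 ltW//; exact: pD.
rewrite cabsM cabsX (le_trans _ (poly_decay n y01))// ler_wpM2r ?exprn_ge0 ?cabs_ge0//.
exact: wle.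
Qed.

(** The bound is uniform in z, so it passes to the Hp norm. For N = 0 it is the boundedness of the
    operator, and for growing N the convergence of the nuclear expansion. The 4 is a 2 from
    [coef_Hp_le] times a 2 from [decay_sum]. *)
Lemma expansion_error f N z : in_Hp p f -> inD z ->
  cabs (w z * f (phi z) - \sum_(n < N) coef f n * (w z * phi z ^+ n)) <= 4 * hp_norm p f / N.+1%:R.
Proof.
move=> fH zD; have fa := in_Hp_poly_approx fH.
have y01 : 0 <= cabs (phi z) < 1 by rewrite cabs_ge0; exact: pD.
have w1 : cabs (w z) <= 1.
  rewrite (le_trans (wle zD))// exprn_ile1//; case/andP: y01 => h1 h2; first by rewrite subr_ge0 ltW.
  by rewrite gerBl.
(* M depends on z and e, but the telescoping sum from N to M is bounded independently of M, so e may
   tend to 0. *)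
apply/ler_addgt0Pr => e e0; have [M0 hM0] := analytic_coef fa y01 e0.
pose M := maxn N M0; have NM : (N <= M)%N := leq_maxl _ _.
have hM := hM0 M (leq_maxr _ _) _ (lexx _).
rewrite (_ : _ - _ = (\sum_(n < M) coef f n * (w z * phi z ^+ n) - \sum_(n < N) coef f n * (w z * phi z ^+ n))
  - w z * (\sum_(n < M) coef f n * phi z ^+ n - f (phi z))); last first.
  rewrite mulrBr mulr_sumr (eq_bigr (fun n : 'I_M => w z * (coef f n * phi z ^+ n))); first by ring.
  by move=> n _; rewrite mulrCA.
apply: (le_trans (cabsB _ _)); apply: lerD; last first.
  by rewrite cabsM (le_trans _ hM)// ler_piMl ?cabs_ge0.
rewrite -!(big_mkord xpredT (fun n => coef f n * (w z * phi z ^+ n))) (big_cat_nat (leq0n N) NM)/=.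
rewrite addrAC subrr add0r (le_trans (cabs_sum _ _ _))//.
apply: (@le_trans _ _ (\sum_(N <= k < M) (2 * hp_norm p f) * (2 / k.+1%:R - 2 / k.+2%:R))).
  apply: ler_sum => k _; rewrite cabsM; apply: ler_pM; rewrite ?cabs_ge0//.
    exact: coef_Hp_le.
  exact: weight_monomial_le.
rewrite -mulr_sumr (_ : 4 * hp_norm p f / N.+1%:R = (2 * hp_norm p f) * (2 / N.+1%:R)).
  by rewrite ler_wpM2l ?decay_sum// mulr_ge0 ?hp_norm_ge0.
by move: (hp_norm p f) (N.+1%:R^-1) => a b; ring.
Qed.

Lemma weight_monomial_Hp n : in_Hp p (fun z => w z * phi z ^+ n) /\
  hp_norm p (fun z => w z * phi z ^+ n) <= 2 / n.+1%:R - 2 / n.+2%:R.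
Proof.
apply: in_Hp_bounded => //; last exact: weight_monomial_le.
  have x01 : 0 <= (0 : R) <= 1 by rewrite lexx ler01.
  by apply: (le_trans _ (poly_decay n x01)); rewrite mulr_ge0 ?exprn_ge0 ?sqr_ge0.
by apply: poly_approxM => //; exact: poly_approxX.
Qed.

Lemma weighted_comp_approx f : in_Hp p f -> poly_approx (weighted_comp w phi f).
Proof.
by move=> /in_Hp_poly_approx fa; apply: poly_approxM => //; exact: poly_approx_comp.
Qed.

Lemma outer_weight : w 0 != 0 -> weight_Hp p phi w.
Proof.
move=> w0; have D0 : inD (0 : R[i]) by rewrite /inD cabs0.
have key f : in_Hp p f -> in_Hp p (weighted_comp w phi f) /\
    hp_norm p (weighted_comp w phi f) <= 4 * hp_norm p f.
  move=> fH; apply: in_Hp_bounded => //; first by rewrite mulr_ge0 ?hp_norm_ge0.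
    exact: weighted_comp_approx.
  by move=> z zD; have := expansion_error 0 fH zD; rewrite big_ord0 subr0 divr1.
split; last split.
- have [+ _] := weight_monomial_Hp 0; rewrite (_ : (fun z => w z * phi z ^+ 0) = w)//.
  by apply/funext => z; rewrite expr0 mulr1.
- by exists 0.
- by split; [move=> f /key[]|exists 4 => f /key[]].
Qed.

Lemma outer_nuclear : nuclear_Hp p (weighted_comp w phi).
Proof.
exists (fun n f => coef f n), (fun n z => w z * phi z ^+ n).
have dual n : dual_Hp p (fun f => coef f n).
  split.
    by move=> a f g fH gH; apply: coefD; [exact: in_Hp_poly_approx fH|exact: in_Hp_poly_approx gH].
  by exists 2 => f fH; exact: coef_Hp_le.
split => //; split; first by move=> n; case: (weight_monomial_Hp n).
split.
  (* The dual norms are at most 2 and the norms of w phi^n sum to at most 2. *)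
  apply: (@le_lt_trans _ _ (4 : R)%:E); last exact: ltry.
  have ex n : exists d : R, dual_norm p (fun f => coef f n) = d%:E /\ 0 <= d <= 2.
    have [d dE [d0 _]] := dual_norm_bound p0 (dual n); exists d; split => //; rewrite d0/=.
    rewrite -lee_fin -dE; apply: ge_ereal_sup => _ [f [fH f1] <-]; rewrite lee_fin.
    by rewrite (le_trans (coef_Hp_le n p1 fH))// ler_piMr.
  have /choice[d hd] := ex.
  have dE n : dual_norm p (fun f => coef f n) = (d n)%:E by case: (hd n).
  have d0 n : 0 <= d n by case: (hd n) => _ /andP[].
  have d2 n : d n <= 2 by case: (hd n) => _ /andP[].
  under eq_eseriesr do rewrite dE -EFinM.
  apply: nneseries_le_ub.
    by move=> n; rewrite lee_fin mulr_ge0 ?hp_norm_ge0.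
  move=> n; rewrite sumEFin lee_fin.
  apply: (@le_trans _ _ (\sum_(0 <= k < n) 2 * (2 / k.+1%:R - 2 / k.+2%:R))).
    apply: ler_sum => k _; apply: ler_pM; rewrite ?hp_norm_ge0//.
    by case: (weight_monomial_Hp k).
  rewrite -mulr_sumr (_ : 4 = 2 * (2 / 1%:R) :> R); last by field.
  by rewrite ler_pM2l// decay_sum.
move=> f fH; apply: ex_cvg0 => e e0.
have c0 : 0 <= 4 * hp_norm p f by rewrite mulr_ge0 ?hp_norm_ge0.
have E0 : 0 < e / (4 * hp_norm p f + 1) by rewrite divr_gt0// ltr_wpDl.
have [N hN] := cvg0_ex (@cvg_harmonic R) E0; exists N => n Nn.
rewrite ger0_norm ?hp_norm_ge0//.
have [_ h] : in_Hp p (fun z => weighted_comp w phi f z - \sum_(k < n) coef f k * (w z * phi z ^+ k)) /\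
  hp_norm p (fun z => weighted_comp w phi f z - \sum_(k < n) coef f k * (w z * phi z ^+ k)) <=
    4 * hp_norm p f / n.+1%:R.
  apply: in_Hp_bounded => //; first by rewrite divr_ge0.
    rewrite (_ : (fun z => _) = (fun z => weighted_comp w phi f z +
       (-1) * \sum_(k < n) coef f k * (w z * phi z ^+ k))); last by apply/funext => z; rewrite mulN1r.
    apply: poly_approxD; first exact: weighted_comp_approx.
    apply: poly_approxM; first exact: poly_approx_cst.
    apply: (@poly_approx_sum _ _ (fun k z => coef f k * (w z * phi z ^+ k))) => k.
    apply: poly_approxM; first exact: poly_approx_cst.
    by apply: poly_approxM => //; exact: poly_approxX.
  by move=> z zD; exact: expansion_error.
apply: (le_trans h).
have := hN n Nn; rewrite /= ger0_norm ?invr_ge0// => h2.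
apply: (@le_trans _ _ ((4 * hp_norm p f) * (e / (4 * hp_norm p f + 1)))).
  by rewrite ler_wpM2l// ltW.
rewrite mulrC mulrAC ler_pdivrMr; last by rewrite ltr_wpDl.
by rewrite ler_wpM2l ?(ltW e0)// lerDl.
Qed.

End WithWeight.
End OuterNuclear.

Theorem theorem5p1 (R : realType) (phi : R[i] -> R[i]) :
  analytic_on_D phi -> (forall z, inD z -> inD (phi z)) ->
  [<-> (exists w : R[i] -> R[i],
          (forall p : R, 1 <= p -> weight_Hp p phi w) /\
          (forall p : R, 1 <= p -> nuclear_Hp p (weighted_comp w phi)));
       (exists w : R[i] -> R[i],
          (forall p : R, 1 <= p -> weight_Hp p phi w) /\
          (forall p : R, 1 <= p -> summing_Hp p 1 (weighted_comp w phi)));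
       (exists (w : R[i] -> R[i]) (r p : R),
          [/\ 1 <= r, 1 <= p, weight_Hp p phi w &
              summing_Hp p r (weighted_comp w phi)]);
       (\int[lebesgue_measure]_(t in `[0%R, 1%R]) log_integrand phi t < +oo)%E].
Proof.
move=> phia phiD; have pa := analytic_poly_approx phia; tfae.
- move=> [w [ww nw]]; exists w; split; first exact: ww.
  move=> p p1; have [_ [_ [TH _]]] := ww p p1.
  exact: (@nuclear_summing R p (weighted_comp w phi) p1 TH (nw p p1)).
- move=> [w [ww sw]]; exists w, 1, 1.
  by split; [exact: lexx|exact: lexx|exact: (ww 1 (lexx 1))|exact: (sw 1 (lexx 1))].
- move=> [w [r [p [r1 p1 ww sw]]]].
  exact: (@summing_log R p r w phi r1 p1 phia phiD ww sw).
- move=> Loo; have [w [wa w0 wle pb]] := log_outer pa phiD Loo.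
  exists w; split => p p1.
    exact: (@outer_weight R phi w p p1 pa wa phiD wle pb w0).
  exact: (@outer_nuclear R phi w p p1 pa wa phiD wle pb).
Qed.
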